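(* There exist absolute constants $C, c > 0$ such that the following holds. For all integers $d, k \ge 2$ and all reals $\lambda > 0$, $\rho > 0$, $\alpha > 0$, there exists an algorithm, running in time polynomial in $n$ and $d$ (for fixed $k$), which takes as input $n$ samples in $[k]^d$ (and the parameters $\lambda, \rho, \alpha$), which is $\rho$-zCDP with respect to its input dataset, and which satisfies: for every $d$-variable pairwise graphical model $\mathcal{D}(\mathcal{W},\Theta)$ over alphabet $[k]$ (with centered weight matrices) whose width satisfies $\lambda(\mathcal{W},\Theta) \le \lambda$, if $$n \ge C\left( \frac{\lambda^2 k^5 \log(dk)\, e^{c\lambda}}{\alpha^4} + \frac{\sqrt{d}\,\lambda^2 k^{5.5} \log^2(dk)\, e^{c\lambda}}{\sqrt{\rho}\,\alpha^3}\right),$$ then given $n$ i.i.d. samples from $\mathcal{D}(\mathcal{W},\Theta)$, with probability greater than $2/3$ the algorithm outputs matrices $\widehat{W}_{i,j} \in \mathbb{R}^{k\times k}$ ($i \ne j \in [d]$) with $|W_{i,j}(u,v) - \widehat{W}_{i,j}(u,v)| \le \alpha$ for all $i \ne j \in [d]$ and all $u, v \in [k]$.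
   Context: A $d$-variable pairwise graphical model $\mathcal{D}(\mathcal{W},\Theta)$ over alphabet $[k]$ is the distribution on $[k]^d$ with $\Pr[Z = z] \propto \exp\left(\sum_{1 \le i < j \le d} W_{i,j}(z_i,z_j) + \sum_{i\in[d]} \theta_i(z_i)\right)$, where $\mathcal{W} = \{W_{i,j} \in \mathbb{R}^{k\times k} : i \ne j \in [d]\}$ satisfies $W_{i,j} = W_{j,i}^T$ and $\Theta = \{\theta_i \in \mathbb{R}^k\}$. Throughout, the weight matrices are assumed centered: every row and every column of each $W_{i,j}$ sums to zero (this is without loss of generality, as shifting row means into $\theta_i$ leaves the distribution unchanged). The width is $\lambda(\mathcal{W},\Theta) = \max_{i\in[d], a\in[k]} \left(\sum_{j \ne i} \max_{b\in[k]} |W_{i,j}(a,b)| + |\theta_i(a)|\right)$. Datasets $X, X' \in \mathcal{X}^n$ are neighboring if they differ in one element. A randomized algorithm $M$ is $\rho$-zero-concentrated differentially private ($\rho$-zCDP) if for all neighboring $X, X'$ and all $\alpha' \in (1,\infty)$, $D_{\alpha'}(M(X)\,\|\,M(X')) \le \rho\alpha'$, where $D_{\alpha'}$ is the Rényi divergence of order $\alpha'$; the privacy guarantee must hold for all datasets, not only those drawn from a graphical model. *)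

(* Defs.v *)
From HB Require Import structures.
From mathcomp Require Import all_boot all_order all_algebra.
From mathcomp Require Import all_classical all_reals all_analysis.

Set Implicit Arguments.
Unset Strict Implicit.
Unset Printing Implicit Defensive.

Import Order.TTheory GRing.Theory Num.Theory.
Import numFieldNormedType.Exports.

Local Open Scope classical_set_scope.
Local Open Scope ring_scope.

(* The alphabet is 'I_k = {0, ..., k-1}. The diagonal entries [weight i i] carry
   no information: nothing below depends on them. *)
Record graphical_model (R : realType) (d k : nat) := GraphicalModel {
  weight : 'I_d -> 'I_d -> 'M[R]_k ;
  external_field : 'I_d -> 'rV[R]_k ;
  weight_sym : forall i j, i != j -> weight i j = (weight j i)^T }.

Section GraphicalModel.
Context (R : realType) (d k : nat) (D : graphical_model R d k).

Definition centered : Prop :=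
  forall i j : 'I_d, i != j ->
    (forall a, \sum_b weight D i j a b = 0) /\
    (forall b, \sum_a weight D i j a b = 0).

Definition gibbs_weight (z : d.-tuple 'I_k) : R :=
  expR (\sum_(i < d) \sum_(j < d | (i < j)%N)
          weight D i j (tnth z i) (tnth z j)
        + \sum_(i < d) external_field D i ord0 (tnth z i)).

Definition gibbs_pmf (z : d.-tuple 'I_k) : R :=
  gibbs_weight z / \sum_(z' : d.-tuple 'I_k) gibbs_weight z'.

(* All terms are nonnegative, so 0 is a neutral default for the maxima. *)
Definition width : R :=
  \big[Num.max/0]_(i < d) \big[Num.max/0]_(a < k)
    ((\sum_(j < d | j != i) \big[Num.max/0]_(b < k) `|weight D i j a b|)
     + `|external_field D i ord0 a|).

End GraphicalModel.

Definition dataset (n d k : nat) := n.-tuple (d.-tuple 'I_k).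

Definition iid_pmf (R : realType) (n d k : nat) (D : graphical_model R d k)
    (X : dataset n d k) : R :=
  \prod_(i < n) gibbs_pmf D (tnth X i).

Definition neighboring (n : nat) (T : eqType) (X X' : n.-tuple T) : Prop :=
  #|[set i : 'I_n | tnth X i != tnth X' i]%SET| = 1%N.

(* (a - 1)^-1 * ln (E_Q [(dP/dQ)^a]), and +oo when P is not absolutely
   continuous with respect to Q. *)
Definition renyi_divergence (disp : measure_display) (T : measurableType disp)
    (R : realType) (a : R) (P Q : probability T R) : \bar R :=
  if pselect (P `<< Q) then
    (((a - 1)^-1)%:E *
      lne (\int[Q]_x (Radon_Nikodym (charge_of_finite_measure P) Q x `^ a)))%E
  else +oo%E.

Definition zCDP (disp : measure_display) (T : measurableType disp)
    (R : realType) (n : nat) (E : eqType) (rho : R)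
    (M : n.-tuple E -> probability T R) : Prop :=
  forall X X' : n.-tuple E, neighboring X X' ->
  forall a : R, 1 < a -> (renyi_divergence a (M X) (M X') <= (rho * a)%:E)%E.

(* Randomized real-RAM programs compute with exact real numbers and natural numbers at unit cost.
   The store has integer variables, integer arrays and real arrays; arrays are
   named by naturals and subscripted by finite lists of integer variables, so a
   real scalar is an array with the empty subscript. Arithmetic on integers is
   limited to addition and truncated subtraction and there is no conversion from
   reals to integers, so that a program running for t steps handles integers of
   O(t) bits beyond those of its inputs.

   All loops are bounded by an integer evaluated on loop entry. Hence every
   program halts. No polynomial-time computation is lost, since a loop running
   until some condition holds can be clocked. *)

Inductive nexp :=
  | NLit of nat
  | NVar of nat
  | NGet of nat & seq nat
  | NAdd of nexp & nexp
  | NSub of nexp & nexp.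

Inductive rexp :=
  | RNat of nexp
  | RGet of nat & seq nat
  | RAdd of rexp & rexp
  | RSub of rexp & rexp
  | RMul of rexp & rexp
  | RDiv of rexp & rexp
  | RExp of rexp
  | RLn of rexp.

Inductive bexp :=
  | BNLe of nexp & nexp
  | BRLe of rexp & rexp.

Inductive program :=
  | Skip
  | NSet of nat & nexp
  | NPut of nat & seq nat & nexp
  | RPut of nat & seq nat & rexp
  | RDraw of nat & seq nat
  | Seq of program & program
  | If of bexp & program & program
  | For of nat & nexp & program.

Fixpoint nexp_cost (e : nexp) : nat :=
  match e with
  | NLit _ | NVar _ => 1
  | NGet _ xs => (size xs).+1
  | NAdd e1 e2 | NSub e1 e2 => (nexp_cost e1 + nexp_cost e2).+1%N
  end.

Fixpoint rexp_cost (e : rexp) : nat :=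
  match e with
  | RNat e => (nexp_cost e).+1
  | RGet _ xs => (size xs).+1
  | RAdd e1 e2 | RSub e1 e2 | RMul e1 e2 | RDiv e1 e2 =>
      (rexp_cost e1 + rexp_cost e2).+1%N
  | RExp e | RLn e => (rexp_cost e).+1
  end.

Definition bexp_cost (b : bexp) : nat :=
  match b with
  | BNLe e1 e2 => (nexp_cost e1 + nexp_cost e2).+1%N
  | BRLe e1 e2 => (rexp_cost e1 + rexp_cost e2).+1%N
  end.

(* Nested tuples, rather than functions, because tuples carry the product
   sigma-algebra. *)
Notation weights_array R d k :=
  (d.-tuple (d.-tuple (k.-tuple (k.-tuple R)))).

Section Semantics.
Context (R : realType).

Definition update (T : eqType) (V : Type) (f : T -> V) (x : T) (v : V) : T -> V :=
  fun y => if y == x then v else f y.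

(* [draws] counts the random numbers consumed so far and [clock] the elapsed
   time; programs can read neither. *)
Record store := Store {
  nvar : nat -> nat ;
  narr : nat -> seq nat -> nat ;
  rarr : nat -> seq nat -> R ;
  draws : nat ;
  clock : nat }.

Definition subscript (s : store) (xs : seq nat) : seq nat := map (nvar s) xs.

Fixpoint neval (s : store) (e : nexp) : nat :=
  match e with
  | NLit m => m
  | NVar x => nvar s x
  | NGet a xs => narr s a (subscript s xs)
  | NAdd e1 e2 => (neval s e1 + neval s e2)%N
  | NSub e1 e2 => (neval s e1 - neval s e2)%N
  end.

Fixpoint reval (s : store) (e : rexp) : R :=
  match e with
  | RNat e => (neval s e)%:R
  | RGet a xs => rarr s a (subscript s xs)
  | RAdd e1 e2 => reval s e1 + reval s e2
  | RSub e1 e2 => reval s e1 - reval s e2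
  | RMul e1 e2 => reval s e1 * reval s e2
  | RDiv e1 e2 => reval s e1 / reval s e2
  | RExp e => expR (reval s e)
  | RLn e => ln (reval s e)
  end.

Definition beval (s : store) (b : bexp) : bool :=
  match b with
  | BNLe e1 e2 => (neval s e1 <= neval s e2)%N
  | BRLe e1 e2 => reval s e1 <= reval s e2
  end.

Definition tick (t : nat) (s : store) : store :=
  Store (nvar s) (narr s) (rarr s) (draws s) (t + clock s)%N.

Definition set_nvar (x v : nat) (s : store) : store :=
  Store (update (nvar s) x v) (narr s) (rarr s) (draws s) (clock s).

Definition set_narr (a : nat) (ix : seq nat) (v : nat) (s : store) : store :=
  Store (nvar s) (update (narr s) a (update (narr s a) ix v))
        (rarr s) (draws s) (clock s).

Definition set_rarr (a : nat) (ix : seq nat) (v : R) (s : store) : store :=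
  Store (nvar s) (narr s) (update (rarr s) a (update (rarr s a) ix v))
        (draws s) (clock s).

Definition incr_draws (s : store) : store :=
  Store (nvar s) (narr s) (rarr s) (draws s).+1 (clock s).

(* [tape] supplies the random numbers. *)
Fixpoint exec (tape : nat -> R) (p : program) (s : store) : store :=
  match p with
  | Skip => tick 1 s
  | NSet x e => tick (nexp_cost e).+1 (set_nvar x (neval s e) s)
  | NPut a xs e => tick (size xs + nexp_cost e).+1%N
                     (set_narr a (subscript s xs) (neval s e) s)
  | RPut a xs e => tick (size xs + rexp_cost e).+1%N
                     (set_rarr a (subscript s xs) (reval s e) s)
  | RDraw a xs => tick (size xs).+1 (incr_draws
                    (set_rarr a (subscript s xs) (tape (draws s)) s))
  | Seq p1 p2 => exec tape p2 (exec tape p1 s)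
  | If b p1 p2 => exec tape (if beval s b then p1 else p2)
                    (tick (bexp_cost b).+1 s)
  | For x e q => foldl (fun s' i => exec tape q (tick 1 (set_nvar x i s')))
                   (tick (nexp_cost e).+1 s) (iota 0 (neval s e))
  end.

(* Input convention: integer variables 0, 1, 2 hold n, d, k; integer array 0
   holds the samples, entry [:: i; j] being coordinate j of sample i; real
   scalars 0, 1, 2 hold the parameters lambda, rho, alpha; the rest is zero. *)
Definition input_store (n d k : nat) (lambda rho alpha : R)
    (X : dataset n d k) : store :=
  Store
    (nth 0%N [:: n; d; k])
    (fun a ix =>
       match a, ix with
       | 0%N, [:: i; j] =>
           match insub i, insub j with
           | Some i', Some j' => tnth (tnth X i') j' : nat
           | _, _ => 0%N
           end
       | _, _ => 0%N
       end)
    (fun a ix => if ix is [::] then nth 0 [:: lambda; rho; alpha] a else 0)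
    0%N 0%N.

(* Output convention: the matrices are the entries [:: i; j; u; v], i != j, of
   real array 3; the diagonal blocks are not part of the output. *)
Definition read_output (d k : nat) (s : store) : weights_array R d k :=
  [tuple [tuple [tuple [tuple
     if i == j then 0 else rarr s 3%N [:: i : nat; j : nat; u : nat; v : nat]
   | v < k] | u < k] | j < d] | i < d].

Definition output_entry (d k : nat) (w : weights_array R d k)
    (i j : 'I_d) (u v : 'I_k) : R :=
  tnth (tnth (tnth (tnth w i) j) u) v.

(* The law of m independent uniform random numbers in [0, 1]. *)
Definition cons_pair (m : nat) (p : measurableTypeR R * m.-tuple R) :
    m.+1.-tuple R :=
  [the m.+1.-tuple R of (p.1 : R) :: p.2].

Lemma measurable_cons_pair (m : nat) :
  measurable_fun [set: measurableTypeR R * m.-tuple R] (@cons_pair m).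
Proof. by apply: measurable_cons; [exact: measurable_fst | exact: measurable_snd]. Qed.

HB.instance Definition _ (m : nat) :=
  isMeasurableFun.Build _ _ _ _ (@cons_pair m) (@measurable_cons_pair m).

Fixpoint uniform_tape (m : nat) : probability (m.-tuple R) R :=
  match m with
  | 0%N => \d_[tuple]
  | m'.+1 => distribution (uniform_prob (@ltr01 R) \x uniform_tape m')%E
               (@cons_pair m')
  end.

(* [prog], run on n samples with the given parameters, halts within [t] steps
   whatever the dataset and the random numbers, and its output on the dataset X
   has law [M X]. As a draw takes at least one step, t random numbers suffice. *)
Definition implements (prog : program) (t n d k : nat) (lambda rho alpha : R)
    (M : dataset n d k -> probability (weights_array R d k) R) : Prop :=
  forall X : dataset n d k,
    let run tape := exec tape prog (input_store lambda rho alpha X) in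
    let output (r : t.-tuple R) : weights_array R d k :=
      read_output d k (run (nth 0 r)) in
    (forall tape, (forall i, 0 <= tape i <= 1) -> (clock (run tape) <= t)%N) /\
    measurable_fun [set: t.-tuple R] output /\
    (forall A : set (weights_array R d k), measurable A ->
       M X A = uniform_tape t (output @^-1` A)).

Definition accurate (d k : nat) (D : graphical_model R d k) (alpha : R) :
    set (weights_array R d k) :=
  [set w | forall (i j : 'I_d) (u v : 'I_k), i != j ->
     `|weight D i j u v - output_entry w i j u v| <= alpha].

(* The probability, over n i.i.d. samples from D and the randomness of M, that
   the output of M is in A. *)
Definition success_prob (n d k : nat) (D : graphical_model R d k)
    (M : dataset n d k -> probability (weights_array R d k) R)
    (A : set (weights_array R d k)) : \bar R :=
  (\sum_(X : dataset n d k) (iid_pmf D X)%:E * M X A)%E.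

End Semantics.

(* Main.v *)
Require Import Defs.
From HB Require Import structures.
From mathcomp Require Import all_boot all_order all_algebra.
From mathcomp Require Import all_classical all_reals all_analysis.
From mathcomp Require Import perm measurable_realfun ring lra zify.

(** Given the other coordinates of a sample and the event that [z_i] is [0] or
    [u], the letter [z_i] follows a logistic model whose parameter,
    [W_ij(u, .) - W_ij(0, .)] together with an intercept, lies in the ball of
    radius [2 lambda] of the norm [sum_j max_b |v(j, b)|]. For each node [i] and
    each letter [u <> 0] the algorithm minimizes the logistic loss over this ball
    by the Frank-Wolfe method. Each step moves towards a signed vertex of the
    ball drawn by the exponential mechanism, with a temperature such that the
    composition of all steps of all regressions is [rho]-zCDP.

    The log-partition function of the exponential mechanism bounds the
    Frank-Wolfe gap up to the surprisal of the drawn vertex, and weighted sums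
    of surprisals have exponential tails. Hence the empirical excess loss is
    small. By strong convexity and the deviation bounds for the gradient at the
    truth and for the second moments of the features, so is the population mean
    of the squared difference of the margins. Every letter has conditional
    probability at least [e^(-2 lambda) / k], whatever the other coordinates
    are, so this mean controls each entry of the parameter up to its mean over
    [b]. Centering in both letters then recovers [W_ij]. *)

Set Implicit Arguments.
Unset Strict Implicit.
Unset Printing Implicit Defensive.

Import Order.TTheory GRing.Theory Num.Theory.
Import numFieldNormedType.Exports.

Local Open Scope classical_set_scope.
Local Open Scope ring_scope.

(** * Logistic loss and concentration *)

(** Turning an average excess loss into a squared entrywise error costs a factor of order
    [k^2 e^(16 lambda)], so each regression aims at an average gap of order
    [alpha^2 / (k^2 e^(16 lambda))]. Half of it pays for the curvature term of Frank-Wolfe, of order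
    [lambda^2 / T], which fixes the number [T] of steps; the other half pays for the random choices,
    of order [lambda k log(dk) / (n beta)]. The [d k T] choices share the budget [rho], so [beta^2]
    is of order [rho / (d k T)], whence the rate [1 / alpha^3]. The rate [1 / alpha^4] comes from
    deviations of order gap over [lambda], uniform over all pairs of vertices. Surprisals are
    unbounded and the choices adaptive. But the mean of the exponential of a surprisal is exactly
    the number of vertices, and the Frank-Wolfe weights of the steps sum to 1, so the tail of the
    weighted sum does not degrade with [T]. The output is a function of the transcript of choices
    and may merge transcripts, so the Renyi bound for transcripts reaches the output by a
    data-processing inequality for finite laws. *)

Section Elementary.
Context (R : realType).
Implicit Types (x y m : R).

(** The function [(1 + x + x^2) e^(-x)] has derivative [x (1 - x) e^(-x)], so on [x <= 1] its
    minimum is its value 1 at 0. *)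
Lemma expR_le1Dx2 y : y <= 1 -> expR y <= 1 + y + y ^+ 2.
Proof.
move=> y1.
pose f (x : R) := (1 + x + x ^+ 2) * expR (- x).
pose df (x : R) := x * (1 - x) * expR (- x).
have fd x : is_derive x 1 f (df x).
  rewrite /f /df; apply: is_derive_eq.
  rewrite /GRing.scale /=; ring.
have fc a b : {within `[a, b], continuous f}.
  apply: continuous_subspaceT => x.
  apply: differentiable_continuous; apply/derivable1_diffP.
  exact: (@ex_derive _ _ _ _ _ _ _ (fd x)).
suff : 1 <= f y.
  by rewrite /f expRN ler_pdivlMr ?expR_gt0// mul1r.
have f0 : f 0 = 1 by rewrite /f oppr0 expR0; ring.
case: (lerP 0 y) => y0.
  have [c] := MVT_segment y0 (fun x _ => fd x) (fc 0 y).
  rewrite in_itv/= f0 => /andP[c0 cy] E.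
  rewrite -subr_ge0 E /df subr0; apply: mulr_ge0 => //.
  apply: mulr_ge0 (expR_ge0 _); apply: mulr_ge0 => //; lra.
have [c] := MVT_segment (ltW y0) (fun x _ => fd x) (fc y 0).
rewrite in_itv/= f0 => /andP[c0 cy] E.
rewrite -subr_le0 E /df sub0r mulrN oppr_le0.
apply: mulr_le0; last by lra.
rewrite -mulrA mulr_le0_ge0//; apply: mulr_ge0 (expR_ge0 _); lra.
Qed.

(** For [B <= 1] the quadratic bound on the exponential leaves only the second moment. For [B > 1]
    the crude bound [e^B <= e^(B^2)] is enough. *)
Lemma hoeffding (I : finType) (p Y : I -> R) (B : R) :
  (forall i, 0 <= p i) -> \sum_i p i = 1 -> \sum_i p i * Y i = 0 ->
  (forall i, `|Y i| <= B) -> \sum_i p i * expR (Y i) <= expR (B ^+ 2).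
Proof.
move=> p0 p1 pY YB.
have [i0 _|I0] := pickP (@predT I); last first.
  by move: p1; rewrite big_pred0// => /eqP; rewrite eq_sym oner_eq0.
have B0 : 0 <= B by apply: le_trans (YB i0).
have [B1|B1] := lerP B 1.
  apply: (@le_trans _ _ (1 + B ^+ 2)); last exact: expR_ge1Dx.
  apply: (@le_trans _ _ (\sum_i (p i + p i * Y i + p i * B ^+ 2))).
    apply: ler_sum => i _; rewrite -[X in X + _ + _]mulr1 -!mulrDr.
    apply: ler_wpM2l => //.
    have YB2 : Y i ^+ 2 <= B ^+ 2 by rewrite -[leLHS]real_normK ?num_real// lerXn2r ?nnegrE.
    apply: le_trans (lerD (lexx _) YB2).
    by apply: expR_le1Dx2; apply: le_trans (ler_norm _) (le_trans (YB i) B1).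
  by rewrite !big_split /= p1 pY -mulr_suml p1 addr0 mul1r.
apply: (@le_trans _ _ (\sum_i p i * expR (B ^+ 2))).
  apply: ler_sum => i _; apply: ler_wpM2l => //; rewrite ler_expR.
  apply: le_trans (ler_norm _) (le_trans (YB i) _); nra.
by rewrite -mulr_suml p1 mul1r.
Qed.

Definition softplus m : R := ln (1 + expR m).
Definition logistic m : R := expR m / (1 + expR m).

Lemma addr1_expR_gt0 m : 0 < 1 + expR m.
Proof. by rewrite addr_gt0 ?expR_gt0. Qed.

Lemma expR_softplus m : expR (softplus m) = 1 + expR m.
Proof. by rewrite lnK ?posrE ?addr1_expR_gt0. Qed.

Lemma logistic_gt0 m : 0 < logistic m.
Proof. by rewrite divr_gt0 ?expR_gt0 ?addr1_expR_gt0. Qed.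

Lemma logisticN m : logistic (- m) = 1 - logistic m.
Proof.
rewrite /logistic expRN; have := expR_gt0 m; have := addr1_expR_gt0 m => h1 h2.
by field; do ?[apply/andP; split]; lra.
Qed.

Lemma logistic_lt1 m : logistic m < 1.
Proof. by have := logistic_gt0 (- m); rewrite logisticN; lra. Qed.

(** The difference [softplus (m + x) - softplus m - logistic m * x] is the logarithm of the moment
    generating function of a centered Bernoulli variable scaled by [x], so Hoeffding's bound
    applies. *)
Lemma softplus_smooth m x :
  softplus (m + x) <= softplus m + logistic m * x + x ^+ 2.
Proof.
rewrite -ler_expR 2!expRD !expR_softplus.
pose q := logistic m.
pose p (b : bool) := if b then q else 1 - q.
pose Y (b : bool) := if b then (1 - q) * x else - q * x.
have q0 := logistic_gt0 m; have q1 := logistic_lt1 m.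
have : \sum_b p b * expR (Y b) <= expR (`|x| ^+ 2).
  apply: hoeffding.
  - by case; rewrite /p /q; lra.
  - by rewrite big_bool /=; lra.
  - by rewrite big_bool /=; ring.
  case; rewrite /Y normrM.
    by rewrite ler_piMl// ger0_norm /q; lra.
  by rewrite normrN ler_piMl// ger0_norm /q; lra.
rewrite real_normK ?num_real// big_bool /= => h.
have e1 := expR_gt0 m; have e2 := addr1_expR_gt0 m.
have qE : (1 + expR m) * q = expR m by rewrite /q /logistic; field; lra.
have -> : 1 + expR (m + x) =
  (1 + expR m) * expR (q * x) * (q * expR ((1 - q) * x) + (1 - q) * expR (- q * x)).
  rewrite mulNr expRN mulrBl expRB mul1r expRD.
  have : expR (q * x) != 0 by rewrite gt_eqF ?expR_gt0.
  move: (expR (q * x)) => E E0.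
  have -> : (1 + expR m) * E * (q * (expR x / E) + (1 - q) * E^-1) =
    ((1 + expR m) * q) * expR x + ((1 + expR m) - (1 + expR m) * q) by field.
  by rewrite qE; ring.
rewrite ler_wpM2l// mulr_ge0 ?expR_ge0 ?addr_ge0 ?ler01//.
Qed.

(** The Bregman divergence of the log-partition function is the Kullback-Leibler divergence of the
    Bernoulli laws with parameters [logistic m] and [logistic y]. Strong convexity then follows from
    a lower bound on this divergence, without second derivatives. *)
Lemma softplus_bregman_kl m y :
  softplus y - softplus m - logistic m * (y - m) =
  - (logistic m * ln (logistic y / logistic m)
     + (1 - logistic m) * ln ((1 - logistic y) / (1 - logistic m))).
Proof.
have h1 z : ln (logistic z) = z - softplus z.
  by rewrite /logistic ln_div ?posrE ?expR_gt0 ?addr1_expR_gt0// expRK.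
have h2 z : ln (1 - logistic z) = - softplus z.
  have -> : 1 - logistic z = (1 + expR z)^-1.
    by rewrite /logistic; have := addr1_expR_gt0 z => ?; field; lra.
  by rewrite lnV ?posrE ?addr1_expR_gt0.
have g z := logistic_gt0 z; have l z : 0 < 1 - logistic z by have := logistic_lt1 z; lra.
have E (a b : R) : 0 < a -> 0 < b -> ln (a / b) = ln a - ln b.
  by move=> a0 b0; rewrite ln_div ?posrE.
rewrite (E (logistic y) (logistic m))// (E (1 - logistic y) (1 - logistic m))//.
by rewrite !h1 !h2; ring.
Qed.

(* The Kullback-Leibler divergence of Bernoulli laws dominates their squared
   Hellinger distance, because [ln z <= 2 (sqrt z - 1)]. *)
Lemma bernoulli_kl_ge (p q : R) : 0 < p < 1 -> 0 < q < 1 ->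
  (p - q) ^+ 2 / 2 <= - (p * ln (q / p) + (1 - p) * ln ((1 - q) / (1 - p))).
Proof.
move=> /andP[p0 p1] /andP[q0 q1].
have ln_le (a b : R) : 0 < a -> 0 < b ->
    a * ln (b / a) <= 2 * (Num.sqrt (a * b) - a).
  move=> a0 b0.
  have sab : 0 < Num.sqrt (b / a) by rewrite sqrtr_gt0 divr_gt0.
  have -> : b / a = Num.sqrt (b / a) ^+ 2 by rewrite sqr_sqrtr ?divr_ge0 ?ltW.
  rewrite lnXn // mulr2n.
  have h : ln (Num.sqrt (b / a)) <= Num.sqrt (b / a) - 1.
    have -> : Num.sqrt (b / a) = 1 + (Num.sqrt (b / a) - 1) by ring.
    apply: le_trans (le_ln1Dx _) _; lra.
  have -> : Num.sqrt (a * b) = a * Num.sqrt (b / a).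
    have -> : a * b = a ^+ 2 * (b / a) by field; lra.
    by rewrite sqrtrM ?sqr_ge0// sqrtr_sqr ger0_norm// ltW.
  by nra.
have h1 := ln_le p q p0 q0.
have h2 : (1 - p) * ln ((1 - q) / (1 - p)) <= 2 * (Num.sqrt ((1 - p) * (1 - q)) - (1 - p)).
  by apply: ln_le; lra.
(* The right side is the square of the difference of the roots, and the sum of the roots is at most
   2. *)
have S (a b : R) : 0 < a < 1 -> 0 < b < 1 ->
    (a - b) ^+ 2 / 4 <= a + b - 2 * Num.sqrt (a * b).
  move=> /andP[a0 a1] /andP[b0 b1].
  rewrite (sqrtrM b (ltW a0)).
  have sa := sqr_sqrtr (ltW a0); have sb := sqr_sqrtr (ltW b0).
  have a'1 : Num.sqrt a <= 1 by rewrite -sqrtr1 ler_wsqrtr// ltW.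
  have b'1 : Num.sqrt b <= 1 by rewrite -sqrtr1 ler_wsqrtr// ltW.
  have a'0 := sqrtr_ge0 a; have b'0 := sqrtr_ge0 b.
  set u := Num.sqrt a in sa a'1 a'0 *; set v := Num.sqrt b in sb b'1 b'0 *.
  rewrite -sa -sb.
  have -> : u ^+ 2 + v ^+ 2 - 2 * (u * v) = (u - v) ^+ 2 by ring.
  have -> : (u ^+ 2 - v ^+ 2) ^+ 2 / 4 = (u - v) ^+ 2 * ((u + v) ^+ 2 / 4) by field.
  rewrite ler_piMr ?sqr_ge0//; nra.
have h3 : (p - q) ^+ 2 / 4 <= p + q - 2 * Num.sqrt (p * q) by apply: S; lra.
have h4 : ((1 - p) - (1 - q)) ^+ 2 / 4 <= (1 - p) + (1 - q) - 2 * Num.sqrt ((1 - p) * (1 - q)).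
  by apply: S; lra.
have E : ((1 - p) - (1 - q)) ^+ 2 = (p - q) ^+ 2 by ring.
by rewrite E in h4; lra.
Qed.

(** The difference is [(e^m - e^y) / ((1 + e^m) (1 + e^y))], with numerator at least
    [e^(-B) (m - y)] for [y <= m] and denominator at most [4 e^(2B)]. *)
Lemma logistic_dist_ge (B m y : R) : `|m| <= B -> `|y| <= B ->
  expR (- (3 * B)) / 4 * `|m - y| <= `|logistic m - logistic y|.
Proof.
wlog ym : m y / y <= m.
  move=> H mB yB; case/orP: (le_total y m) => h; first exact: (H m y h mB yB).
  by rewrite (distrC m) (distrC (logistic m)); exact: (H y m h yB mB).
move=> mB yB.
have B0 : 0 <= B by apply: le_trans mB.
have [m1 m2] : - B <= m /\ m <= B by apply/andP; rewrite -ler_norml.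
have [y1 y2] : - B <= y /\ y <= B by apply/andP; rewrite -ler_norml.
rewrite (ger0_norm (x := m - y)) ?subr_ge0//.
apply: le_trans (ler_norm _).
have -> : logistic m - logistic y =
    (expR m - expR y) / ((1 + expR m) * (1 + expR y)).
  rewrite /logistic; have := addr1_expR_gt0 m; have := addr1_expR_gt0 y => ? ?.
  by field; do ?[apply/andP; split]; lra.
have d : expR (- B) * (m - y) <= expR m - expR y.
  have -> : expR m = expR y * expR (m - y) by rewrite -expRD; congr expR; ring.
  rewrite -[X in _ <= _ - X]mulr1 -mulrBr.
  apply: ler_pM; rewrite ?expR_ge0 ?subr_ge0 ?ler_expR//.
  by have := expR_ge1Dx (m - y); lra.
have E1 : 1 <= expR B by rewrite -expR0 ler_expR.
have em : 1 + expR m <= 2 * expR B by have : expR m <= expR B by [rewrite ler_expR]; lra.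
have ey : 1 + expR y <= 2 * expR B by have : expR y <= expR B by [rewrite ler_expR]; lra.
have p1 := addr1_expR_gt0 m; have p2 := addr1_expR_gt0 y.
rewrite ler_pdivlMr ?mulr_gt0//; apply: le_trans d.
have -> : expR (- (3 * B)) / 4 * (m - y) * ((1 + expR m) * (1 + expR y)) =
  (expR (- (3 * B)) * ((1 + expR m) * (1 + expR y)) / 4) * (m - y) by field.
apply: ler_wpM2r; first by rewrite subr_ge0.
have -> : expR (- B) = expR (- (3 * B)) * ((2 * expR B) * (2 * expR B)) / 4.
  have -> : expR (- B) = expR (- (3 * B)) * (expR B * expR B).
    by rewrite -!expRD; congr expR; ring.
  by field.
rewrite ler_wpM2r ?invr_ge0// ler_wpM2l ?expR_ge0//.
by apply: ler_pM => //; apply: ltW.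
Qed.

(** The divergence is at least half the squared distance of the probabilities, which is at least
    [e^(-3B) / 4] times the distance of the margins: hence [e^(-6B) / 32]. *)
Lemma softplus_strong (B m x : R) : `|m| <= B -> `|m + x| <= B ->
  softplus m + logistic m * x + expR (- (6 * B)) / 32 * x ^+ 2
    <= softplus (m + x).
Proof.
move=> mB xB.
have g z : 0 < logistic z < 1 by rewrite logistic_gt0 logistic_lt1.
have := softplus_bregman_kl m (m + x); have := bernoulli_kl_ge (g m) (g (m + x)).
have -> : m + x - m = x by ring.
move=> H E; rewrite -E in H.
have D := logistic_dist_ge mB xB.
have D2 : (expR (- (3 * B)) / 4) ^+ 2 * x ^+ 2 <= (logistic m - logistic (m + x)) ^+ 2.
  rewrite -(real_normK (num_real (logistic m - _))).
  have -> : (expR (- (3 * B)) / 4) ^+ 2 * x ^+ 2 =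
     (expR (- (3 * B)) / 4 * `|m - (m + x)|) ^+ 2.
    rewrite [RHS]exprMn real_normK ?num_real//; congr (_ * _); ring.
  by rewrite lerXn2r ?nnegrE// mulr_ge0 ?divr_ge0 ?expR_ge0.
have e6 : expR (- (6 * B)) = expR (- (3 * B)) ^+ 2.
  by rewrite -expRM_natl; congr expR; ring.
rewrite e6; move: D2 H; rewrite expr_div_n.
set s := (_ - _) ^+ 2; set e := expR _ ^+ 2 => D2 H; lra.
Qed.

Lemma softplus_convex m x :
  softplus m + logistic m * x <= softplus (m + x).
Proof.
have := @softplus_strong (`|m| + `|x|) m x.
rewrite lerDl normr_ge0 ler_normD => /(_ isT isT).
apply: le_trans; rewrite lerDl mulr_ge0 ?sqr_ge0// divr_ge0 ?expR_ge0//.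
Qed.

End Elementary.

Section Concentration.
Context (R : realType).

Lemma sum_tuple_prod (T : finType) (n : nat) (F : T -> R) :
  \sum_(X : n.-tuple T) \prod_(i < n) F (tnth X i) = (\sum_x F x) ^+ n.
Proof.
transitivity (\prod_(i < n) \sum_x F x); last by rewrite prodr_const card_ord.
rewrite bigA_distr_bigA /=.
rewrite (reindex (@finfun_of_tuple T n)) /=; last first.
  exists (@tuple_of_finfun T n) => x _; [exact: finfun_of_tupleK|exact: tuple_of_finfunK].
by apply: eq_bigr => X _; apply: eq_bigr => i _; rewrite ffunE.
Qed.

Context (T : finType) (p : T -> R).
Hypotheses (p0 : forall x, 0 <= p x) (p1 : \sum_x p x = 1).

Lemma iid_deviation (n : nat) (f : T -> R) (e : R) :
  0 <= e -> \sum_x p x * f x = 0 -> (forall x, `|f x| <= 2) ->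
  \sum_(X : n.-tuple T | n%:R * e < \sum_(i < n) f (tnth X i))
     \prod_(i < n) p (tnth X i) <= expR (- (n%:R * e ^+ 2 / 16)).
Proof.
(* This [s] minimizes the Chernoff exponent [4 s^2 - s e], with value [- e^2 / 16]. *)
move=> e0 pf fB; pose s := e / 8.
have s0 : 0 <= s by rewrite divr_ge0.
have mgf : \sum_x p x * expR (s * f x) <= expR (4 * s ^+ 2).
  have -> : 4 * s ^+ 2 = (s * 2) ^+ 2 by ring.
  apply: hoeffding => //.
    rewrite -[RHS](mulr0 s) -[in RHS]pf mulr_sumr.
    by apply: eq_bigr => x _; rewrite mulrCA.
  by move=> x; rewrite normrM (ger0_norm s0) ler_wpM2l.
have M X : n%:R * e < \sum_(i < n) f (tnth X i) ->
   \prod_(i < n) p (tnth X i) <=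
   expR (- (s * (n%:R * e))) * \prod_(i < n) (p (tnth X i) * expR (s * f (tnth X i))).
  move=> h; rewrite big_split /= mulrCA -expR_sum -expRD.
  rewrite ler_peMr ?prodr_ge0// -[leLHS]expR0 ler_expR -mulr_sumr.
  by have := ler_wpM2l s0 (ltW h); lra.
apply: le_trans (ler_sum _ M) _.
rewrite -mulr_sumr.
apply: (@le_trans _ _ (expR (- (s * (n%:R * e))) * (\sum_x p x * expR (s * f x)) ^+ n)).
  apply: ler_wpM2l; first exact: expR_ge0.
  rewrite -sum_tuple_prod [leRHS](bigID (fun X : n.-tuple T => n%:R * e < \sum_(i < n) f (tnth X i))) /=.
  rewrite lerDl; apply: sumr_ge0 => X _; apply: prodr_ge0 => i _.
  by rewrite mulr_ge0 ?expR_ge0.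
apply: (@le_trans _ _ (expR (- (s * (n%:R * e))) * expR (4 * s ^+ 2) ^+ n)).
  apply: ler_wpM2l; first exact: expR_ge0.
  apply: lerXn2r; rewrite ?nnegrE ?expR_ge0//.
  by apply: sumr_ge0 => x _; rewrite mulr_ge0 ?expR_ge0.
rewrite -expRM_natl -expRD ler_expR /s.
have -> : - (e / 8 * (n%:R * e)) + n%:R * (4 * (e / 8) ^+ 2) = - (n%:R * e ^+ 2 / 16) by field.
by [].
Qed.

End Concentration.

(** * The graphical model *)

Section Gibbs.
Context (R : realType) (d k : nat) (D : graphical_model R d k.+1).
Implicit Types (z : d.-tuple 'I_k.+1) (i j : 'I_d) (a b : 'I_k.+1).

Definition resample z i a : d.-tuple 'I_k.+1 :=
  [tuple if j == i then a else tnth z j | j < d].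

Lemma tnth_resample z i a j : tnth (resample z i a) j = if j == i then a else tnth z j.
Proof. exact: tnth_mktuple. Qed.

Lemma resampleK z i a : resample (resample z i a) i (tnth z i) = z.
Proof.
apply: eq_from_tnth => j; rewrite !tnth_resample.
by case: eqP => // ->.
Qed.

Lemma resample_resample z i a b : resample (resample z i a) i b = resample z i b.
Proof. by apply: eq_from_tnth => j; rewrite !tnth_resample; case: eqP. Qed.

Definition local_field i a z : R :=
  \sum_(j < d | j != i) weight D i j a (tnth z j) + external_field D i ord0 a.

Lemma local_field_resample i a z b : local_field i a (resample z i b) = local_field i a z.
Proof.
by congr (_ + _); apply: eq_bigr => j ji; rewrite tnth_resample (negbTE ji).
Qed.

Lemma pair_sum_split (g : 'I_d -> 'I_d -> R) i :
  (forall x y, x != y -> g x y = g y x) ->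
  \sum_(x < d) \sum_(y < d | (x < y)%N) g x y =
  \sum_(y < d | y != i) g i y +
  \sum_(x < d | x != i) \sum_(y < d | (x < y)%N && (y != i)) g x y.
Proof.
move=> gs; rewrite (bigD1 i)//=.
have E x : x != i -> \sum_(y < d | (x < y)%N) g x y =
   (if (x < i)%N then g i x else 0) + \sum_(y < d | (x < y)%N && (y != i)) g x y.
  move=> xi; rewrite (bigID (fun y => y == i))/=; congr (_ + _).
  case: ifPn => ltxi.
    by rewrite (big_pred1 i) 1?gs// => y /=; case: eqP => [->|_]; rewrite ?ltxi ?andbF.
  by rewrite big_pred0// => y; case: eqP => [->|_]; rewrite ?(negbTE ltxi) ?andbF.
rewrite (eq_bigr _ E) big_split /= addrA; congr (_ + _).
rewrite [RHS](bigID (fun y : 'I_d => (i < y)%N))/=; congr (_ + _).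
  by apply: eq_bigl => y; rewrite neq_ltn orbC; case: ltngtP.
rewrite -big_mkcondr; apply: eq_bigl => y.
by rewrite -leqNgt -val_eqE/= ltn_neqAle andbA andbb.
Qed.

(** All dependence on the letter at [i] sits in the local field, so comparing a sample with its
    resamplings at [i] involves neither the partition function nor the interactions of other
    nodes. *)
Lemma gibbs_factor i : exists G : d.-tuple 'I_k.+1 -> R,
  (forall z, 0 <= G z) /\ (forall z a, G (resample z i a) = G z) /\
  forall z, gibbs_pmf D z = expR (local_field i (tnth z i) z) * G z.
Proof.
pose Z := \sum_(z' : d.-tuple 'I_k.+1) gibbs_weight D z'.
pose rest z := \sum_(x < d | x != i) \sum_(y < d | (x < y)%N && (y != i))
   weight D x y (tnth z x) (tnth z y)
   + \sum_(x < d | x != i) external_field D x ord0 (tnth z x).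
exists (fun z => expR (rest z) / Z); split; [|split].
- move=> z; rewrite divr_ge0 ?expR_ge0//; apply: sumr_ge0 => ? _; exact: expR_ge0.
- move=> z a; congr (expR _ / _); congr (_ + _).
    apply: eq_bigr => j ji; apply: eq_bigr => j' /andP[_ j'i].
    by rewrite !tnth_resample (negbTE ji) (negbTE j'i).
  by apply: eq_bigr => j ji; rewrite tnth_resample (negbTE ji).
move=> z; rewrite /gibbs_pmf -/Z mulrA -expRD; congr (expR _ / _).
rewrite (@pair_sum_split (fun x y => weight D x y (tnth z x) (tnth z y)) i); last first.
  by move=> x y xy; rewrite weight_sym// mxE.
rewrite [X in _ + X](bigD1 i)//= /local_field /rest; ring.
Qed.

Lemma gibbs_weight_gt0 z : 0 < gibbs_weight D z.
Proof. exact: expR_gt0. Qed.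

Lemma gibbs_total_gt0 : 0 < \sum_(z : d.-tuple 'I_k.+1) gibbs_weight D z.
Proof.
rewrite (bigD1 [tuple ord0 | j < d])//= ltr_wpDr ?gibbs_weight_gt0//.
by apply: sumr_ge0 => z _; exact: expR_ge0.
Qed.

Lemma gibbs_pmf_ge0 z : 0 <= gibbs_pmf D z.
Proof. by rewrite divr_ge0 ?(ltW (gibbs_weight_gt0 _)) ?(ltW gibbs_total_gt0). Qed.

Lemma gibbs_pmf_sum1 : \sum_(z : d.-tuple 'I_k.+1) gibbs_pmf D z = 1.
Proof. by rewrite -mulr_suml divff// gt_eqF ?gibbs_total_gt0. Qed.

(** The map sending [(z, a)] to [(resample z i a, tnth z i)] is an involution that exchanges the two
    sides. *)
Lemma resample_sum i (F : d.-tuple 'I_k.+1 -> R) :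
  \sum_z \sum_a gibbs_pmf D (resample z i a) * F z =
  \sum_z \sum_a gibbs_pmf D z * F (resample z i a).
Proof.
rewrite !pair_big /=.
pose h (x : d.-tuple 'I_k.+1 * 'I_k.+1) := (resample x.1 i x.2, tnth x.1 i).
have hK : involutive h.
  by move=> [z a]; rewrite /h /= resampleK tnth_resample eqxx.
rewrite (reindex_inj (inv_inj hK)) /=.
by apply: eq_bigr => -[z a] _; rewrite /= resampleK.
Qed.

Context (lam : R) (widthD : width D <= lam).

Lemma row_width i a :
  \sum_(j < d | j != i) \big[Num.max/0]_(b < k.+1) `|weight D i j a b|
    + `|external_field D i ord0 a| <= lam.
Proof.
apply: le_trans widthD; rewrite /width.
apply: (le_trans _ (le_bigmax_cond _ _ (erefl : xpredT i))).
exact: (le_bigmax_cond _ (fun a => _) (erefl : xpredT a)).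
Qed.

Lemma local_field_le i a z : `|local_field i a z| <= lam.
Proof.
apply: le_trans (row_width i a); apply: le_trans (ler_normD _ _) _.
rewrite lerD2r; apply: le_trans (ler_norm_sum _ _ _) _.
apply: ler_sum => j _.
exact: (le_bigmax_cond _ (fun b => `|weight D i j a b|) (erefl : xpredT (tnth z j))).
Qed.

Lemma gibbs_resample_ge i a z :
  expR (- (2 * lam)) * gibbs_pmf D (resample z i a) <= gibbs_pmf D z.
Proof.
have [G [G0 [Gr GE]]] := gibbs_factor i.
rewrite !GE Gr mulrA ler_wpM2r// -expRD ler_expR tnth_resample eqxx local_field_resample.
have := local_field_le i a z; have := local_field_le i (tnth z i) z.
by rewrite !ler_norml => /andP[? ?] /andP[? ?]; lra.
Qed.

(** The lower bound on conditional probabilities in a form without conditioning: one coordinate may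
    be replaced by a free letter at the cost of a constant factor. *)
Lemma resample_ge i (F : d.-tuple 'I_k.+1 -> R) : (forall z, 0 <= F z) ->
  expR (- (2 * lam)) / k.+1%:R * (\sum_z gibbs_pmf D z * \sum_a F (resample z i a))
    <= \sum_z gibbs_pmf D z * F z.
Proof.
move=> F0; under eq_bigr => z _ do rewrite mulr_sumr.
rewrite -resample_sum mulr_sumr; apply: ler_sum => z _.
rewrite -mulr_suml mulrA; apply: ler_wpM2r => //.
rewrite -mulrA mulrCA mulr_sumr ler_pdivrMl ?ltr0n//.
apply: le_trans (ler_sum _ (fun a _ => gibbs_resample_ge i a z)) _.
by rewrite sumr_const card_ord mulr_natl.
Qed.

End Gibbs.

(** * The group norm and the logistic loss *)

Section Features.
Context (R : realType) (d k : nat).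
Implicit Types (v w : 'I_d -> 'I_k.+1 -> R) (x : 'I_d -> 'I_k.+1).

(* The slot of the node [i] itself carries the intercept. *)
Definition feature (i : 'I_d) (z : d.-tuple 'I_k.+1) (j : 'I_d) : 'I_k.+1 :=
  if j == i then ord0 else tnth z j.

Definition margin w x : R := \sum_(j < d) w j (x j).

Definition sgn (s : bool) : R := if s then 1 else -1.

Notation pattern := {ffun 'I_k.+1 -> bool}.

(* The ball of radius [c] of the norm [sum_j max_b |v j b|]. *)
Definition inball (c : R) v :=
  exists M : 'I_d -> R, (forall j b, `|v j b| <= M j) /\ \sum_j M j <= c.

Lemma norm_sgn s : `|sgn s| = 1.
Proof. by case: s; rewrite /sgn ?normrN normr1. Qed.

Lemma margin_le c v x : inball c v -> `|margin v x| <= c.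
Proof.
move=> [M [vM Mc]]; apply: le_trans Mc; apply: le_trans (ler_norm_sum _ _ _) _.
exact: ler_sum.
Qed.

Lemma inballD c1 c2 v w : inball c1 v -> inball c2 w ->
  inball (c1 + c2) (fun j b => v j b + w j b).
Proof.
move=> [M [vM Mc]] [N [wN Nc]]; exists (fun j => M j + N j); split.
  by move=> j b; rewrite (le_trans (ler_normD _ _))// lerD.
by rewrite big_split /= lerD.
Qed.

Lemma inballZ c a v : inball c v -> inball (`|a| * c) (fun j b => a * v j b).
Proof.
move=> [M [vM Mc]]; exists (fun j => `|a| * M j); split.
  by move=> j b; rewrite normrM ler_wpM2l.
by rewrite -mulr_sumr ler_wpM2l.
Qed.

Lemma inballB c1 c2 v w : inball c1 v -> inball c2 w ->
  inball (c1 + c2) (fun j b => v j b - w j b).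
Proof.
move=> hv [N [wN Nc]]; apply: inballD hv _; exists N; split => // j b.
by rewrite normrN.
Qed.

Lemma inball_le c v j b : inball c v -> `|v j b| <= c.
Proof.
move=> [M [vM Mc]]; apply: le_trans Mc; apply: le_trans (vM j b) _.
rewrite (bigD1 j)//= lerDl sumr_ge0// => j' _.
exact: le_trans (vM j' ord0).
Qed.

(* Linear functionals on the ball are maximal at a signed vertex. *)
Lemma inball_dual (S : finType) (r : S -> R) (x : S -> 'I_d -> 'I_k.+1) (B c : R) v :
  0 <= B ->
  (forall j (s : pattern), \sum_t r t * sgn (s (x t j)) <= B) ->
  inball c v -> \sum_t r t * margin v (x t) <= c * B.
Proof.
move=> B0 rB [M [vM Mc]].
under eq_bigr => t _ do rewrite mulr_sumr.
rewrite exchange_big /=; apply: le_trans (ler_wpM2r B0 Mc); rewrite mulr_suml.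
apply: ler_sum => j _.
pose G b := \sum_(t | x t j == b) r t.
have part (f : 'I_k.+1 -> R) : \sum_t r t * f (x t j) = \sum_b f b * G b.
  rewrite (partition_big (fun t => x t j) xpredT)//=; apply: eq_bigr => b _.
  by rewrite /G mulr_sumr; apply: eq_bigr => t /eqP ->; rewrite mulrC.
(* The signs of the total coefficients of the letters turn a sum of absolute values into the value
   at one signed vertex. *)
rewrite part; pose s : pattern := [ffun b => 0 <= G b].
apply: (@le_trans _ _ (M j * \sum_t r t * sgn (s (x t j)))); last first.
  by rewrite ler_wpM2l// (le_trans _ (vM j ord0)).
rewrite (part (fun b => sgn (s b))) mulr_sumr; apply: ler_sum => b _.
have -> : sgn (s b) * G b = `|G b|.
  rewrite /sgn ffunE; case: (lerP 0 (G b)) => h; first by rewrite ger0_norm ?mul1r.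
  by rewrite ltr0_norm ?mulN1r.
by apply: le_trans (ler_norm _) _; rewrite normrM ler_wpM2r.
Qed.

Definition vertex (j : 'I_d) (s : pattern) : 'I_d -> 'I_k.+1 -> R :=
  fun j' b => if j' == j then sgn (s b) else 0.

Lemma margin_vertex j s x : margin (vertex j s) x = sgn (s (x j)).
Proof.
rewrite /margin (bigD1 j)//= /vertex eqxx big1 ?addr0// => j' h.
by rewrite (negbTE h).
Qed.

Lemma inball_vertex j s : inball 1 (vertex j s).
Proof.
exists (fun j' => (j' == j)%:R); split.
  by move=> j' b; rewrite /vertex; case: eqP; rewrite ?norm_sgn ?normr0.
by rewrite (bigD1 j)//= eqxx big1 ?addr0// => j' /negbTE ->.
Qed.

Lemma marginB v w x : margin (fun j b => v j b - w j b) x = margin v x - margin w x.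
Proof. by rewrite /margin sumrB. Qed.

Lemma marginZ a v x : margin (fun j b => a * v j b) x = a * margin v x.
Proof. by rewrite /margin mulr_sumr. Qed.

(** Minus the derivative of [loss] with respect to the margin. *)
Definition residual (i : 'I_d) (u : 'I_k.+1) (z : d.-tuple 'I_k.+1) (m : R) : R :=
  (tnth z i == u)%:R * logistic (- m) - (tnth z i == ord0)%:R * logistic m.

Definition selected (i : 'I_d) (u : 'I_k.+1) (z : d.-tuple 'I_k.+1) : R :=
  (tnth z i == u)%:R + (tnth z i == ord0)%:R.

Definition loss (i : 'I_d) (u : 'I_k.+1) (z : d.-tuple 'I_k.+1) (m : R) : R :=
  (tnth z i == u)%:R * softplus (- m) + (tnth z i == ord0)%:R * softplus m.

Lemma selected_bounds i u z : u != ord0 -> 0 <= selected i u z <= 1.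
Proof.
move=> u0; rewrite /selected; case: eqP => [->|_]; first by rewrite (negbTE u0) addr0 ler01/=.
by case: eqP; rewrite add0r ?lexx ?ler01.
Qed.

Lemma residual_le i u z m : u != ord0 -> `|residual i u z m| <= 1.
Proof.
move=> u0; rewrite /residual; have := logistic_gt0 m; have := logistic_lt1 m.
rewrite logisticN; case: eqP => [->|_]; first by rewrite (negbTE u0) /= mulr1n mulr0n => *; rewrite ler_norml; lra.
by case: eqP => _ /=; rewrite ?mulr1n ?mulr0n => *; rewrite ler_norml; lra.
Qed.

Lemma loss_smooth i u z (m x : R) : u != ord0 ->
  loss i u z (m + x) <= loss i u z m - residual i u z m * x + x ^+ 2.
Proof.
move=> u0; rewrite /loss /residual; have := softplus_smooth m x.
have := softplus_smooth (- m) (- x); rewrite -opprD sqrrN.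
have := sqr_ge0 x.
case: eqP => [->|_]; first by rewrite (negbTE u0) /= mulr1n mulr0n; lra.
by case: eqP => _ /=; rewrite ?mulr1n ?mulr0n; lra.
Qed.

Lemma loss_strong i u z (B m x : R) : `|m| <= B -> `|m + x| <= B ->
  loss i u z m - residual i u z m * x + selected i u z * (expR (- (6 * B)) / 32 * x ^+ 2)
    <= loss i u z (m + x).
Proof.
move=> mB xB; rewrite /loss /residual /selected; have := softplus_strong mB xB.
have := @softplus_strong _ B (- m) (- x); rewrite -opprD !normrN => /(_ mB xB).
rewrite sqrrN; set e := expR _ / 32 * _.
set a := (_ == u)%:R; set b := (_ == ord0)%:R => h1 h2.
have a0 : 0 <= a by []. have b0 : 0 <= b by [].
have := ler_wpM2l a0 h1; have := ler_wpM2l b0 h2; lra.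
Qed.

Lemma loss_convex i u z (m x : R) :
  loss i u z m - residual i u z m * x <= loss i u z (m + x).
Proof.
rewrite /loss /residual; have h2 := softplus_convex m x.
have h1 := softplus_convex (- m) (- x); rewrite -opprD in h1.
set a := (_ == u)%:R; set b := (_ == ord0)%:R.
have a0 : 0 <= a by []. have b0 : 0 <= b by [].
have := ler_wpM2l a0 h1; have := ler_wpM2l b0 h2; lra.
Qed.

End Features.

(** * Optimality and identifiability of the true parameter *)

Section Population.
Context (R : realType) (d k : nat) (D : graphical_model R d k.+1).
Context (lam : R) (widthD : width D <= lam).
Implicit Types (z : d.-tuple 'I_k.+1).

Definition true_point (i : 'I_d) (u : 'I_k.+1) (j : 'I_d) (b : 'I_k.+1) : R :=
  if j == i then external_field D i ord0 u - external_field D i ord0 ord0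
  else weight D i j u b - weight D i j ord0 b.

Lemma margin_true_point i u z :
  margin (true_point i u) (feature i z) = local_field D i u z - local_field D i ord0 z.
Proof.
rewrite /margin (bigD1 i)//= /true_point eqxx /local_field.
rewrite [X in _ + X = _](eq_bigr (fun j => weight D i j u (tnth z j) - weight D i j ord0 (tnth z j))).
  by rewrite sumrB; ring.
by move=> j ji; rewrite /feature (negbTE ji).
Qed.

(** The letters [u] and [ord0] use up one width each; the intercept fits in the same budget because
    the width includes the external field. *)
Lemma inball_true_point i u : inball (2 * lam) (true_point i u).
Proof.
pose mx a j := \big[Num.max/0]_(b < k.+1) `|weight D i j a b|.
exists (fun j => if j == i then `|external_field D i ord0 u| + `|external_field D i ord0 ord0|
   else mx u j + mx ord0 j); split.
  move=> j b; rewrite /true_point; case: eqP => _; first exact: ler_normB.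
  apply: le_trans (ler_normB _ _) _; apply: lerD.
    exact: (le_bigmax_cond _ (fun b => `|weight D i j u b|) (erefl : xpredT b)).
  exact: (le_bigmax_cond _ (fun b => `|weight D i j ord0 b|) (erefl : xpredT b)).
rewrite (bigD1 i)//= eqxx.
rewrite (eq_bigr (fun j => mx u j + mx ord0 j)); last by move=> j /negbTE ->.
have := row_width widthD i u; have := row_width widthD i ord0.
by rewrite big_split /= -/(mx _ _) => h1 h2; rewrite /mx; lra.
Qed.

Lemma feature_resample i z a : feature i (resample z i a) =1 feature i z.
Proof. by move=> j; rewrite /feature tnth_resample; case: eqP. Qed.

Lemma eq_margin (w : 'I_d -> 'I_k.+1 -> R) x y : x =1 y -> margin w x = margin w y.
Proof. by move=> xy; apply: eq_bigr => j _; rewrite xy. Qed.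

(* Swapping the letters [u] and [ord0] at node [i] pairs off opposite terms. *)
Lemma residual_mean0 i u (h : ('I_d -> 'I_k.+1) -> R) : u != ord0 ->
  (forall x y, x =1 y -> h x = h y) ->
  \sum_z gibbs_pmf D z *
    (residual i u z (margin (true_point i u) (feature i z)) * h (feature i z)) = 0.
Proof.
move=> u0 hx.
pose F z := gibbs_pmf D z *
    (residual i u z (margin (true_point i u) (feature i z)) * h (feature i z)).
rewrite -[LHS]/(\sum_z F z); pose S z := resample z i (tperm ord0 u (tnth z i)).
have SK : involutive S.
  move=> z; rewrite /S tnth_resample eqxx tpermK resample_resample.
  by apply: eq_from_tnth => j; rewrite tnth_resample; case: eqP => [->|].
have E : \sum_z F z = \sum_z F (S z) by rewrite (reindex_inj (inv_inj SK)).
suff : \sum_z (F z + F (S z)) = 0.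
  by rewrite big_split /= -E => ?; lra.
apply: big1 => z _; rewrite /F.
have [G [_ [Gr GE]]] := gibbs_factor D i.
rewrite (hx _ _ (feature_resample _ _ _)) (eq_margin _ (feature_resample _ _ _)).
rewrite margin_true_point /residual !GE /S Gr tnth_resample eqxx local_field_resample.
set fu := local_field D i u z; set f0 := local_field D i ord0 z.
(* Detailed balance: both sides are [e^(fu + f0) / (e^fu + e^f0)]. *)
have lg : expR fu * logistic (- (fu - f0)) = expR f0 * logistic (fu - f0).
  rewrite logisticN /logistic expRB.
  have := expR_gt0 f0; have := expR_gt0 fu => h1 h2.
  by field; do ?[apply/andP; split]; rewrite ?gt_eqF//; lra.
case: (eqVneq (tnth z i) u) => [->|zu].
  rewrite tpermR eqxx (negbTE u0) eq_sym (negbTE u0) -/fu -/f0 !mul1r !mul0r subr0 sub0r.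
  have -> : expR fu * G z * (logistic (- (fu - f0)) * h (feature i z)) =
    (expR fu * logistic (- (fu - f0))) * G z * h (feature i z) by ring.
  by rewrite lg; ring.
case: (eqVneq (tnth z i) ord0) => [->|z0].
  rewrite tpermL eqxx (negbTE u0) -/fu -/f0 !mul1r !mul0r subr0 sub0r.
  have -> : expR fu * G z * (logistic (- (fu - f0)) * h (feature i z)) =
    (expR fu * logistic (- (fu - f0))) * G z * h (feature i z) by ring.
  by rewrite lg; ring.
rewrite tpermD; [|by rewrite eq_sym|by rewrite eq_sym].
by rewrite (negbTE zu) (negbTE z0) !mul0r subr0 mul0r mulr0 addr0.
Qed.

(** Two resamplings, each costing [e^(-2 lambda) / k]. Setting node [i] to [u] selects the sample
    without moving its margin, as the features ignore the letter at [i]. Freeing node [j] then lets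
    the margin run through [C + w j a] with [C] unknown, so only the deviation of [w j] from its
    mean can be detected. *)
Lemma second_moment_ge i u j (w : 'I_d -> 'I_k.+1 -> R) b : j != i ->
  expR (- (4 * lam)) / k.+1%:R ^+ 2 * (w j b - (\sum_b' w j b') / k.+1%:R) ^+ 2 <=
  \sum_z gibbs_pmf D z * (selected R i u z * margin w (feature i z) ^+ 2).
Proof.
move=> ji.
have s0 z : 0 <= selected R i u z by rewrite /selected addr_ge0.
have s1 z : 1 <= selected R i u (resample z i u).
  by rewrite /selected tnth_resample !eqxx lerDl.
apply: le_trans _ (resample_ge widthD i (fun z => mulr_ge0 (s0 z) (sqr_ge0 _))).
set c := expR (- (2 * lam)) / k.+1%:R.
have c0 : 0 <= c by rewrite divr_ge0 ?expR_ge0.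
apply: (@le_trans _ _ (c * (\sum_z gibbs_pmf D z * margin w (feature i z) ^+ 2))); last first.
  apply: ler_wpM2l => //; apply: ler_sum => z _; apply: ler_wpM2l; first exact: gibbs_pmf_ge0.
  rewrite (bigD1 u)//= -[leLHS]addr0; apply: lerD; last first.
    by apply: sumr_ge0 => a _; rewrite mulr_ge0 ?s0 ?sqr_ge0.
  by rewrite (eq_margin _ (feature_resample _ _ _)) ler_peMl ?sqr_ge0.
apply: (@le_trans _ _ (c * (c * (w j b - (\sum_b' w j b') / k.+1%:R) ^+ 2))).
  rewrite mulrA; apply: ler_wpM2r; rewrite ?sqr_ge0//.
  have -> : expR (- (4 * lam)) = expR (- (2 * lam)) * expR (- (2 * lam)).
    by rewrite -expRD; congr expR; ring.
  have k0 : k.+1%:R != 0 :> R by rewrite pnatr_eq0.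
  have -> // : expR (- (2 * lam)) * expR (- (2 * lam)) / k.+1%:R ^+ 2 = c * c.
  by rewrite /c; field.
apply: ler_wpM2l => //.
apply: le_trans _ (resample_ge widthD j (fun z => sqr_ge0 _)).
rewrite -/c; apply: ler_wpM2l => //.
set mu := (\sum_b' w j b') / k.+1%:R.
rewrite -[leLHS]mul1r -(gibbs_pmf_sum1 D) mulr_suml; apply: ler_sum => z _.
apply: ler_wpM2l; first exact: gibbs_pmf_ge0.
pose C := \sum_(j' < d | j' != j) w j' (feature i z j').
have mE a : margin w (feature i (resample z j a)) = C + w j a.
  rewrite /margin (bigD1 j)//= addrC /feature (negbTE ji) tnth_resample eqxx; congr (_ + _).
  by apply: eq_bigr => j' h; rewrite tnth_resample (negbTE h).
(* Expansion around the mean: the cross term sums to zero and the square involving [C] is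
   dropped. *)
rewrite (eq_bigr (fun a => (w j a - mu) ^+ 2 + 2 * (C + mu) * (w j a - mu) + (C + mu) ^+ 2)); last first.
  by move=> a _; rewrite mE; ring.
rewrite !big_split /= -mulr_sumr.
have -> : \sum_a (w j a - mu) = 0.
  rewrite sumrB sumr_const card_ord -mulr_natr /mu.
  have k0 : k.+1%:R != 0 :> R by rewrite pnatr_eq0.
  by field.
rewrite mulr0 addr0 (bigD1 b)//= -addrA lerDl addr_ge0//.
  by apply: sumr_ge0 => a _; exact: sqr_ge0.
by apply: sumr_ge0 => a _; exact: sqr_ge0.
Qed.

End Population.

(** * The Frank-Wolfe method with noisy vertices *)

Section Paths.
Context (R : realType) (V : Type).
Implicit Types (f p : seq V -> V -> R) (h s : seq V).

(** Each term sees the whole history before it, starting from [h]; adaptive choices enter in this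
    way. *)
Fixpoint path_sum f h s : R :=
  if s is a :: s' then f h a + path_sum f (rcons h a) s' else 0.

Fixpoint path_prod p h s : R :=
  if s is a :: s' then p h a * path_prod p (rcons h a) s' else 1.

Lemma path_sum_cat f h s1 s2 :
  path_sum f h (s1 ++ s2) = path_sum f h s1 + path_sum f (h ++ s1) s2.
Proof.
elim: s1 h => [|a s1 IH] h /=; first by rewrite add0r cats0.
by rewrite IH addrA cat_rcons.
Qed.

End Paths.

Section FrankWolfe.
Context (R : realType) (d k n : nat).
Notation pattern := {ffun 'I_k.+1 -> bool}.
Notation V := ('I_d * pattern)%type.
Notation point := ('I_d -> 'I_k.+1 -> R).

(** The step size [2 / (t + 2)] equals 1 at the first step, so the starting point is forgotten.
    Iterates stay in the unit ball; the radius [2 * lam] enters only in the margins. *)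
Definition fw_step (t : nat) (v : point) (a : V) : point :=
  fun j b => t%:R / (t + 2)%:R * v j b + 2 / (t + 2)%:R * @vertex R d k a.1 a.2 j b.

Definition fw_point (h : seq V) : point :=
  (foldl (fun tv a => (tv.1.+1, fw_step tv.1 tv.2 a)) (0%N, fun _ _ => 0) h).2.

Lemma fw_point_rcons h a : fw_point (rcons h a) = fw_step (size h) (fw_point h) a.
Proof.
rewrite /fw_point foldl_rcons /=; congr (fw_step _ _ _).
have H t v : (foldl (fun (tv : nat * point) (a : V) => (tv.1.+1, fw_step tv.1 tv.2 a)) (t, v) h).1 = (t + size h)%N.
  by elim: h t v => [|b h IH] t v /=; rewrite ?addn0// IH addnS.
by rewrite H.
Qed.

Lemma inball_fw_point h : inball 1 (fw_point h).
Proof.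
elim/last_ind: h => [|h a IH].
  by exists (fun _ => 0); split => [j b|]; rewrite ?normr0// big1.
rewrite fw_point_rcons /fw_step.
have [M [H1 H2]] := inballD (inballZ ((size h)%:R / (size h + 2)%:R) IH)
  (inballZ (2 / (size h + 2)%:R) (@inball_vertex R d k a.1 a.2)).
exists M; split => //; apply: le_trans H2 _.
rewrite !ger0_norm ?divr_ge0// !mulr1 -mulrDl -natrD divff//.
Qed.

Variables (lam beta : R) (i : 'I_d) (u : 'I_k.+1).
Hypotheses (lam0 : 0 < lam) (beta0 : 0 < beta) (u0 : u != ord0).
Variable X : dataset n d k.+1.

Definition fw_margin (h : seq V) (t : 'I_n) : R :=
  2 * lam * margin (fw_point h) (feature i (tnth X t)).

(** Minus the derivative of the total loss at the current iterate in the direction of the vertex [a]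
    of the unit ball. *)
Definition fw_utility (h : seq V) (a : V) : R :=
  \sum_(t < n) residual i u (tnth X t) (fw_margin h t)
     * sgn R (a.2 (feature i (tnth X t) a.1)).

Definition fw_weight (h : seq V) (a : V) : R := expR (beta * fw_utility h a).

Definition fw_total (h : seq V) : R := \sum_a fw_weight h a.

(** Minus the logarithm of the probability that the exponential mechanism selects [a]. *)
Definition fw_surprisal (h : seq V) (a : V) : R :=
  ln (fw_total h) - beta * fw_utility h a.

Definition empirical_loss (w : point) : R :=
  \sum_(t < n) loss i u (tnth X t) (margin w (feature i (tnth X t))).

Definition fw_loss (h : seq V) : R :=
  empirical_loss (fun j b => 2 * lam * fw_point h j b).

Lemma fw_weight_gt0 h a : 0 < fw_weight h a.
Proof. exact: expR_gt0. Qed.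

Lemma fw_utility_le h a : beta * fw_utility h a <= ln (fw_total h).
Proof.
rewrite -ler_expR lnK; last first.
  rewrite posrE /fw_total (bigD1 a)//= ltr_wpDr ?fw_weight_gt0//.
  by apply: sumr_ge0 => b _; apply: ltW; exact: fw_weight_gt0.
rewrite /fw_total (bigD1 a)//= lerDl; apply: sumr_ge0 => b _.
by apply: ltW; exact: fw_weight_gt0.
Qed.

(** Complementary patterns have opposite utilities, so some utility is nonnegative, and the
    log-partition function dominates every scaled utility. *)
Lemma fw_total_ln_ge0 h : 0 <= ln (fw_total h).
Proof.
have h1 := fw_utility_le h (i, [ffun => true]).
have h2 := fw_utility_le h (i, [ffun => false]).
have E : fw_utility h (i, [ffun => false]) = - fw_utility h (i, [ffun => true]).
  rewrite /fw_utility -sumrN; apply: eq_bigr => t _.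
  by rewrite /= !ffunE /sgn mulrN1 mulr1.
rewrite E in h2; lra.
Qed.

Lemma residual_dual_le h (w : point) c : inball c w ->
  \sum_(t < n) residual i u (tnth X t) (fw_margin h t) * margin w (feature i (tnth X t))
    <= c * (ln (fw_total h) / beta).
Proof.
apply: inball_dual.
  by rewrite divr_ge0 ?fw_total_ln_ge0// ltW.
move=> j s; rewrite ler_pdivlMr// mulrC.
exact: (fw_utility_le h (j, s)).
Qed.

(** A deterministic inequality, valid for every vertex [a]. Convexity bounds the excess loss by a
    linear functional, which duality bounds by the log-partition function; smoothness gives back the
    utility of [a]; the discrepancy is exactly the surprisal over [beta]. A margin moves by at most
    [4 lambda g], hence the term [16 lambda^2 g^2]. *)
Lemma fw_progress (w : point) h a (g := 2 / (size h + 2)%:R) :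
  inball (2 * lam) w ->
  fw_loss (rcons h a) - empirical_loss w <=
  (1 - g) * (fw_loss h - empirical_loss w)
  + g * (2 * lam / beta) * fw_surprisal h a + n%:R * (16 * lam ^+ 2 * g ^+ 2).
Proof.
move=> wb.
have N0 : (size h + 2)%:R != 0 :> R by rewrite pnatr_eq0 addn2.
have N1 : 0 < (size h + 2)%:R :> R by rewrite ltr0n addn2.
have g0 : 0 <= g by rewrite divr_ge0.
have gE : (size h)%:R / (size h + 2)%:R = 1 - g by rewrite /g natrD; field; rewrite -natrD.
pose x t := feature i (tnth X t).
pose r t := residual i u (tnth X t) (fw_margin h t).
pose dl t := 2 * lam * g * (sgn R (a.2 (x t a.1)) - margin (fw_point h) (x t)).
have S1 : fw_loss (rcons h a) <= \sum_(t < n) (loss i u (tnth X t) (fw_margin h t)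
    - r t * dl t + 16 * lam ^+ 2 * g ^+ 2).
  apply: ler_sum => t _.
  have -> : margin (fun j b => 2 * lam * fw_point (rcons h a) j b) (feature i (tnth X t))
     = fw_margin h t + dl t.
    rewrite marginZ fw_point_rcons /fw_margin /dl -/(x t).
    have -> : margin (fw_step (size h) (fw_point h) a) (x t) =
       (1 - g) * margin (fw_point h) (x t) + g * sgn R (a.2 (x t a.1)).
      by rewrite -gE -margin_vertex /margin /fw_step big_split /= -!mulr_sumr.
    by ring.
  apply: le_trans (loss_smooth _ _ _ _ u0) _.
  rewrite lerD2l /dl exprMn.
  have -> : 16 * lam ^+ 2 * g ^+ 2 = (2 * lam * g) ^+ 2 * 4 by ring.
  apply: ler_wpM2l; first exact: sqr_ge0.
  have h1 : `|sgn R (a.2 (x t a.1)) - margin (fw_point h) (x t)| <= 2.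
    apply: le_trans (ler_normB _ _) _; rewrite norm_sgn.
    have := margin_le (x t) (inball_fw_point h); lra.
  rewrite -(real_normK (num_real (_ - _))).
  have -> : 4 = 2 ^+ 2 :> R by ring.
  by rewrite lerXn2r ?nnegrE.
have S2 : fw_loss h - \sum_(t < n) r t * (margin w (x t) - fw_margin h t)
    <= empirical_loss w.
  rewrite -sumrB; apply: ler_sum => t _.
  rewrite marginZ -/(fw_margin h t).
  apply: le_trans (loss_convex _ _ _ _ _) _.
  by rewrite /x subrKC.
have S3 := residual_dual_le h wb.
rewrite big_split /= sumrB sumr_const card_ord -[X in _ + X]mulr_natl in S1.
have S1' : \sum_(t < n) loss i u (tnth X t) (fw_margin h t) = fw_loss h.
  by apply: eq_bigr => t _; rewrite marginZ.
rewrite S1' in S1.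
pose A := \sum_(t < n) r t * margin (fw_point h) (x t).
have E1 : \sum_(t < n) r t * dl t = 2 * lam * g * (fw_utility h a - A).
  rewrite /A /fw_utility -sumrB mulr_sumr; apply: eq_bigr => t _.
  by rewrite /dl -/(r t) -/(x t); ring.
have E2 : \sum_(t < n) r t * (margin w (x t) - fw_margin h t) =
   \sum_(t < n) r t * margin w (x t) - 2 * lam * A.
  rewrite /A mulr_sumr -sumrB; apply: eq_bigr => t _.
  by rewrite /fw_margin -/(x t); ring.
rewrite E1 in S1; rewrite E2 in S2; rewrite -/r -/x in S3.
set W := \sum_(t < n) r t * margin w (x t) in S2 S3.
have S3' : W <= 2 * lam * (ln (fw_total h) / beta) by exact: S3.
have E3 : g * (2 * lam / beta) * fw_surprisal h a =
   g * (2 * lam * (ln (fw_total h) / beta)) - 2 * lam * g * fw_utility h a.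
  by rewrite /fw_surprisal; field; rewrite gt_eqF.
rewrite E3.
have := ler_wpM2l g0 S3'; have := ler_wpM2l g0 S2; lra.
Qed.

(** With [g = 2 / (t + 2)] one has [(t + 1) (t + 2) (1 - g) = t (t + 1)], so the gaps weighted by
    [t (t + 1)] telescope. *)
Lemma fw_gap (w : point) h s : inball (2 * lam) w ->
  (size h + size s)%:R * (size h + size s).+1%:R * (fw_loss (h ++ s) - empirical_loss w) <=
  (size h)%:R * (size h).+1%:R * (fw_loss h - empirical_loss w)
  + 2 * lam / beta * path_sum (fun h a => 2 * (size h).+1%:R * fw_surprisal h a) h s
  + 64 * lam ^+ 2 * n%:R * (size s)%:R.
Proof.
move=> wb; elim: s h => [|a s IH] h /=.
  by rewrite addn0 cats0 !mulr0 !addr0.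
rewrite -cat_rcons -addSnnS; have := IH (rcons h a); rewrite size_rcons => H.
apply: le_trans H _.
have P := fw_progress h a wb; move: P => /=.
set G' := fw_loss (rcons h a) - _; set G := fw_loss h - _; set S := fw_surprisal h a.
set Q := path_sum _ _ s.
rewrite -(addn1 (size h).+1) -(addn1 (size h)) -(addn1 (size s)) !natrD.
have m0 : 0 <= (size h)%:R :> R by [].
set m := (size h)%:R in m0 *.
set ss := (size s)%:R; set nn := n%:R.
have nn0 : 0 <= nn by rewrite /nn.
move=> P.
have p2 : 0 <= (m + 1) * (m + 1 + 1) by nra.
have := ler_wpM2l p2 P.
have m2 : m + 2 != 0 by rewrite gt_eqF//; lra.
have -> : (m + 1) * (m + 1 + 1) * ((1 - 2 / (m + 2)) * G + 2 / (m + 2) * (2 * lam / beta) * S + nn * (16 * lam ^+ 2 * (2 / (m + 2)) ^+ 2)) =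
   m * (m + 1) * G + 2 * lam / beta * (2 * (m + 1) * S) + 64 * lam ^+ 2 * nn * ((m + 1) / (m + 2)).
  by field; rewrite m2 gt_eqF.
have r1 : (m + 1) / (m + 2) <= 1 by rewrite ler_pdivrMr; lra.
have c0 : 0 <= 64 * lam ^+ 2 * nn by apply: mulr_ge0 => //; apply: mulr_ge0 => //; exact: sqr_ge0.
have := ler_wpM2l c0 r1; rewrite mulr1 !mulrDr mulr1; lra.
Qed.

(** After normalization the surprisals carry nonnegative weights of total 1, as the tail bound for
    them requires. *)
Lemma fw_gap_avg (w : point) s (T : nat) : inball (2 * lam) w -> (0 < T)%N -> size s = T ->
  fw_loss s - empirical_loss w <=
  2 * lam / beta * path_sum (fun h a => 2 * (size h).+1%:R / (T%:R * T.+1%:R) * fw_surprisal h a) [::] s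
  + 64 * lam ^+ 2 * n%:R / T.+1%:R.
Proof.
move=> wb T0 sT; have := fw_gap [::] s wb; rewrite /= add0n sT mul0r mul0r add0r.
have tp : 0 < T%:R :> R by rewrite ltr0n.
have tp1 : 0 < T.+1%:R :> R by rewrite ltr0n.
move=> H.
have -> : path_sum (fun h a => 2 * (size h).+1%:R / (T%:R * T.+1%:R) * fw_surprisal h a) [::] s =
  path_sum (fun h a => 2 * (size h).+1%:R * fw_surprisal h a) [::] s / (T%:R * T.+1%:R).
  elim: s {sT H} [::] => [|a s IH] h /=; first by rewrite mul0r.
  by rewrite IH; field; rewrite !gt_eqF.
rewrite -(ler_pM2l (mulr_gt0 tp tp1)); apply: le_trans H _.
rewrite le_eqVlt; apply/orP; left; apply/eqP.
by field; rewrite !gt_eqF.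
Qed.

End FrankWolfe.

(** * Deviation events and recovery of the parameter *)

Lemma union_bound (R : realType) (T I : finType) (p : T -> R) (c : I -> T -> bool) :
  (forall x, 0 <= p x) ->
  \sum_(x | ~~ [forall y, c y x]) p x <= \sum_y \sum_(x | ~~ c y x) p x.
Proof.
move=> p0; under [leRHS]eq_bigr => y _ do rewrite big_mkcond.
rewrite exchange_big /= big_mkcond /=; apply: ler_sum => x _.
case: ifP => [|_]; last first.
  by apply: sumr_ge0 => y _; case: ifP.
rewrite negb_forall => /existsP[y cy].
by rewrite (bigD1 y)//= cy lerDl sumr_ge0// => y' _; case: ifP.
Qed.

Section Recovery.
Context (R : realType) (d k n : nat) (D : graphical_model R d k.+1).
Notation pattern := {ffun 'I_k.+1 -> bool}.
Notation V := ('I_d * pattern)%type.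
Implicit Types (z : d.-tuple 'I_k.+1) (X : dataset n d k.+1).

Definition expectation (f : d.-tuple 'I_k.+1 -> R) : R :=
  \sum_z gibbs_pmf D z * f z.

Definition sign_at i (a : V) z : R := sgn R (a.2 (feature i z a.1)).

Definition gradient_dev i u (a : V) z : R :=
  residual i u z (margin (true_point D i u) (feature i z)) * sign_at i a z.

Definition moment i u (a b : V) z : R :=
  selected R i u z * (sign_at i a z * sign_at i b z).

Definition moment_dev i u (a b : V) z : R :=
  expectation (moment i u a b) - moment i u a b z.

(** One-sided bounds suffice, since complementing a pattern changes the sign of the sum. Both
    families are indexed by the same type, so one union bound serves for both. *)
Definition deviations_le (e : R) X : bool :=
  [forall x : 'I_d * 'I_k.+1 * V * V,
     (x.1.1.2 != ord0) ==>
     (\sum_(t < n) gradient_dev x.1.1.1 x.1.1.2 x.1.2 (tnth X t) <= n%:R * e)]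
  && [forall x : 'I_d * 'I_k.+1 * V * V,
     (x.1.1.2 != ord0) ==>
     (\sum_(t < n) moment_dev x.1.1.1 x.1.1.2 x.1.2 x.2 (tnth X t) <= n%:R * e)].

Lemma moment_le i u (a b : V) z : u != ord0 -> `|moment i u a b z| <= 1.
Proof.
move=> u0; have /andP[s0 s1] := @selected_bounds R d k i u z u0.
by rewrite !normrM !norm_sgn !mulr1 ger0_norm.
Qed.

Lemma expectation_moment_le i u (a b : V) : u != ord0 ->
  `|expectation (moment i u a b)| <= 1.
Proof.
move=> u0; apply: le_trans (ler_norm_sum _ _ _) _.
rewrite -(gibbs_pmf_sum1 D); apply: ler_sum => z _.
rewrite normrM (ger0_norm (gibbs_pmf_ge0 D z)) ler_piMr ?gibbs_pmf_ge0//.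
exact: moment_le.
Qed.

Lemma deviations_prob (e : R) : 0 <= e ->
  \sum_(X : dataset n d k.+1 | ~~ deviations_le e X) iid_pmf D X <=
  (2 * (d * k.+1 * (d * 2 ^ k.+1) ^ 2))%:R * expR (- (n%:R * e ^+ 2 / 16)).
Proof.
move=> e0.
have p0 X : 0 <= iid_pmf D X by apply: prodr_ge0 => t _; exact: gibbs_pmf_ge0.
have cardI : #|{: 'I_d * 'I_k.+1 * V * V}| = (d * k.+1 * (d * 2 ^ k.+1) ^ 2)%N.
  by rewrite !card_prod card_ffun !card_ord card_bool mulnA -mulnn !mulnA.
pose dev := expR (- (n%:R * e ^+ 2 / 16)) : R.
have U (f : 'I_d * 'I_k.+1 * V * V -> d.-tuple 'I_k.+1 -> R) :
    (forall x, x.1.1.2 != ord0 -> expectation (f x) = 0) ->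
    (forall x z, x.1.1.2 != ord0 -> `|f x z| <= 2) ->
    \sum_(X : dataset n d k.+1 | ~~ [forall x, (x.1.1.2 != ord0) ==>
       (\sum_(t < n) f x (tnth X t) <= n%:R * e)]) iid_pmf D X
    <= (d * k.+1 * (d * 2 ^ k.+1) ^ 2)%:R * dev.
  move=> f0 f2; apply: le_trans (union_bound _ p0) _.
  apply: (@le_trans _ _ (\sum_(x : 'I_d * 'I_k.+1 * V * V) dev)); last first.
    by rewrite sumr_const cardI mulr_natl.
  apply: ler_sum => x _; case: (altP (x.1.1.2 =P ord0)) => x0.
    rewrite big1 ?expR_ge0// => X; by rewrite /= implybF.
  have H := iid_deviation (gibbs_pmf_ge0 D) (gibbs_pmf_sum1 D) n e0 (f0 x x0) (fun z => f2 x z x0).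
  apply: le_trans H; rewrite le_eqVlt; apply/orP; left; apply/eqP.
  by apply: eq_bigl => X; rewrite /= -ltNge.
have U1 := U (fun x => gradient_dev x.1.1.1 x.1.1.2 x.1.2).
have U2 := U (fun x => moment_dev x.1.1.1 x.1.1.2 x.1.2 x.2).
rewrite natrM -mulrA [leRHS]mulr_natl mulr2n.
apply: le_trans (lerD (U1 _ _) (U2 _ _)).
- rewrite big_mkcond [X in _ <= X + _]big_mkcond [X in _ <= _ + X]big_mkcond -big_split /=.
  apply: ler_sum => X _; rewrite /deviations_le negb_and.
  by case: (~~ [forall _, _]); case: (~~ [forall _, _]) => /=; rewrite ?addr0 ?add0r// lerDl.
- move=> x x0; apply: (residual_mean0 D x.1.1.1 (h := fun y => sgn R (x.1.2.2 (y x.1.2.1))) x0).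
  by move=> y y' ->.
- move=> x z x0; rewrite normrM norm_sgn mulr1.
  by apply: le_trans (residual_le _ _ _ x0) _; rewrite ler1n.
- move=> x x0; rewrite /expectation /moment_dev.
  under eq_bigr => z _ do rewrite mulrBr.
  by rewrite sumrB -mulr_suml gibbs_pmf_sum1 mul1r subrr.
move=> x z x0; apply: le_trans (ler_normB _ _) _.
by have := moment_le x.1.1.1 x.1.2 x.2 z x0; have := expectation_moment_le x.1.1.1 x.1.2 x.2 x0; lra.
Qed.

Context (lam : R) (widthD : width D <= lam).

(** The squared margin is bilinear in two copies of [w]. Duality over the ball, applied to each copy
    in turn, reduces it to pairs of vertices and produces the factor [c^2]. *)
Lemma moment_bilinear (e c : R) X i u (w : 'I_d -> 'I_k.+1 -> R) :
  0 <= e -> 0 <= c -> u != ord0 -> deviations_le e X -> inball c w ->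
  n%:R * expectation (fun z => selected R i u z * margin w (feature i z) ^+ 2)
  <= \sum_(t < n) selected R i u (tnth X t) * margin w (feature i (tnth X t)) ^+ 2
     + c ^+ 2 * (n%:R * e).
Proof.
move=> e0 c0 u0 /andP[_ /forallP dev] wb.
(* The signed measure by which [n] times the population exceeds the empirical counts. *)
pose mu z := n%:R * gibbs_pmf D z - \sum_(t < n) (tnth X t == z)%:R.
have muE f : \sum_z mu z * f z = n%:R * expectation f - \sum_(t < n) f (tnth X t).
  under eq_bigr => z _ do rewrite mulrBl -mulrA mulr_suml.
  rewrite sumrB -mulr_sumr; congr (_ - _).
  rewrite exchange_big /=; apply: eq_bigr => t _.
  rewrite (bigD1 (tnth X t))//= eqxx mul1r big1 ?addr0// => z h.
  by rewrite eq_sym (negbTE h) mul0r.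
have ne0 : 0 <= n%:R * e by rewrite mulr_ge0.
have H0 a b : \sum_z mu z * moment i u a b z <= n%:R * e.
  rewrite muE; have := dev (i, u, a, b); rewrite /= u0 /moment_dev sumrB.
  by rewrite sumr_const card_ord -[_ *+ n]mulr_natl.
have H1 b : \sum_z mu z * selected R i u z * sign_at i b z * margin w (feature i z) <= c * (n%:R * e).
  apply: inball_dual => // j s; apply: le_trans (H0 b (j, s)).
  by rewrite le_eqVlt; apply/orP; left; apply/eqP; apply: eq_bigr => z _; rewrite /moment /sign_at /=; ring.
have H2 : \sum_z mu z * selected R i u z * margin w (feature i z) * margin w (feature i z)
     <= c * (c * (n%:R * e)).
  apply: inball_dual => //; first by rewrite mulr_ge0.
  move=> j s; apply: le_trans (H1 (j, s)).
  by rewrite le_eqVlt; apply/orP; left; apply/eqP; apply: eq_bigr => z _; rewrite /sign_at /=; ring.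
have E : \sum_z mu z * selected R i u z * margin w (feature i z) * margin w (feature i z) =
  \sum_z mu z * (selected R i u z * margin w (feature i z) ^+ 2).
  by apply: eq_bigr => z _; ring.
rewrite E muE in H2; rewrite expr2 -mulrA; lra.
Qed.

(** The error [w] lies in the ball of radius [4 lambda], which gives the factors [4 lambda] and
    [16 lambda^2] of the deviations. Margins at most [2 lambda] give the curvature
    [e^(-12 lambda) / 32], and the passage from the second moment to an entry costs
    [k^2 e^(4 lambda)]. *)
Lemma recovery (e g : R) X i u j b (v : 'I_d -> 'I_k.+1 -> R)
    (w := fun j b => 2 * lam * v j b - true_point D i u j b) :
  0 <= e -> 0 < lam -> (0 < n)%N -> u != ord0 -> j != i -> deviations_le e X ->
  inball 1 v ->
  empirical_loss i u X (fun j b => 2 * lam * v j b)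
   - empirical_loss i u X (true_point D i u) <= n%:R * g ->
  (w j b - (\sum_b' w j b') / k.+1%:R) ^+ 2 <=
  k.+1%:R ^+ 2 * expR (4 * lam) *
   (32 * expR (12 * lam) * (g + 4 * lam * e) + 16 * lam ^+ 2 * e).
Proof.
move=> e0 lam0 n0 u0 ji dev vb gap.
have vb' : inball (2 * lam) (fun j b => 2 * lam * v j b).
  have := inballZ (2 * lam) vb; rewrite mulr1 ger0_norm//; lra.
have tb := inball_true_point widthD i u.
have wb : inball (4 * lam) w.
  by have := inballB vb' tb; congr (inball _ _); ring.
have l4 : 0 <= 4 * lam by lra.
set m := fun t : 'I_n => margin (true_point D i u) (feature i (tnth X t)).
set dm := fun t : 'I_n => margin w (feature i (tnth X t)).
have dmE t : margin (fun j b => 2 * lam * v j b) (feature i (tnth X t)) = m t + dm t.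
  by rewrite /dm /w marginB -/(m t) addrC subrK.
have S1 : empirical_loss i u X (true_point D i u)
   - \sum_(t < n) residual i u (tnth X t) (m t) * dm t
   + expR (- (12 * lam)) / 32 * \sum_(t < n) selected R i u (tnth X t) * dm t ^+ 2
   <= empirical_loss i u X (fun j b => 2 * lam * v j b).
  rewrite mulr_sumr -sumrB -big_split /=; apply: ler_sum => t _; rewrite dmE.
  have m1 : `|m t| <= 2 * lam := margin_le _ tb.
  have m2 : `|m t + dm t| <= 2 * lam by rewrite -dmE; exact: margin_le _ vb'.
  have := loss_strong i u (tnth X t) m1 m2.
  have -> : 6 * (2 * lam) = 12 * lam by ring.
  by rewrite [X in _ -> _ + X <= _]mulrCA.
have S2 : \sum_(t < n) residual i u (tnth X t) (m t) * dm t <= 4 * lam * (n%:R * e).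
  apply: inball_dual wb; first by rewrite mulr_ge0.
  by move=> j' s; have /andP[/forallP/(_ (i, u, (j', s), (j', s))) + _] := dev; rewrite /= u0.
have S3 := moment_bilinear i e0 l4 u0 dev wb.
have S4 := second_moment_ge widthD u w b ji.
rewrite -/(expectation (fun z => selected R i u z * margin w (feature i z) ^+ 2)) in S4.
set E := expectation _ in S3 S4; set Q := \sum_(t < n) _ * _ ^+ 2 in S3.
rewrite -/Q in S1.
set y := (w j b - _) ^+ 2 in S4 *.
have np : 0 < n%:R :> R by rewrite ltr0n.
have kp : 0 < k.+1%:R :> R by rewrite ltr0n.
have e12 := expR_gt0 (12 * lam).
have Q1 : Q <= 32 * expR (12 * lam) * (n%:R * g + 4 * lam * (n%:R * e)).
  have h : expR (- (12 * lam)) / 32 * Q <= n%:R * g + 4 * lam * (n%:R * e) by lra.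
  have c0 : 0 <= 32 * expR (12 * lam) by rewrite mulr_ge0// ltW.
  have := ler_wpM2l c0 h; congr (_ <= _); rewrite expRN; field; exact: lt0r_neq0.
have E1 : E <= 32 * expR (12 * lam) * (g + 4 * lam * e) + 16 * lam ^+ 2 * e.
  rewrite -(ler_pM2l np); apply: le_trans S3 _.
  have -> : n%:R * (32 * expR (12 * lam) * (g + 4 * lam * e) + 16 * lam ^+ 2 * e) =
   32 * expR (12 * lam) * (n%:R * g + 4 * lam * (n%:R * e)) + (4 * lam) ^+ 2 * (n%:R * e) by ring.
  by rewrite lerD2r.
apply: le_trans (ler_wpM2l _ E1); last by rewrite mulr_ge0 ?expR_ge0 ?sqr_ge0.
have c0 : 0 <= k.+1%:R ^+ 2 * expR (4 * lam) by rewrite mulr_ge0 ?expR_ge0 ?sqr_ge0.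
have := ler_wpM2l c0 S4; congr (_ <= _).
by rewrite expRN; field; rewrite !gt_eqF ?expR_gt0.
Qed.

End Recovery.

(** * Adaptive sampling by the exponential mechanism *)

Section TupleSums.
Context (R : realType) (V : finType).

Lemma sum_tuple0 (F : seq V -> R) : \sum_(s : 0.-tuple V) F s = F [::].
Proof.
rewrite (big_pred1 [tuple]) // => s.
by symmetry; apply/eqP; exact: tuple0.
Qed.

Lemma sum_tupleS (m : nat) (F : seq V -> R) :
  \sum_(s : m.+1.-tuple V) F s = \sum_a \sum_(s : m.-tuple V) F (a :: s).
Proof.
rewrite pair_big /=.
rewrite (reindex (fun x : V * m.-tuple V => [tuple of x.1 :: x.2])) //=.
exists (fun s : m.+1.-tuple V => (thead s, [tuple of behead s])).
  by move=> [a s] _ /=; congr (_, _); apply: val_inj.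
by move=> s _; rewrite [RHS]tuple_eta.
Qed.

End TupleSums.

Section Sampler.
Context (R : realType) (V : finType).
Implicit Types (U : seq V -> V -> R) (h s : seq V).

Definition partition_fun U h : R := \sum_a expR (U h a).
Definition gibbs_choice U h (a : V) : R := expR (U h a) / partition_fun U h.
Definition likelihood U h s : R := path_prod (gibbs_choice U) h s.
Definition surprisal U h a : R := ln (partition_fun U h) - U h a.

Lemma partition_fun_gt0 U h (a : V) : 0 < partition_fun U h.
Proof.
rewrite /partition_fun (bigD1 a)//= ltr_wpDr ?expR_gt0//.
by apply: sumr_ge0 => b _; exact: expR_ge0.
Qed.

Lemma gibbs_choice_gt0 U h a : 0 < gibbs_choice U h a.
Proof. by rewrite divr_gt0 ?expR_gt0 ?(partition_fun_gt0 U h a). Qed.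

Lemma gibbs_choice_sum1 U h (a : V) : \sum_b gibbs_choice U h b = 1.
Proof. by rewrite -mulr_suml divff// gt_eqF ?(partition_fun_gt0 U h a). Qed.

Lemma gibbs_choiceE U h a : gibbs_choice U h a = expR (- surprisal U h a).
Proof.
by rewrite /gibbs_choice /surprisal opprB expRB lnK// posrE (partition_fun_gt0 U h a).
Qed.

Lemma likelihood_gt0 U h s : 0 < likelihood U h s.
Proof.
elim: s h => [|a s IH] h; rewrite /likelihood /= ?ltr01//.
by rewrite mulr_gt0 ?gibbs_choice_gt0//; exact: IH.
Qed.

Lemma likelihood_sum1 U (m : nat) h (a : V) : \sum_(s : m.-tuple V) likelihood U h s = 1.
Proof.
elim: m h => [|m IH] h; first by rewrite sum_tuple0.
rewrite sum_tupleS -(gibbs_choice_sum1 U h a); apply: eq_bigr => b _ /=.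
by rewrite -mulr_sumr -[RHS]mulr1; congr (_ * _); exact: IH.
Qed.

Lemma expR_convex_le (w x : R) : 0 <= w <= 1 -> expR (w * x) <= 1 - w + w * expR x.
Proof.
move=> /andP[w0 w1].
have e0 := expR_gt0 (w * x).
have h1 : expR (w * x) * (1 + (1 - w) * x) <= expR x.
  have -> : expR x = expR (w * x) * expR ((1 - w) * x).
    by rewrite -expRD; congr expR; ring.
  by rewrite ler_pM2l// expR_ge1Dx.
have h2 : expR (w * x) * (1 - w * x) <= 1.
  rewrite -[leRHS](expRxMexpNx_1 (w * x)) ler_pM2l//.
  by have := expR_ge1Dx (- (w * x)).
have := ler_wpM2l w0 h1; have : 0 <= 1 - w by lra.
move=> /ler_wpM2l/(_ _ _ h2); lra.
Qed.

(** At [w = 1] each item contributes its probability times the inverse of it, so the sum is the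
    number of items whatever the utilities are. Smaller [w] follow by convexity of the
    exponential. *)
Lemma surprisal_mgf U h (w : R) (a : V) : 0 <= w <= 1 ->
  \sum_b gibbs_choice U h b * expR (w * surprisal U h b) <= expR (w * ln #|V|%:R).
Proof.
move=> w01; set N : R := #|V|%:R.
have N0 : 0 < N by rewrite ltr0n; apply/card_gt0P; exists a.
apply: (@le_trans _ _ (\sum_b gibbs_choice U h b *
    (expR (w * ln N) * (1 - w + w * expR (surprisal U h b - ln N))))).
  apply: ler_sum => b _; rewrite ler_pM2l ?gibbs_choice_gt0//.
  have -> : w * surprisal U h b = w * ln N + w * (surprisal U h b - ln N) by ring.
  by rewrite (expRD (w * ln N)) ler_pM2l ?expR_gt0// expR_convex_le.
rewrite (eq_bigr (fun b => expR (w * ln N) * ((1 - w) * gibbs_choice U h b + w / N))); last first.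
  move=> b _; rewrite gibbs_choiceE expRB (lnK (x := N)) ?posrE// expRN.
  have := expR_gt0 (surprisal U h b) => e0.
  by field; rewrite !gt_eqF.
rewrite -mulr_sumr big_split /= -mulr_sumr (gibbs_choice_sum1 U h a) sumr_const.
have -> : (w / N) *+ #|V| = w by rewrite -[_ *+ _]mulr_natr -/N divfK// gt_eqF.
by rewrite mulr1 subrK mulr1.
Qed.

(** The bound for one choice is uniform in the history, so the bounds multiply along an adaptive
    path. *)
Lemma surprisal_path_mgf U (w : nat -> R) (a : V) (m : nat) h :
  (forall t, 0 <= w t <= 1) ->
  \sum_(s : m.-tuple V) likelihood U h s *
     expR (path_sum (fun h b => w (size h) * surprisal U h b) h s)
  <= expR ((\sum_(t < m) w (size h + t)%N) * ln #|V|%:R).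
Proof.
move=> w01; elim: m h => [|m IH] h.
  by rewrite (sum_tuple0 (fun s => likelihood U h s * expR (path_sum _ h s))) /likelihood /= big_ord0 mul0r expR0 mulr1.
rewrite (sum_tupleS _ (fun s => likelihood U h s * expR (path_sum _ h s))) /=.
rewrite big_ord_recl addn0 mulrDl expRD.
apply: le_trans (ler_wpM2r (expR_ge0 _) (surprisal_mgf U h a (w01 (size h)))).
rewrite mulr_suml; apply: ler_sum => b _.
rewrite (eq_bigr (fun s : m.-tuple V => gibbs_choice U h b * expR (w (size h) * surprisal U h b) *
  (likelihood U (rcons h b) s * expR (path_sum (fun h b => w (size h) * surprisal U h b) (rcons h b) s)))); last first.
  by move=> s _; rewrite expRD /likelihood /=; ring.
rewrite -mulr_sumr ler_pM2l; last exact: (mulr_gt0 (gibbs_choice_gt0 _ _ _) (expR_gt0 _)).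
apply: le_trans (IH _) _; rewrite ler_expR size_rcons.
rewrite le_eqVlt; apply/orP; left; apply/eqP; congr (_ * _).
by apply: eq_bigr => t _; rewrite addSnnS.
Qed.

(** Markov's inequality for the exponential. As the weights total at most 1, its mean is at most the
    number of items, however long the path. *)
Lemma surprisal_tail U (w : nat -> R) (a : V) (m : nat) (x : R) :
  (forall t, 0 <= w t <= 1) -> \sum_(t < m) w t <= 1 ->
  \sum_(s : m.-tuple V | ln #|V|%:R + x <
     path_sum (fun h b => w (size h) * surprisal U h b) [::] s) likelihood U [::] s
  <= expR (- x).
Proof.
move=> w01 w1; have N1 : 1 <= #|V|%:R :> R by rewrite ler1n; apply/card_gt0P; exists a.
have H := surprisal_path_mgf U a m [::] w01; rewrite /= in H.
apply: (@le_trans _ _ (expR (- (ln #|V|%:R + x)) * expR (ln #|V|%:R))); last first.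
  by rewrite -expRD ler_expR; lra.
apply: (@le_trans _ _ (expR (- (ln #|V|%:R + x)) * (\sum_(s : m.-tuple V) likelihood U [::] s *
     expR (path_sum (fun h b => w (size h) * surprisal U h b) [::] s)))); last first.
  rewrite ler_pM2l ?expR_gt0//; apply: le_trans H _; rewrite ler_expR.
  have l0 : 0 <= ln #|V|%:R :> R by rewrite ln_ge0.
  have := ler_wpM2r l0 w1; rewrite mul1r => H1.
  by apply: le_trans H1; rewrite le_eqVlt; apply/orP; left; apply/eqP; congr (_ * _).
rewrite mulr_sumr big_mkcond /=; apply: ler_sum => s _; case: ifP => hs; last first.
  by rewrite !mulr_ge0 ?expR_ge0 ?ltW ?likelihood_gt0.
rewrite mulrCA -expRD; have l0 := likelihood_gt0 U [::] s.
rewrite ler_peMr//; first exact: ltW.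
by rewrite -[leLHS]expR0 ler_expR; move: hs; lra.
Qed.

(** The log-likelihood ratio is [F - l], and [F] deviates from its mean by at most [2B]. Hoeffding's
    bound with exponent [a - 1] controls the fluctuation and with exponent [-1] the mean, and
    [(a - 1)^2 + (a - 1) = a (a - 1)]. *)
Lemma gibbs_choice_renyi U U' h (B a : R) (v0 : V) : 1 < a ->
  (forall v, `|U h v - U' h v| <= B) ->
  \sum_v gibbs_choice U' h v * expR (a * (surprisal U' h v - surprisal U h v))
  <= expR (4 * B ^+ 2 * (a * (a - 1))).
Proof.
move=> a1 UB; pose F v := U h v - U' h v.
pose l := ln (partition_fun U h) - ln (partition_fun U' h).
have sE v : surprisal U' h v - surprisal U h v = F v - l.
  by rewrite /surprisal /F /l; ring.
pose p := gibbs_choice U h.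
pose mu := \sum_v p v * F v.
have p0 v : 0 <= p v by apply: ltW; exact: gibbs_choice_gt0.
have p1 : \sum_v p v = 1 by exact: gibbs_choice_sum1.
have B0 : 0 <= B by apply: le_trans (UB v0).
have muB : `|mu| <= B.
  apply: le_trans (ler_norm_sum _ _ _) _; rewrite -[leRHS]mul1r -p1 mulr_suml.
  apply: ler_sum => v _; rewrite normrM ger0_norm// ler_wpM2l//; exact: UB.
have H c : \sum_v p v * expR (c * (F v - mu)) <= expR (4 * B ^+ 2 * c ^+ 2).
  have -> : 4 * B ^+ 2 * c ^+ 2 = (`|c| * (2 * B)) ^+ 2.
    by rewrite exprMn real_normK ?num_real//; ring.
  apply: hoeffding => //.
    rewrite (eq_bigr (fun v => c * (p v * F v) - c * mu * p v)); last by move=> ? _; ring.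
    by rewrite sumrB -!mulr_sumr p1 -/mu mulr1 subrr.
  move=> x; rewrite normrM ler_wpM2l//; apply: le_trans (ler_normB _ _) _.
  by have := UB x; rewrite -/(F x); lra.
(* The quantity [mu - l] is the Kullback-Leibler divergence of the two choice laws. *)
have l1 : expR (mu - l) <= expR (4 * B ^+ 2).
  have := H (-1); rewrite sqrrN expr1n mulr1; apply: le_trans.
  rewrite (eq_bigr (fun v => expR mu * (gibbs_choice U' h v * expR (- l)))); last first.
    move=> v _; rewrite /p !gibbs_choiceE -!expRD; congr expR.
    by have := sE v; rewrite /F; lra.
  by rewrite -mulr_sumr -mulr_suml (gibbs_choice_sum1 U' h v0) mul1r -expRD.
rewrite ler_expR in l1.
(* Change of measure: the law of [U'] times the [a]-th power of the ratio is the law of [U] times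
   its power [a - 1]. *)
rewrite (eq_bigr (fun v => expR ((a - 1) * (mu - l)) * (p v * expR ((a - 1) * (F v - mu))))); last first.
  move=> v _; rewrite /p !gibbs_choiceE -!expRD; congr expR.
  have := sE v => e; have -> : surprisal U' h v = F v - l + surprisal U h v by lra.
  ring.
rewrite -mulr_sumr; apply: le_trans (ler_wpM2l (expR_ge0 _) (H _)) _.
rewrite -expRD ler_expR.
have a10 : 0 <= a - 1 by lra.
have := ler_wpM2l a10 l1; nra.
Qed.

(** Adaptive composition: the bound for one choice holds after every history, so it factors out of
    the sum over continuations. *)
Lemma likelihood_renyi U U' (m : nat) (B a : R) (v0 : V) h : 1 < a ->
  (forall h v, `|U h v - U' h v| <= B) ->
  \sum_(s : m.-tuple V) likelihood U' h s *
     expR (a * path_sum (fun h v => surprisal U' h v - surprisal U h v) h s)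
  <= expR (4 * B ^+ 2 * m%:R * (a * (a - 1))).
Proof.
move=> a1 UB; elim: m h => [|m IH] h.
  by rewrite (sum_tuple0 (fun s => likelihood U' h s * expR (a * path_sum _ h s))) /likelihood /= !mulr0 !mul0r expR0 mulr1.
rewrite (sum_tupleS _ (fun s => likelihood U' h s * expR (a * path_sum _ h s))) /=.
have -> : 4 * B ^+ 2 * m.+1%:R * (a * (a - 1)) =
  4 * B ^+ 2 * (a * (a - 1)) + 4 * B ^+ 2 * m%:R * (a * (a - 1)).
  by rewrite -natr1; ring.
rewrite expRD; apply: le_trans (ler_wpM2r (expR_ge0 _) (gibbs_choice_renyi v0 a1 (UB h))).
rewrite mulr_suml; apply: ler_sum => b _.
rewrite (eq_bigr (fun s : m.-tuple V => gibbs_choice U' h b * expR (a * (surprisal U' h b - surprisal U h b)) *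
  (likelihood U' (rcons h b) s * expR (a * path_sum (fun h v => surprisal U' h v - surprisal U h v) (rcons h b) s)))); last first.
  by move=> s _; rewrite mulrDr expRD /likelihood /=; ring.
by rewrite -mulr_sumr ler_pM2l; [exact: IH|exact: (mulr_gt0 (gibbs_choice_gt0 _ _ _) (expR_gt0 _))].
Qed.

Lemma likelihood_ratio U U' h s :
  likelihood U h s / likelihood U' h s =
  expR (path_sum (fun h v => surprisal U' h v - surprisal U h v) h s).
Proof.
elim: s h => [|b s IH] h; first by rewrite /likelihood /= divr1 expR0.
rewrite /= expRD -IH /likelihood /= !gibbs_choiceE expRB !expRN.
have := likelihood_gt0 U' (rcons h b) s; rewrite /likelihood => h0.
have := expR_gt0 (surprisal U h b); have := expR_gt0 (surprisal U' h b) => h1 h2.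
by field; rewrite !gt_eqF.
Qed.

End Sampler.

(** * Renyi divergence of finite mixtures *)

Section FiniteMixture.
Local Open Scope ereal_scope.
Context (disp : measure_display) (T : measurableType disp) (R : realType).
Context (H : finType) (g : H -> T).

Definition mixture_law (P : probability T R) (p : H -> R) :=
  forall A, measurable A -> P A = \sum_h (p h)%:E * \d_(g h) A.

Lemma mixture_integral (P : probability T R) (p : H -> R) (h0 : H) (f : T -> \bar R) :
  (forall h, 0 <= p h)%R -> mixture_law P p ->
  measurable_fun [set: T] f -> (forall x, 0 <= f x) ->
  \int[P]_x f x = \sum_h (p h)%:E * f (g h).
Proof.
move=> p0 PE mf f0.
have sumE (F : H -> \bar R) : \sum_(i < #|H|) F (nth h0 (enum H) i) = \sum_h F h.
  by rewrite -[RHS]big_enum (big_nth h0) big_mkord cardT.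
pose m n : {measure set T -> \bar R} :=
  mscale (NngNum (p0 (nth h0 (enum H) n))) (dirac (g (nth h0 (enum H) n)) : {measure set T -> \bar R}).
rewrite (eq_measure_integral (msum m #|H| : {measure set T -> \bar R})); last first.
  by move=> A mA _; apply: etrans (PE _ mA) _; rewrite -sumE.
rewrite ge0_integral_measure_sum// -sumE; apply: eq_bigr => i _.
rewrite ge0_integral_mscale// integral_dirac//.
by rewrite diracT mul1e.
Qed.

End FiniteMixture.

Section DataProcessing.
Context (R : realType) (H : finType) (e : rel H) (p q : H -> R).
Hypotheses (p0 : forall h, 0 < p h) (q0 : forall h, 0 < q h).
Hypothesis (ee : equivalence_rel e).

Let P h := \sum_(h' | e h h') p h'.
Let Q h := \sum_(h' | e h h') q h'.

(** Bernoulli's inequality [y^a >= 1 + a (y - 1)] at [y = e^t]. *)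
Lemma power_tangent (a t : R) : 1 < a -> 1 + a * (expR t - 1) <= expR (a * t).
Proof.
move=> a1; have et := expR_gt0 t.
have h1 : expR t * (1 + (a - 1) * t) <= expR (a * t).
  have -> : expR (a * t) = expR t * expR ((a - 1) * t) by rewrite -expRD; congr expR; ring.
  by rewrite ler_pM2l// expR_ge1Dx.
have h2 : expR t * (1 - t) <= 1.
  by rewrite -[leRHS](expRxMexpNx_1 t) ler_pM2l// expR_ge1Dx.
have h3 : 0 <= a - 1 by lra.
by have := ler_wpM2l h3 h2; lra.
Qed.

(** Data processing. The [a]-th power of the ratio of each item is bounded below by the tangent at
    the ratio of its class, and the linear terms cancel within every class. *)
Lemma coarsening_renyi (a : R) : 1 < a ->
  \sum_h q h * expR (a * ln (P h / Q h)) <= \sum_h q h * expR (a * ln (p h / q h)).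
Proof.
move=> a1.
have refl h : e h h by have [] := ee h h h.
have P0 h : 0 < P h.
  rewrite /P (bigD1 h)//= ltr_wpDr ?p0//; apply: sumr_ge0 => ? _; exact: ltW.
have Q0 h : 0 < Q h.
  rewrite /Q (bigD1 h)//= ltr_wpDr ?q0//; apply: sumr_ge0 => ? _; exact: ltW.
have eP h h' : e h h' -> P h = P h'.
  by move=> hh'; apply: eq_bigl => x; have [_ ->] := ee h h' x.
have eQ h h' : e h h' -> Q h = Q h'.
  by move=> hh'; apply: eq_bigl => x; have [_ ->] := ee h h' x.
have es h h' : e h h' = e h' h.
  apply/idP/idP => hh'.
    by have [_ <-] := ee h h' h.
  by have [_ <-] := ee h' h h'.
pose r h := expR (a * ln (P h / Q h)).
pose c h := r h * (Q h / P h).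
(* The coefficients [c] and [r] are constant on classes, and on each class both sides sum to [r]
   times its total mass under [q]. *)
have bal : \sum_h c h * p h = \sum_h r h * q h.
  transitivity (\sum_h \sum_(h' | e h h') r h / P h * (p h * q h')).
    apply: eq_bigr => h _; rewrite -mulr_sumr -mulr_sumr -/(Q h) /c.
    by field; rewrite gt_eqF.
  rewrite (exchange_big_dep xpredT)//=; apply: eq_bigr => h _.
  under eq_bigl => h' do rewrite es.
  rewrite (eq_bigr (fun h' => r h / P h * (p h' * q h))); last first.
    by move=> h' hh'; rewrite /r (eP h h')// (eQ h h').
  rewrite -mulr_sumr -mulr_suml -/(P h); field; by rewrite gt_eqF.
have S h : q h * r h + a * (c h * p h - r h * q h) <= q h * expR (a * ln (p h / q h)).
  have E1 : a * ln (p h / q h) = a * ln (P h / Q h) + a * ln ((p h / q h) * (Q h / P h)).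
    have -> : p h / q h = (P h / Q h) * ((p h / q h) * (Q h / P h)).
      by field; rewrite !gt_eqF.
    rewrite [in LHS]lnM ?posrE ?mulr_gt0 ?divr_gt0 ?invr_gt0//.
    rewrite mulrDr; congr (_ + _ * ln _); by field; rewrite !gt_eqF.
  rewrite E1 expRD -/(r h).
  have T := power_tangent (ln ((p h / q h) * (Q h / P h))) a1.
  rewrite lnK ?posrE ?mulr_gt0 ?divr_gt0 ?invr_gt0// in T.
  have qr : 0 <= q h * r h by rewrite mulr_ge0 ?expR_ge0// ltW.
  rewrite mulrA; apply: le_trans (ler_wpM2l qr T).
  rewrite le_eqVlt; apply/orP; left; apply/eqP; rewrite /c.
  by field; rewrite !gt_eqF.
apply: le_trans (ler_sum _ (fun h _ => S h)).
rewrite big_split /= -mulr_sumr sumrB bal subrr mulr0 addr0.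
by [].
Qed.

End DataProcessing.

Section RenyiFinite.
Context (disp : measure_display) (T : measurableType disp) (R : realType).
Context (H : finType) (g : H -> T) (P Q : probability T R) (p q : H -> R).
Hypotheses (p0 : forall h, 0 < p h) (q0 : forall h, 0 < q h).
Hypotheses (PE : mixture_law g P p) (QE : mixture_law g Q q).
Hypothesis mg : forall h, measurable [set g h].

Lemma mixture_point (P' : probability T R) (p' : H -> R) h : mixture_law g P' p' ->
  P' [set g h] = (\sum_(h' | `[< g h = g h' >]) p' h')%:E.
Proof.
move=> PE'; rewrite PE'// [in RHS]big_mkcond -sumEFin; apply: eq_bigr => h' _.
rewrite diracE; case: asboolP => [->|gh]; first by rewrite mem_set// mule1.
by rewrite memNset ?mule0// => /= /esym.
Qed.

Lemma renyi_finite (h0 : H) (a x : R) : 1 < a ->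
  \sum_h q h * expR (a * ln (p h / q h)) <= expR ((a - 1) * x) ->
  (renyi_divergence a P Q <= x%:E)%E.
Proof.
move=> a1 ub.
have dom : P `<< Q.
  move=> A; rewrite /null_set /= => nA B mB BA.
  have := nA _ mB BA; rewrite QE// PE// => /eqP QB.
  have qd h : (0 <= (q h)%:E * \d_(g h) B)%E by rewrite mule_ge0// lee_fin ltW.
  rewrite big1// => h _.
  move: QB; rewrite (bigD1 h)//= padde_eq0 ?qd ?sume_ge0// => /andP[+ _].
  rewrite mule_eq0 => /orP[|/eqP ->].
    by rewrite eqe gt_eqF.
  by rewrite mule0.
rewrite /renyi_divergence; case: pselect => // dom'.
set f := Radon_Nikodym _ _.
have ff y : f y \is a fin_num by apply: Radon_Nikodym_fin_num.
have mf : measurable_fun [set: T] f.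
  by have /integrableP[] := @Radon_Nikodym_integrable _ _ _ (charge_of_finite_measure P) Q dom'.
pose e h h' := `[< g h = g h' >].
pose Ps h := \sum_(h' | e h h') p h'.
pose Qs h := \sum_(h' | e h h') q h'.
have Ps0 h : 0 < Ps h.
  rewrite /Ps (bigD1 h)/=; last by apply/asboolP.
  by rewrite ltr_wpDr//; apply: sumr_ge0 => ? _; exact: ltW.
have Qs0 h : 0 < Qs h.
  rewrite /Qs (bigD1 h)/=; last by apply/asboolP.
  by rewrite ltr_wpDr//; apply: sumr_ge0 => ? _; exact: ltW.
(* A Radon-Nikodym derivative is determined only almost everywhere, but [g h] has positive mass
   under [Q], which forces its value there. *)
have fE h : f (g h) = (Ps h / Qs h)%:E.
  have E1 : P [set g h] = (\int[Q]_(y in [set g h]) f y)%E.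
    exact: (@Radon_Nikodym_integral _ _ _ (charge_of_finite_measure P) Q _ dom' (mg h)).
  have E2 : (\int[Q]_(y in [set g h]) f y = \int[Q]_(y in [set g h]) (cst (f (g h)) y))%E.
    by apply: eq_integral => y; rewrite inE /= => ->.
  have E3 : (Ps h)%:E = (f (g h) * (Qs h)%:E)%E.
    by rewrite -(mixture_point h PE) -(mixture_point h QE) E1 E2; exact: integral_cst.
  move: E3; rewrite -(fineK (ff (g h))) -EFinM => -[->].
  by rewrite mulfK// gt_eqF.
have -> : (\int[Q]_y (f y `^ a) = (\sum_h q h * expR (a * ln (Ps h / Qs h)))%:E)%E.
  rewrite (mixture_integral h0 (fun h => ltW (q0 h)) QE).
  - rewrite -sumEFin; apply: eq_bigr => h _; rewrite fE poweR_EFin EFinM.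
    by rewrite /powR gt_eqF// divr_gt0.
  - exact: (measurableT_comp (measurable_poweR a) mf).
  - by move=> y; exact: poweR_ge0.
have ee : equivalence_rel e.
  move=> h1 h2 h3; split; first exact/asboolP.
  by move=> /asboolP h12; apply/asboolP/asboolP; rewrite h12.
have C := coarsening_renyi p0 q0 ee a1; rewrite -/Ps -/Qs in C.
have S0 : 0 < \sum_h q h * expR (a * ln (Ps h / Qs h)).
  rewrite (bigD1 h0)//= ltr_wpDr ?mulr_gt0 ?expR_gt0//.
  by apply: sumr_ge0 => h _; rewrite mulr_ge0 ?expR_ge0// ltW.
rewrite lne_EFin// -EFinM lee_fin ler_pdivrMl ?subr_gt0//.
by rewrite -ler_expR lnK ?posrE//; apply: le_trans C ub.
Qed.

End RenyiFinite.

(** * Sampling from a tape of uniform numbers *)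

Section Scan.
Context (R : realType) (V : eqType) (w : V -> R).
Hypothesis w0 : forall v, 0 < w v.

(* Inverse transform sampling: the last item whose prefix sum is at most [x]. *)
Fixpoint scan (x acc : R) (cur : V) (l : seq V) : V :=
  if l is v :: l' then scan x (acc + w v) (if acc <= x then v else cur) l' else cur.

Lemma scan_below x acc cur l : x < acc -> scan x acc cur l = cur.
Proof.
elim: l acc cur => //= v l IH acc cur xa; rewrite leNgt xa /=; apply: IH.
by rewrite ltr_wpDr// ltW.
Qed.

Lemma scan_mem x acc cur l : acc <= x -> l != [::] -> scan x acc cur l \in l.
Proof.
elim: l acc cur => //= v l IH acc cur ax _; rewrite ax.
have [xy|yx] := ltP x (acc + w v); first by rewrite scan_below// mem_head.
case: l IH => [|y l] IH; first by rewrite mem_head.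
by rewrite in_cons IH ?orbT.
Qed.

Definition prefix_sum acc l v := acc + \sum_(y <- take (index v l) l) w y.

Lemma scanE x acc cur l v : uniq l -> v \in l ->
  acc <= x < acc + \sum_(y <- l) w y ->
  (scan x acc cur l == v) = (prefix_sum acc l v <= x < prefix_sum acc l v + w v).
Proof.
elim: l acc cur => //= y l IH acc cur /andP[yl ul] vl /andP[ax xs].
rewrite ax /prefix_sum /=.
have [xy|yx] := ltP x (acc + w y).
  rewrite scan_below//; case: (eqVneq y v) => [yv|yv].
    by rewrite take0 big_nil addr0 ax -yv xy.
  rewrite /= big_cons addrA; symmetry; apply/negbTE; rewrite negb_and -ltNge.
  apply/orP; left; apply: lt_le_trans xy _; rewrite lerDl; apply: sumr_ge0 => ? _; exact: ltW.
case: (eqVneq y v) vl => [<-|yv] vl.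
  rewrite take0 big_nil addr0 [in RHS]ltNge yx andbF; apply/negbTE/eqP => E.
  have l0 : l != [::].
    by apply: contraTneq xs => ->; rewrite big_seq1 -leNgt.
  by have := scan_mem y yx l0; rewrite E (negbTE yl).
rewrite in_cons eq_sym (negbTE yv) /= in vl.
rewrite /= big_cons addrA IH// yx /=.
by rewrite big_cons addrA in xs.
Qed.

End Scan.

Section ChoiceLaw.
Context (R : realType) (V : finType) (w : V -> R) (l : seq V) (v0 : V).
Hypotheses (w0 : forall v, 0 < w v) (ul : uniq l) (lV : forall v, v \in l).

Let Z := \sum_v w v.

Let ZE : \sum_(y <- l) w y = Z.
Proof.
rewrite /Z -[RHS]big_enum /=; apply: perm_big.
by apply: uniq_perm (enum_uniq _) _ => // v; rewrite lV mem_enum.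
Qed.

Let Z0 : 0 < Z.
Proof.
by rewrite /Z (bigD1 v0)//= ltr_wpDr//; apply: sumr_ge0 => ? _; exact: ltW.
Qed.

Definition choose_item (x : R) : V := scan w (x * Z) 0 v0 l.

Lemma measurable_scan (acc : R) (cur : V) (l' : seq V) v :
  measurable ([set x | scan w (x * Z) acc cur l' = v] : set (measurableTypeR R)).
Proof.
elim: l' acc cur => [|y l' IH] acc cur /=.
  by case: (eqVneq cur v) => [->|/eqP h];
   [rewrite (_ : [set _ | _] = setT)//; apply/seteqP; split
   |rewrite (_ : [set _ | _] = set0)//; apply/seteqP; split].
have -> : [set x : measurableTypeR R | scan w (x * Z) (acc + w y) (if acc <= x * Z then y else cur) l' = v] =
  (`[acc / Z, +oo[ `&` [set x | scan w (x * Z) (acc + w y) y l' = v])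
  `|` (~` `[acc / Z, +oo[ `&` [set x | scan w (x * Z) (acc + w y) cur l' = v]).
  have hx (x : R) : (x \in `[acc / Z, +oo[) = (acc <= x * Z).
    by rewrite in_itv /= andbT ler_pdivrMr.
  apply/seteqP; split => x /=; rewrite hx.
    by case: ifP => h; [left|right].
  by case=> -[h]; [rewrite h|move/negP/negbTE: h => ->].
have mi : measurable (`[acc / Z, +oo[%classic : set (measurableTypeR R)) by exact: measurable_itv.
by apply: measurableU; apply: measurableI => //; exact: measurableC.
Qed.

Lemma choose_item_law v :
  uniform_prob (@ltr01 R) [set x | choose_item x = v] = (w v / Z)%:E.
Proof.
set A := [set x | choose_item x = v].
have mA : measurable (A : set (measurableTypeR R)) by exact: measurable_scan.
pose a := prefix_sum w 0 l v / Z; pose b := (prefix_sum w 0 l v + w v) / Z.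
have p0 : 0 <= prefix_sum w 0 l v.
  by rewrite /prefix_sum add0r sumr_ge0// => ? _; exact: ltW.
have pZ : prefix_sum w 0 l v + w v <= Z.
  rewrite -ZE /prefix_sum add0r -[in leRHS](cat_take_drop (index v l) l) big_cat /=.
  rewrite lerD2l (drop_nth v0) ?index_mem// big_cons nth_index// lerDl.
  by apply: sumr_ge0 => ? _; exact: ltW.
have a0 : 0 <= a by rewrite divr_ge0// ltW.
have ab : a < b by rewrite ltr_pM2r ?invr_gt0// ltrDl.
have b1 : b <= 1 by rewrite ler_pdivrMr ?mul1r.
(* At [x = 1] the threshold is the total weight, which lies in none of the half-open intervals; this
   point is split off as a null set. *)
have AE : A `&` `[0, 1] = `[a, b[ `|` (A `&` [set 1]) :> set (measurableTypeR R).
  have inA (x : R) : 0 <= x < 1 -> (A x <-> a <= x < b).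
    move=> /andP[x0 x1]; rewrite /a /b ler_pdivrMr// ltr_pdivlMr//.
    rewrite -(@scanE _ _ w w0 (x * Z) 0 v0 l v) ?add0r ?ZE//.
      by split => [Ax|/eqP//]; exact/eqP.
    by rewrite mulr_ge0 ?(ltW Z0)//= gtr_pMl.
  apply/seteqP; split => x /=; rewrite !in_itv /=.
    move=> [Ax /andP[x0 x1]]; case: (ltgtP x 1) x1 => // [x1 _|xE _]; last by right; split.
    by left; apply/(inA x) => //; rewrite x0.
  case=> [/andP[xa xb]|[Ax xE]]; last by split=> //; rewrite xE ler01 lexx.
  have x0 : 0 <= x by apply: le_trans xa.
  have x1 : x < 1 by apply: lt_le_trans b1.
  by split; [apply/(inA x); rewrite ?x0 ?xa|rewrite x0 ltW].
have m01 : measurable (`[0, 1]%classic : set (measurableTypeR R)) by exact: measurable_itv.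
have mab : measurable (`[a, b[%classic : set (measurableTypeR R)) by exact: measurable_itv.
rewrite /uniform_prob integral_uniform_pdf.
rewrite (eq_integral (cst 1%:E)); last first.
  move=> x; rewrite inE /= in_itv /= => -[_ x01].
  by rewrite /uniform_pdf x01 subr0 invr1.
rewrite integral_cst; last exact: measurableI.
rewrite mul1e AE measureU0//.
- have L : lebesgue_measure (`[a, b[%classic : set R) = (b - a)%:E.
    by rewrite lebesgue_measure_itv /= lte_fin ab -EFinB.
  apply: etrans L _; congr EFin.
  by rewrite /a /b -mulrBl addrC addKr.
- by apply: measurableI => //; exact: measurable_set1.
apply: (@subset_measure0 _ (measurableTypeR R) R lebesgue_measure _ ([set 1] : set (measurableTypeR R))) => //.
- by apply: measurableI => //; exact: measurable_set1.
- exact: lebesgue_measure_set1.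
Qed.

End ChoiceLaw.

Section TapeLaw.
Context (R : realType) (V : finType).
Variables (choose : seq V -> R -> V) (p : seq V -> V -> R).
Hypothesis m_choose : forall h v,
  measurable ([set x | choose h x = v] : set (measurableTypeR R)).
Hypothesis choose_law : forall h v,
  uniform_prob (@ltr01 R) [set x | choose h x = v] = (p h v)%:E.

Fixpoint transcript (m : nat) (h : seq V) (r : nat -> R) : seq V :=
  if m is m'.+1 then transcript m' (rcons h (choose h (r 0%N))) (fun i => r i.+1)
  else h.

Lemma size_transcript m h r : size (transcript m h r) = (size h + m)%N.
Proof.
by elim: m h r => [|m IH] h r /=; rewrite ?addn0// IH size_rcons addSnnS.
Qed.

Lemma eq_transcript m h r r' : r =1 r' -> transcript m h r = transcript m h r'.
Proof. by elim: m h r r' => //= m IH h r r' rr; rewrite rr; apply: IH => i; exact: rr. Qed.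

(** The recursion of [transcript] consumes the tape from the front, which suits the product measure;
    a program appends its latest choice at the end. *)
Lemma transcriptS m h r :
  transcript m.+1 h r = rcons (transcript m h r) (choose (transcript m h r) (r m)).
Proof.
elim: m h r => //= m IH h r; rewrite -IH /=; congr (transcript _ _ _).
Qed.

Lemma measure_fiber (d : measure_display) (T : measurableType d) (mu : {measure set T -> \bar R})
    (F : V -> set T) : (forall v, measurable (F v)) -> trivIset [set: V] F ->
  (mu (\bigcup_v F v) = \sum_v mu (F v))%E.
Proof.
move=> mF tF; rewrite (measure_fin_bigcup _ _ tF)//; last exact: finite_finset.
rewrite -[RHS]big_enum (@fsbigE _ _ _ _ _ (enum V)) ?enum_uniq//.
  by apply: eq_bigl => v; rewrite in_setT.
by move=> v _; rewrite mem_enum.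
Qed.

Lemma measurable_transcript (m t : nat) h (B : set (seq V)) : (m <= t)%N ->
  measurable [set r : t.-tuple R | B (transcript m h (nth 0 r))].
Proof.
elim: m t h => [|m IH] t h mt /=.
  have [b|b] := pselect (B h).
    by rewrite (_ : [set _ | _] = setT)//; apply/seteqP; split.
  by rewrite (_ : [set _ | _] = set0)//; apply/seteqP; split.
case: t mt => // t mt.
have -> : [set r : t.+1.-tuple R | B (transcript m (rcons h (choose h r`_0)) (fun i => r`_i.+1))] =
  \bigcup_(v in [set: V]) (((fun r : t.+1.-tuple R => tnth r ord0) @^-1` [set x | choose h x = v])
    `&` ((fun r : t.+1.-tuple R => [tuple of behead r]) @^-1`
      [set r : t.-tuple R | B (transcript m (rcons h v) (nth 0 r))])).
  apply/seteqP; split => r /=.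
    move=> Br; exists (choose h r`_0) => //; split => /=.
      by rewrite (tnth_nth 0).
    by rewrite (@eq_transcript _ _ _ (fun i => r`_i.+1))// => i; rewrite nth_behead.
  case=> v _ [/= e]; rewrite (tnth_nth 0) /= in e; rewrite e.
  by rewrite (@eq_transcript _ _ _ (fun i => r`_i.+1))// => i; rewrite nth_behead.
apply: fin_bigcup_measurable; first exact: finite_finset.
move=> v _; apply: measurableI.
  rewrite -[X in measurable X]setTI.
  by apply: (measurable_tnth ord0) => //; exact: m_choose.
rewrite -[X in measurable X]setTI; apply: measurable_behead => //.
exact: IH.
Qed.

(** Since finitely many items can be chosen, the event is a finite disjoint union of rectangles, one
    for each first choice. The tape may be longer than the number of draws. *)
Lemma transcript_law (m t : nat) h (B : set (seq V)) : (m <= t)%N ->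
  uniform_tape R t [set r : t.-tuple R | B (transcript m h (nth 0 r))] =
  (\sum_(s : m.-tuple V) path_prod p h s * \1_B (h ++ s))%:E.
Proof.
elim: m t h => [|m IH] t h mt /=.
  rewrite (sum_tuple0 (fun s => path_prod p h s * \1_B (h ++ s))) /= cats0 mul1r indicE.
  have [b|b] := pselect (B h).
    rewrite mem_set// (_ : [set _ | _] = setT) ?probability_setT//.
    by apply/seteqP; split.
  by rewrite memNset// (_ : [set _ | _] = set0) ?measure0//; apply/seteqP; split.
case: t mt => // t mt.
rewrite (sum_tupleS _ (fun s => path_prod p h s * \1_B (h ++ s))) /=.
rewrite /distribution /pushforward /=.
pose F v : set (measurableTypeR R * t.-tuple R) :=
  [set x | choose h x = v] `*` [set r : t.-tuple R | B (transcript m (rcons h v) (nth 0 r))].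
have -> : @cons_pair R t @^-1` [set r | B (transcript m (rcons h (choose h r`_0)) (fun i => r`_i.+1))]
   = \bigcup_v F v.
  apply/seteqP; split => -[x r] /=.
    by move=> Br; exists (choose h x).
  by case=> v _ [/= -> +].
have mF v : measurable (F v).
  by apply: measurableX; [exact: m_choose|exact: measurable_transcript].
rewrite measure_fiber//; last first.
  by move=> v v' _ _ [[x r] [[/= <- _] [/= <- _]]].
rewrite -sumEFin; apply: eq_bigr => v _.
transitivity (uniform_prob (@ltr01 R) [set x | choose h x = v] *
    uniform_tape R t [set r : t.-tuple R | B (transcript m (rcons h v) (nth 0%R r))])%E.
  by apply: product_measure1E; [exact: m_choose|exact: measurable_transcript].
rewrite choose_law IH// -EFinM mulr_sumr; congr EFin.
by apply: eq_bigr => s _; rewrite mulrA cat_rcons.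
Qed.

End TapeLaw.

(** * Reasoning about programs *)

Section ProgramLogic.
Context (R : realType).
Implicit Types (p q : program) (s : store R) (tape : nat -> R) (N A W : seq nat) (nd : bool).

Fixpoint nwrites p : seq nat :=
  match p with
  | NSet x _ => [:: x]
  | Seq p1 p2 | If _ p1 p2 => nwrites p1 ++ nwrites p2
  | For x _ q => x :: nwrites q
  | _ => [::]
  end.

Fixpoint awrites p : seq nat :=
  match p with
  | NPut a _ _ => [:: a]
  | Seq p1 p2 | If _ p1 p2 => awrites p1 ++ awrites p2
  | For _ _ q => awrites q
  | _ => [::]
  end.

Fixpoint rwrites p : seq nat :=
  match p with
  | RPut a _ _ | RDraw a _ => [:: a]
  | Seq p1 p2 | If _ p1 p2 => rwrites p1 ++ rwrites p2
  | For _ _ q => rwrites q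
  | _ => [::]
  end.

Fixpoint drawless p : bool :=
  match p with
  | RDraw _ _ => false
  | Seq p1 p2 | If _ p1 p2 => drawless p1 && drawless p2
  | For _ _ q => drawless q
  | _ => true
  end.

(** The lists are computed from the syntax of programs, so the side conditions on what is left
    untouched are decided by evaluation. *)
Definition frame (N A W : seq nat) (nd : bool) s s' : Prop :=
  [/\ forall x, x \notin N -> nvar s' x = nvar s x,
      forall a, a \notin A -> narr s' a = narr s a,
      forall a, a \notin W -> rarr s' a = rarr s a &
      nd -> draws s' = draws s].

Lemma frame_trans N A W nd s1 s2 s3 :
  frame N A W nd s1 s2 -> frame N A W nd s2 s3 -> frame N A W nd s1 s3.
Proof.
move=> [n1 a1 w1 d1] [n2 a2 w2 d2]; split => [x h|x h|x h|h].
- by rewrite n2// n1.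
- by rewrite a2// a1.
- by rewrite w2// w1.
by rewrite d2// d1.
Qed.

Lemma frame_sub N A W nd (N' A' W' : seq nat) (nd' : bool) s s' :
  {subset N <= N'} -> {subset A <= A'} -> {subset W <= W'} -> (nd' -> nd) ->
  frame N A W nd s s' -> frame N' A' W' nd' s s'.
Proof.
move=> sN sA sW sd [n a w d]; split => [x h|x h|x h|h].
- by apply: n; apply: contra h; exact: sN.
- by apply: a; apply: contra h; exact: sA.
- by apply: w; apply: contra h; exact: sW.
by apply: d; exact: sd.
Qed.

Definition framed p s s' := frame (nwrites p) (awrites p) (rwrites p) (drawless p) s s'.

Lemma updateE (T : eqType) (U : Type) (f : T -> U) x v y :
  update f x v y = if y == x then v else f y.
Proof. by []. Qed.

Lemma frame_step N A W nd tape q x s i : x \in N ->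
  (forall s, frame N A W nd s (exec tape q s)) ->
  frame N A W nd s (exec tape q (tick 1 (set_nvar x i s))).
Proof.
move=> xN Hq; apply: frame_trans (Hq _); split => //= y yN; rewrite updateE.
by case: eqP yN => // ->; rewrite xN.
Qed.

Lemma foldl_inv (S : Type) (f : S -> nat -> S) (I : nat -> S -> Prop) a m (x : S) :
  I a x -> (forall i y, (a <= i < a + m)%N -> I i y -> I i.+1 (f y i)) ->
  I (a + m)%N (foldl f x (iota a m)).
Proof.
elim: m a x => [|m IH] a x Ia step /=; first by rewrite addn0.
rewrite addnS -addSn; apply: IH.
  by apply: step => //; rewrite leqnn -addSnnS leq_addr.
move=> i s' /andP[ai im]; apply: step; rewrite (ltnW ai) /=.
by rewrite addnS -addSn.
Qed.

Lemma exec_frame p tape s : framed p s (exec tape p s).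
Proof.
elim: p s => [|x e|a xs e|a xs e|a xs|p1 IH1 p2 IH2|b p1 IH1 p2 IH2|x e q IH] s //=.
- split => //= y; rewrite inE updateE => /negbTE -> //.
- split => //= y; rewrite inE updateE => /negbTE -> //.
- split => //= y; rewrite inE updateE => /negbTE -> //.
- split => //= y; rewrite inE updateE => /negbTE -> //.
- apply: (@frame_trans _ _ _ _ _ (exec tape p1 s)).
    apply: frame_sub (IH1 s) => //= [x|x|x|/andP[]//]; by rewrite mem_cat => ->.
  apply: frame_sub (IH2 _) => //= [x|x|x|/andP[]//]; by rewrite mem_cat orbC => ->.
- apply: (@frame_trans _ _ _ _ _ (tick (bexp_cost b).+1 s)); first by split.
  case: (beval s b).
    apply: frame_sub (IH1 _) => //= [x|x|x|/andP[]//]; by rewrite mem_cat => ->.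
  apply: frame_sub (IH2 _) => //= [x|x|x|/andP[]//]; by rewrite mem_cat orbC => ->.
pose I (i : nat) s' := framed (For x e q) s s'.
apply: (@foldl_inv _ _ I 0 (neval s e)); first by split.
move=> i s' _ h; apply: frame_trans h _; apply: frame_step; first by rewrite /= mem_head.
move=> s2; apply: frame_sub (IH s2) => //= y; rewrite inE => ->; exact: orbT.
Qed.

(** The step may assume that the loop so far has changed only what it writes, so invariants need to
    mention only what is new. *)
Lemma For_rule tape x e q s0 (I : nat -> store R -> Prop) (m : nat) : neval s0 e = m ->
  I 0%N (tick (nexp_cost e).+1 s0) ->
  (forall i s, (i < m)%N -> framed (For x e q) s0 s -> I i s ->
     I i.+1 (exec tape q (tick 1 (set_nvar x i s)))) ->
  I m (exec tape (For x e q) s0).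
Proof.
move=> em I0 step /=; rewrite em.
pose J i s := I i s /\ framed (For x e q) s0 s.
suff : J (0 + m)%N (foldl (fun s' i => exec tape q (tick 1 (set_nvar x i s')))
    (tick (nexp_cost e).+1 s0) (iota 0 m)) by case.
apply: foldl_inv; first by split => //; split.
move=> i s /andP[_ im] [Ii fr]; split; first exact: step.
apply: frame_trans fr _; apply: frame_step; first by rewrite /= mem_head.
move=> s2; apply: frame_sub (exec_frame q tape s2) => //= y; rewrite inE => ->; exact: orbT.
Qed.

Lemma For_fold tape x e q s0 (m : nat) (A : Type) (f : A -> 'I_m -> A) (a0 : A)
    (I : A -> store R -> Prop) : neval s0 e = m ->
  I a0 (tick (nexp_cost e).+1 s0) ->
  (forall (i : 'I_m) a s, framed (For x e q) s0 s -> I a s ->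
     I (f a i) (exec tape q (tick 1 (set_nvar x i s)))) ->
  I (foldl f a0 (enum 'I_m)) (exec tape (For x e q) s0).
Proof.
move=> em I0 step.
pose J i s := I (foldl f a0 (take i (enum 'I_m))) s.
have H : J m (exec tape (For x e q) s0).
  apply: (@For_rule tape x e q s0 J m em); first by rewrite /J take0.
  move=> i s im fr Ii; rewrite /J.
  rewrite (take_nth (Ordinal im)) ?size_enum_ord// foldl_rcons.
  have -> : nth (Ordinal im) (enum 'I_m) i = Ordinal im.
    by apply: val_inj; rewrite /= nth_enum_ord.
  exact: step.
by rewrite /J take_oversize ?size_enum_ord in H.
Qed.

Lemma foldl_sum (m : nat) (F : 'I_m -> R) (a : R) :
  foldl (fun a i => a + F i) a (enum 'I_m) = a + \sum_i F i.
Proof.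
rewrite -[\sum_i F i]big_enum /=; elim: (enum 'I_m) a => [|i l IH] a /=.
  by rewrite big_nil addr0.
by rewrite IH big_cons addrA.
Qed.

Lemma foldl_pairs (A B S : Type) (f : S -> A * B -> S) (la : seq A) (lb : seq B) a :
  foldl (fun a x => foldl (fun a y => f a (x, y)) a lb) a la =
  foldl f a [seq (x, y) | x <- la, y <- lb].
Proof.
elim: la a => //= x la IH a; rewrite IH foldl_cat; congr foldl.
by elim: lb a {IH} => //= y lb IH a.
Qed.

(** [L] stands for a bound on the variables that bound loops. Literal bounds, which in this program
    depend on [k] alone, remain constants and do not raise the degree in [L]. *)
Fixpoint cost (L : nat) p : nat :=
  match p with
  | Skip => 1
  | NSet _ e => (nexp_cost e).+1
  | NPut _ xs e => (size xs + nexp_cost e).+1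
  | RPut _ xs e => (size xs + rexp_cost e).+1
  | RDraw _ xs => (size xs).+1
  | Seq p1 p2 => cost L p1 + cost L p2
  | If b p1 p2 => (bexp_cost b).+1 + (cost L p1 + cost L p2)
  | For _ e q => (nexp_cost e).+1 + (if e is NLit m then m else L) * (cost L q).+1
  end%N.

Fixpoint loops_bounded (B : seq nat) p : bool :=
  match p with
  | Seq p1 p2 | If _ p1 p2 => loops_bounded B p1 && loops_bounded B p2
  | For _ e q =>
      match e with NLit _ => true | NVar x => x \in B | _ => false end && loops_bounded B q
  | _ => true
  end.

Lemma clock_le tape (B : seq nat) (L : nat) p s :
  loops_bounded B p -> (forall x, x \in B -> x \notin nwrites p) ->
  (forall x, x \in B -> (nvar s x <= L)%N) ->
  (clock (exec tape p s) <= cost L p + clock s)%N.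
Proof.
elim: p s => [|x e|a xs e|a xs e|a xs|p1 IH1 p2 IH2|b p1 IH1 p2 IH2|x e q IH] s //=.
- move=> /andP[b1 b2] Bw BL.
  have Bw1 x : x \in B -> x \notin nwrites p1 by move=> /Bw; rewrite mem_cat negb_or => /andP[].
  have Bw2 x : x \in B -> x \notin nwrites p2 by move=> /Bw; rewrite mem_cat negb_or => /andP[].
  have h2 : (clock (exec tape p2 (exec tape p1 s)) <= cost L p2 + clock (exec tape p1 s))%N.
    apply: IH2 => // x xB; have [fn _ _ _] := exec_frame p1 tape s; rewrite fn; [exact: BL|exact: Bw1].
  apply: leq_trans h2 _; rewrite (addnC (cost L p1)) -addnA leq_add2l; exact: IH1.
- move=> /andP[b1 b2] Bw BL.
  have Bw1 x : x \in B -> x \notin nwrites p1 by move=> /Bw; rewrite mem_cat negb_or => /andP[].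
  have Bw2 x : x \in B -> x \notin nwrites p2 by move=> /Bw; rewrite mem_cat negb_or => /andP[].
  case: (beval s b).
    by have := IH1 (tick (bexp_cost b).+1 s) b1 Bw1 BL; rewrite /=; lia.
  by have := IH2 (tick (bexp_cost b).+1 s) b2 Bw2 BL; rewrite /=; lia.
move=> /andP[be bq] Bw BL.
have Bwq y : y \in B -> y \notin nwrites q.
  by move=> /Bw; rewrite inE negb_or => /andP[].
have xB y : y \in B -> y != x by move=> /Bw; rewrite inE negb_or => /andP[].
set m := neval s e.
have mL : (m <= (if e is NLit m then m else L))%N.
  by rewrite /m; case: e be {m} => //= y yB; exact: BL.
pose I (i : nat) (s' : store R) := (clock s' <= (nexp_cost e).+1 + i * (cost L q).+1 + clock s)%N
   /\ forall y, y \in B -> nvar s' y = nvar s y.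
have : I (0 + m)%N (foldl (fun s' i => exec tape q (tick 1 (set_nvar x i s')))
    (tick (nexp_cost e).+1 s) (iota 0 m)).
  apply: foldl_inv; first by split; rewrite //= mul0n addn0.
  move=> i s' _ [h1 h2]; split; last first.
    move=> y yB; have [fn _ _ _] := exec_frame q tape (tick 1 (set_nvar x i s')); rewrite fn; last exact: Bwq.
    by rewrite /= updateE (negbTE (xB y yB)) h2.
  have h3 := IH (tick 1 (set_nvar x i s')) bq Bwq.
  apply: leq_trans (h3 _) _.
    by move=> y yB; rewrite /= updateE (negbTE (xB y yB)) h2// BL.
  rewrite /= mulSn addnCA addSn; move: h1; set c := cost L q; set n := (i * _)%N; lia.
case=> h _; apply: leq_trans h _; rewrite add0n leq_add2r leq_add2l leq_mul2r mL orbT.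
by [].
Qed.

Lemma draws_le_clock tape p s :
  (draws (exec tape p s) + clock s <= clock (exec tape p s) + draws s)%N.
Proof.
elim: p s => [|x e|a xs e|a xs e|a xs|p1 IH1 p2 IH2|b p1 IH1 p2 IH2|x e q IH] s /=; try lia.
- by have := IH1 s; have := IH2 (exec tape p1 s); lia.
- case: (beval s b).
    by have := IH1 (tick (bexp_cost b).+1 s) => /=; lia.
  by have := IH2 (tick (bexp_cost b).+1 s) => /=; lia.
pose I (i : nat) (s' : store R) := (draws s' + clock s <= clock s' + draws s)%N.
apply: (@foldl_inv _ _ I 0 (neval s e)); first by rewrite /I /=; lia.
by move=> i s' _; rewrite /I => h; have := IH (tick 1 (set_nvar x i s')) => /=; lia.
Qed.

Lemma cost_poly p : exists A B : nat, forall L, (0 < L)%N -> (cost L p <= A * L ^ B)%N.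
Proof.
have lit c : exists A B : nat, forall L, (0 < L)%N -> (c <= A * L ^ B)%N.
  by exists c, 0%N => L _; rewrite expn0 muln1.
have add (f g : nat -> nat) :
    (exists A B : nat, forall L, (0 < L)%N -> (f L <= A * L ^ B)%N) ->
    (exists A B : nat, forall L, (0 < L)%N -> (g L <= A * L ^ B)%N) ->
    exists A B : nat, forall L, (0 < L)%N -> (f L + g L <= A * L ^ B)%N.
  move=> [A1 [B1 H1]] [A2 [B2 H2]]; exists (A1 + A2)%N, (B1 + B2)%N => L L0.
  rewrite mulnDl leq_add//.
    by apply: leq_trans (H1 L L0) _; rewrite leq_mul2l leq_pexp2l ?leq_addr ?orbT.
  by apply: leq_trans (H2 L L0) _; rewrite leq_mul2l leq_pexp2l ?leq_addl ?orbT.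
have mul (f g : nat -> nat) :
    (exists A B : nat, forall L, (0 < L)%N -> (f L <= A * L ^ B)%N) ->
    (exists A B : nat, forall L, (0 < L)%N -> (g L <= A * L ^ B)%N) ->
    exists A B : nat, forall L, (0 < L)%N -> (f L * g L <= A * L ^ B)%N.
  move=> [A1 [B1 H1]] [A2 [B2 H2]]; exists (A1 * A2)%N, (B1 + B2)%N => L L0.
  by rewrite expnD mulnACA leq_mul ?H1 ?H2.
elim: p => [|x e|a xs e|a xs e|a xs|p1 IH1 p2 IH2|b p1 IH1 p2 IH2|x e q IH] /=; try exact: lit.
- exact: add.
- by apply: (add (fun=> _)); [exact: lit|exact: add].
apply: (add (fun=> _)); first exact: lit.
apply: (mul (fun L => if e is NLit m then m else L)).
  have idp : exists A B : nat, forall L, (0 < L)%N -> (L <= A * L ^ B)%N.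
    by exists 1%N, 1%N => L _; rewrite expn1 mul1n.
  by case: e => //= m; exact: lit.
have [A [B H]] := IH; exists A.+1, B => L L0.
rewrite mulSn -add1n leq_add ?H// expn_gt0 L0//.
Qed.

End ProgramLogic.

(** * The program *)

(* Integer variables: 3 number of steps per regression, 4 node, 5 and 6 rank and
   letter of the regression, 7 step, 8 sample, 9 coordinate, 10 and 11 letters,
   12 pattern of signs (or a letter), 13 and 14 chosen vertex.
   Real arrays: 3 output, 4 iterates, 5 signs, 6 residuals, 7 weights of the
   vertices, 8 total weight, 9 prefix sum, 10 random threshold, 11 and 12
   accumulators, 13 bound on the number of steps, 14 temperature. *)
Section Code.
Variable k : nat.
Notation pattern := {ffun 'I_k.+1 -> bool}.

(* 1 if the arguments are equal and 0 otherwise, by truncated subtraction. *)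
Definition neq (e1 e2 : nexp) : nexp := NSub (NLit 1) (NAdd (NSub e1 e2) (NSub e2 e1)).
(** Integer expressions have no product, so a constant multiple is a repeated sum. *)
Definition nscale (c : nat) (e : nexp) : nexp := iter c (NAdd e) (NLit 0).
Definition rlit (m : nat) : rexp := RNat (NLit m).
Definition rvar (a : nat) : rexp := RGet a [::].
Definition rneg (e : rexp) : rexp := RSub (rlit 0) e.
Definition rlogistic (e : rexp) : rexp := RDiv (RExp e) (RAdd (rlit 1) (RExp e)).
Definition radd_to (a : nat) (e : rexp) : program := RPut a [::] (RAdd (rvar a) e).

(* The truncated subtraction sends the coordinate of the node itself to the letter 0. *)
Definition feature_exp : nexp :=
  NSub (NGet 0 [:: 8; 9]) (nscale k (neq (NVar 9) (NVar 4))).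

Definition margin_exp : rexp := RMul (RMul (rlit 2) (rvar 0)) (rvar 11).

Definition residual_exp : rexp :=
  RSub (RMul (RNat (neq (NGet 0 [:: 8; 4]) (NVar 6))) (rlogistic (rneg margin_exp)))
       (RMul (RNat (neq (NGet 0 [:: 8; 4]) (NLit 0))) (rlogistic margin_exp)).

Definition code_margin : program :=
  For 9 (NVar 1) (Seq (NSet 11 feature_exp) (radd_to 11 (RGet 4 [:: 4; 6; 9; 11]))).

Definition code_residuals : program :=
  For 8 (NVar 0)
    (Seq (RPut 11 [::] (rlit 0)) (Seq code_margin (RPut 6 [:: 8] residual_exp))).

Definition code_utility : program :=
  For 8 (NVar 0)
    (Seq (NSet 11 feature_exp)
         (radd_to 12 (RMul (RGet 6 [:: 8]) (RGet 5 [:: 12; 11])))).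

Definition code_weights : program :=
  Seq (RPut 8 [::] (rlit 0))
    (For 9 (NVar 1)
      (For 12 (NLit #|pattern|)
        (Seq (RPut 12 [::] (rlit 0))
        (Seq code_utility
        (Seq (RPut 7 [:: 9; 12] (RExp (RMul (rvar 14) (rvar 12))))
             (radd_to 8 (RGet 7 [:: 9; 12]))))))).

Definition code_choice : program :=
  Seq (RDraw 10 [::])
  (Seq (RPut 10 [::] (RMul (rvar 10) (rvar 8)))
  (Seq (RPut 9 [::] (rlit 0))
  (Seq (NSet 13 (NLit 0))
  (Seq (NSet 14 (NLit 0))
    (For 9 (NVar 1)
      (For 12 (NLit #|pattern|)
        (Seq (If (BRLe (rvar 9) (rvar 10))
               (Seq (NSet 13 (NVar 9)) (NSet 14 (NVar 12))) Skip)
             (radd_to 9 (RGet 7 [:: 9; 12]))))))))).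

Definition code_update : program :=
  For 9 (NVar 1)
    (For 10 (NLit k.+1)
      (RPut 4 [:: 4; 6; 9; 10]
        (RAdd (RMul (RDiv (RNat (NVar 7)) (RNat (NAdd (NVar 7) (NLit 2))))
                    (RGet 4 [:: 4; 6; 9; 10]))
              (RMul (RDiv (rlit 2) (RNat (NAdd (NVar 7) (NLit 2))))
                    (RMul (RNat (neq (NVar 9) (NVar 13))) (RGet 5 [:: 14; 10])))))).

Definition code_step : program :=
  Seq code_residuals (Seq code_weights (Seq code_choice code_update)).

Definition code_train : program :=
  For 4 (NVar 1)
    (For 5 (NLit k)
      (Seq (NSet 6 (NAdd (NVar 5) (NLit 1)))
           (For 7 (NVar 3) code_step))).

Definition center_exp (e1 e2 : nexp) : rexp :=
  RSub (RNat (neq e1 e2)) (RDiv (rlit 1) (rlit k.+1)).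

Definition code_output : program :=
  For 4 (NVar 1)
    (For 9 (NVar 1)
      (For 6 (NLit k.+1)
        (For 10 (NLit k.+1)
          (Seq (RPut 11 [::] (rlit 0))
          (Seq (For 12 (NLit k.+1)
                 (For 11 (NLit k.+1)
                   (radd_to 11 (RMul (RMul (center_exp (NVar 6) (NVar 12))
                                           (center_exp (NVar 10) (NVar 11)))
                                     (RGet 4 [:: 4; 12; 9; 11])))))
               (RPut 3 [:: 4; 9; 6; 10] margin_exp)))))).

(** The value [2^16 lambda^2 k^2 e^(16 lambda) / alpha^2], [k] being the alphabet size, makes the
    Frank-Wolfe error [64 lambda^2 / T] about half of the gap to be reached. *)
Definition iterations_exp : rexp :=
  RDiv (RMul (RMul (RMul (rlit 16) (rlit 16)) (RMul (rlit 16) (rlit 16)))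
             (RMul (RMul (rvar 0) (rvar 0))
                   (RMul (RMul (rlit k.+1) (rlit k.+1))
                         (RExp (RMul (rlit 16) (rvar 0))))))
       (RMul (rvar 2) (rvar 2)).

(* Programs have no square root, hence the exponential of half a logarithm. *)
Definition temperature_exp : rexp :=
  RExp (RDiv (RLn (RDiv (rvar 1)
    (RMul (RMul (RMul (rlit 16) (RNat (NVar 1))) (rlit k.+1)) (RNat (NVar 3)))))
    (rlit 2)).

Definition pattern_bit (q b : nat) : bool :=
  (nth [ffun => false] (enum (pattern : finType)) q) (inord b).

Definition code_sign (x : nat * nat) : program :=
  Seq (NSet 12 (NLit x.1)) (Seq (NSet 11 (NLit x.2))
    (RPut 5 [:: 12; 11] (if pattern_bit x.1 x.2 then rlit 1 else rneg (rlit 1)))).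

(** The enumeration of patterns depends on [k] only, so the table of signs is hard-wired as
    straight-line code. *)
Definition code_signs : program :=
  foldr (fun x p => Seq (code_sign x) p) Skip
    [seq (q, b) | q <- iota 0 #|pattern|, b <- iota 0 k.+1].

(** Reals cannot be converted to integers, so the integer part of the bound is found by counting.
    The cap [n] keeps the running time polynomial whatever [lambda] and [alpha] are. *)
Definition code_iterations : program :=
  Seq (RPut 13 [::] iterations_exp)
    (For 8 (NVar 0)
      (If (BRLe (RNat (NAdd (NVar 3) (NLit 1))) (rvar 13))
          (NSet 3 (NAdd (NVar 3) (NLit 1))) Skip)).

Definition code_init : program :=
  Seq code_iterations (Seq (RPut 14 [::] temperature_exp) code_signs).

Definition code_main : program := Seq code_train code_output.

Definition code : program := Seq code_init code_main.

End Code.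

(** * Effect of one training step on the store *)

Section Semantics.
Context (R : realType) (d k n : nat) (X : dataset n d k.+1) (lam rho alpha : R).
Notation pattern := {ffun 'I_k.+1 -> bool}.
Notation V := ('I_d * pattern)%type.
Notation Q := #|pattern|.
Context (T : nat) (beta : R).
Implicit Types (s : store R).

Lemma neval_neq s e1 e2 : neval s (neq e1 e2) = (neval s e1 == neval s e2) :> nat.
Proof. by rewrite /=; case: eqP; lia. Qed.

Lemma neval_nscale s c e : neval s (nscale c e) = (c * neval s e)%N.
Proof. by elim: c => //= c ->; rewrite mulSn. Qed.

Definition static s : Prop :=
  [/\ nvar s 0 = n, nvar s 1 = d, nvar s 3 = T,
      forall (t : 'I_n) (j : 'I_d), narr s 0 [:: t : nat; j : nat] = tnth (tnth X t) j &
      [/\ rarr s 0 [::] = lam, rarr s 14 [::] = beta &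
          forall (q : 'I_Q) (b : 'I_k.+1), rarr s 5 [:: q : nat; b : nat] = sgn R (enum_val q b)]].

Lemma static_frame N A W nd s s' : frame N A W nd s s' ->
  ~~ has (mem N) [:: 0; 1; 3]%N -> 0%N \notin A -> ~~ has (mem W) [:: 0; 14; 5]%N ->
  static s -> static s'.
Proof.
move=> [fn fa fr _] /=; rewrite !negb_or => /and4P[n0 n1 n3 _] a0 /and4P[r0 r14 r5 _].
move=> [h1 h2 h3 h4 [h5 h6 h7]]; split; rewrite ?fn ?fa//; split; rewrite ?fr//.
Qed.

Lemma frame_set_nvar x i s c : frame [:: x] [::] [::] true s (tick c (set_nvar x i s)).
Proof. by split => //= y; rewrite inE updateE => /negbTE ->. Qed.

Lemma neval_feature s (i : 'I_d) (t : 'I_n) (j : 'I_d) :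
  static s -> nvar s 4 = i -> nvar s 8 = t -> nvar s 9 = j ->
  neval s (feature_exp k) = feature i (tnth X t) j.
Proof.
move=> [_ _ _ hX _] h4 h8 h9.
rewrite /feature_exp /= neval_nscale neval_neq /= h4 h8 h9 hX /feature val_eqE.
case: eqP => _ /=; last by rewrite muln0 subn0.
rewrite muln1; have := ltn_ord (tnth (tnth X t) j); rewrite ltnS; lia.
Qed.

Lemma reval_rlogistic s e : reval s (rlogistic e) = logistic (reval s e).
Proof. by rewrite /= /logistic. Qed.

Lemma sum_ord_lt (m : nat) (F : 'I_m -> R) (i : nat) (im : (i < m)%N) :
  \sum_(j < m | (j < i.+1)%N) F j = \sum_(j < m | (j < i)%N) F j + F (Ordinal im).
Proof.
rewrite (bigD1 (Ordinal im))/=; last exact: ltnSn.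
rewrite addrC; congr (_ + _); apply: eq_bigl => j.
by rewrite -val_eqE /= ltnS andbC -ltn_neqAle.
Qed.

Lemma sum_ord_all (m : nat) (F : 'I_m -> R) : \sum_(j < m | (j < m)%N) F j = \sum_j F j.
Proof. by apply: eq_bigl => j; rewrite ltn_ord. Qed.

Lemma frame_cat N A W nd N' A' W' nd' s1 s2 s3 :
  frame N A W nd s1 s2 -> frame N' A' W' nd' s2 s3 ->
  frame (N ++ N') (A ++ A') (W ++ W') (nd && nd') s1 s3.
Proof.
move=> [n1 a1 w1 d1] [n2 a2 w2 d2]; split => [x|x|x|]; rewrite ?mem_cat ?negb_or => /andP[h h'].
- by rewrite n2// n1.
- by rewrite a2// a1.
- by rewrite w2// w1.
by rewrite d2// d1.
Qed.

Lemma frame_nvar N A W nd s s' x : frame N A W nd s s' -> x \notin N -> nvar s' x = nvar s x.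
Proof. by case=> h _ _ _; exact: h. Qed.

Lemma frame_rarr N A W nd s s' a : frame N A W nd s s' -> a \notin W -> rarr s' a = rarr s a.
Proof. by case=> _ _ h _; exact: h. Qed.

Lemma frame_draws N A W s s' : frame N A W true s s' -> draws s' = draws s.
Proof. by case=> _ _ _; apply. Qed.

Lemma exec_seq tape p1 p2 s : exec tape (Seq p1 p2) s = exec tape p2 (exec tape p1 s).
Proof. by []. Qed.

Lemma rarr_RPut tape a xs e s ix :
  rarr (exec tape (RPut a xs e) s) a ix =
  if ix == subscript s xs then reval s e else rarr s a ix.
Proof. by rewrite /= !updateE eqxx. Qed.

Lemma rarr_RPut_same tape a xs e s ix : subscript s xs = ix ->
  rarr (exec tape (RPut a xs e) s) a ix = reval s e.
Proof. by move=> <-; rewrite rarr_RPut eqxx. Qed.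

Lemma nvar_NSet tape x e s : nvar (exec tape (NSet x e) s) x = neval s e.
Proof. by rewrite /= updateE eqxx. Qed.

Lemma nvar_set x i s c : nvar (tick c (set_nvar x i s)) x = i.
Proof. by rewrite /= updateE eqxx. Qed.

Lemma static_n s : static s -> neval s (NVar 0) = n. Proof. by case. Qed.
Lemma static_d s : static s -> neval s (NVar 1) = d. Proof. by case. Qed.

Lemma frame_exec N A W nd p tape s0 s : frame N A W nd s0 s ->
  frame (N ++ nwrites p) (A ++ awrites p) (W ++ rwrites p) (nd && drawless p) s0 (exec tape p s).
Proof. by move=> f; apply: frame_cat f (exec_frame p tape s). Qed.

Lemma frame_set N A W nd x i c s0 s : frame N A W nd s0 s ->
  frame (N ++ [:: x]) (A ++ [::]) (W ++ [::]) (nd && true) s0 (tick c (set_nvar x i s)).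
Proof. by move=> f; apply: frame_cat f (frame_set_nvar x i s c). Qed.

Lemma exec_feature tape s (i : 'I_d) (t : 'I_n) (j : 'I_d) :
  static s -> nvar s 4 = i -> nvar s 8 = t -> nvar s 9 = j ->
  nvar (exec tape (NSet 11 (feature_exp k)) s) 11 = feature i (tnth X t) j.
Proof. by move=> *; rewrite nvar_NSet; exact: neval_feature. Qed.

Lemma exec_margin tape s (i : 'I_d) (u : 'I_k.+1) (t : 'I_n) (v : 'I_d -> 'I_k.+1 -> R) :
  static s -> nvar s 4 = i -> nvar s 6 = u -> nvar s 8 = t -> rarr s 11 [::] = 0 ->
  (forall (j : 'I_d) (b : 'I_k.+1), rarr s 4 [:: i : nat; u : nat; j : nat; b : nat] = v j b) ->
  rarr (exec tape (code_margin k) s) 11 [::]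
  = margin v (feature i (tnth X t)).
Proof.
move=> st h4 h6 h8 h0 hv.
rewrite -[RHS]add0r -(foldl_sum (fun j => v j (feature i (tnth X t) j))).
apply: (@For_fold R tape 9 (NVar 1) _ s d R (fun a j => a + v j (feature i (tnth X t) j)) 0
     (fun a s => rarr s 11 [::] = a)) => //; first exact: static_d.
move=> j a s4 f4 ha.
have f5 := frame_set 9 j 1 f4; have n9 := nvar_set 9 j s4 1.
have r5 : rarr (tick 1 (set_nvar 9 j s4)) 11 [::] = a by [].
(* The intermediate store is made abstract once its relevant entries are recorded; everything else
   about it follows from the accumulated frame. *)
move: (tick _ _) f5 n9 r5 => s5 f5 n9 r5; rewrite /framed /= in f5.
rewrite exec_seq.
have f6 := frame_exec (NSet 11 (feature_exp k)) tape f5.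
have n6 : nvar (exec tape (NSet 11 (feature_exp k)) s5) 11 = feature i (tnth X t) j.
  apply: exec_feature => //; [exact: (static_frame f5)|by rewrite (frame_nvar f5)|by rewrite (frame_nvar f5)].
have r6 : rarr (exec tape (NSet 11 (feature_exp k)) s5) 11 [::] = a by [].
have n69 : nvar (exec tape (NSet 11 (feature_exp k)) s5) 9 = j by [].
move: (exec _ _ s5) f6 n6 r6 n69 => s6 f6 n6 r6 n69; rewrite /framed /= in f6.
rewrite /radd_to rarr_RPut_same// /= r6 n6 n69 (frame_rarr f6)//.
by rewrite !(frame_nvar f6)// h4 h6 hv.
Qed.

Lemma reval_residual s (i : 'I_d) (u : 'I_k.+1) (t : 'I_n) (m : R) :
  static s -> nvar s 4 = i -> nvar s 6 = u -> nvar s 8 = t -> rarr s 11 [::] = m ->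
  reval s residual_exp = residual i u (tnth X t) (2 * lam * m).
Proof.
move=> [_ _ _ hX [hl _ _]] h4 h6 h8 hm.
have mE : reval s margin_exp = 2 * lam * m by rewrite /margin_exp /= hl hm.
rewrite /residual_exp -[LHS]/((neval s (neq (NGet 0 [:: 8; 4]) (NVar 6)))%:R * reval s (rlogistic (rneg margin_exp))
 - (neval s (neq (NGet 0 [:: 8; 4]) (NLit 0)))%:R * reval s (rlogistic margin_exp)).
rewrite !reval_rlogistic -[reval s (rneg _)]/(0 - reval s margin_exp) mE sub0r.
by rewrite !neval_neq /= h8 h4 h6 hX /residual -!val_eqE.
Qed.

Lemma exec_residuals tape s (i : 'I_d) (u : 'I_k.+1) (v : 'I_d -> 'I_k.+1 -> R) :
  static s -> nvar s 4 = i -> nvar s 6 = u ->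
  (forall (j : 'I_d) (b : 'I_k.+1), rarr s 4 [:: i : nat; u : nat; j : nat; b : nat] = v j b) ->
  forall t : 'I_n, rarr (exec tape (code_residuals k) s) 6 [:: t : nat] =
    residual i u (tnth X t) (2 * lam * margin v (feature i (tnth X t))).
Proof.
move=> st h4 h6 hv.
pose I (m : nat) s' := forall t : 'I_n, (t < m)%N -> rarr s' 6 [:: t : nat] =
    residual i u (tnth X t) (2 * lam * margin v (feature i (tnth X t))).
suff : I n (exec tape (code_residuals k) s) by move=> H t; apply: H.
apply: For_rule => //; first exact: static_n.
move=> m s' mn fr Im; pose t := Ordinal mn.
have n1 := nvar_set 8 m s' 1.
have I1 : I m (tick 1 (set_nvar 8 m s')) by [].
have := frame_set 8 m 1 fr.
move: (tick _ _) n1 I1 => s1 n1 I1 f1; rewrite /framed /= in f1.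
rewrite exec_seq exec_seq.
have f2 := frame_exec (RPut 11 [::] (rlit 0)) tape f1.
have r2 : rarr (exec tape (RPut 11 [::] (rlit 0)) s1) 11 [::] = 0 by rewrite rarr_RPut_same.
have n2 : nvar (exec tape (RPut 11 [::] (rlit 0)) s1) 8 = m by [].
have I2 : I m (exec tape (RPut 11 [::] (rlit 0)) s1) by [].
move: (exec tape (RPut 11 _ _) s1) f2 r2 n2 I2 => s2 f2 r2 n2 I2; rewrite /framed /= in f2.
have f3 := frame_exec (code_margin k) tape f2; have g3 := exec_frame (code_margin k) tape s2.
have r3 : rarr (exec tape (code_margin k) s2) 11 [::] = margin v (feature i (tnth X t)).
  apply: (@exec_margin _ _ i u) => //; first exact: (static_frame f2).
  - by rewrite (frame_nvar f2).
  - by rewrite (frame_nvar f2).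
  by rewrite (frame_rarr f2).
have I3 : I m (exec tape (code_margin k) s2) by move=> t' tm; rewrite (frame_rarr g3)//; apply: I2.
have n3 : nvar (exec tape (code_margin k) s2) 8 = m by rewrite (frame_nvar g3).
move: (exec tape (code_margin k) s2) f3 r3 I3 n3 {g3} => s3 f3 r3 I3 n3; rewrite /framed /= in f3.
move=> t' tm; rewrite rarr_RPut.
have -> : reval s3 residual_exp = residual i u (tnth X t) (2 * lam * margin v (feature i (tnth X t))).
  apply: reval_residual => //; first exact: (static_frame f3).
  - by rewrite (frame_nvar f3).
  by rewrite (frame_nvar f3).
rewrite /subscript [map _ _]/= n3 eqseq_cons andbT; case: (eqVneq (t' : nat) m) => [tE|tn].
  by have -> : t' = t by apply: val_inj.
by apply: I3; rewrite ltn_neqAle tn -ltnS.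
Qed.

End Semantics.

Section InnerLoop.
Context (R : realType) (d k n : nat) (X : dataset n d k.+1) (lam : R).
Notation pattern := {ffun 'I_k.+1 -> bool}.
Notation V := ('I_d * pattern)%type.
Notation Q := #|pattern|.
Context (T : nat) (beta : R).
Implicit Types (s : store R).
Notation static := (static X lam T beta).

Lemma exec_utility tape s (i j : 'I_d) (q : 'I_Q) (g : 'I_n -> R) :
  static s -> nvar s 4 = i -> nvar s 9 = j -> nvar s 12 = q -> rarr s 12 [::] = 0 ->
  (forall t : 'I_n, rarr s 6 [:: t : nat] = g t) ->
  rarr (exec tape (code_utility k) s) 12 [::]
  = \sum_(t < n) g t * sgn R (enum_val q (feature i (tnth X t) j)).
Proof.
move=> st h4 h9 h12 h0 hg.
pose F (t : 'I_n) := g t * sgn R (enum_val q (feature i (tnth X t) j)).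
rewrite -[RHS]add0r -(foldl_sum F).
apply: (@For_fold R tape 8 (NVar 0) _ s n R (fun a j => a + F j) 0
     (fun a s => rarr s 12 [::] = a)) => //; first exact: (static_n st).
move=> t a s4 f4 ha.
have f5 := frame_set 8 t 1 f4; have n8 := nvar_set 8 t s4 1.
have r5 : rarr (tick 1 (set_nvar 8 t s4)) 12 [::] = a by [].
move: (tick _ _) f5 n8 r5 => s5 f5 n8 r5; rewrite /framed /= in f5.
rewrite exec_seq.
have f6 := frame_exec (NSet 11 (feature_exp k)) tape f5.
have n6 : nvar (exec tape (NSet 11 (feature_exp k)) s5) 11 = feature i (tnth X t) j.
  apply: (exec_feature (X := X) (lam := lam) (T := T) (beta := beta)) => //.
  - exact: (static_frame f5).
  - by rewrite (frame_nvar f5).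
  by rewrite (frame_nvar f5).
have r6 : rarr (exec tape (NSet 11 (feature_exp k)) s5) 12 [::] = a by [].
have n68 : nvar (exec tape (NSet 11 (feature_exp k)) s5) 8 = t by [].
move: (exec _ _ s5) f6 n6 r6 n68 => s6 f6 n6 r6 n68; rewrite /framed /= in f6.
have [_ _ _ _ [_ _ h5]] := st.
rewrite /radd_to rarr_RPut_same// /= r6 n6 n68 !(frame_rarr f6)//.
by rewrite !(frame_nvar f6)// hg h12 h5.
Qed.

Lemma exec_weights tape s (i : 'I_d) (g : 'I_n -> R)
    (W := fun (j : 'I_d) (q : 'I_Q) =>
       expR (beta * \sum_(t < n) g t * sgn R (enum_val q (feature i (tnth X t) j)))) :
  static s -> nvar s 4 = i -> (forall t : 'I_n, rarr s 6 [:: t : nat] = g t) ->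
  (forall (j : 'I_d) (q : 'I_Q), rarr (exec tape (code_weights k) s) 7 [:: j : nat; q : nat] = W j q)
  /\ rarr (exec tape (code_weights k) s) 8 [::] = \sum_j \sum_q W j q.
Proof.
move=> st h4 hg.
pose I (m : nat) s' := (forall (j : 'I_d) (q : 'I_Q), (j < m)%N -> rarr s' 7 [:: j : nat; q : nat] = W j q)
  /\ rarr s' 8 [::] = \sum_(j < d | (j < m)%N) \sum_q W j q.
suff : I d (exec tape (code_weights k) s).
  by move=> [H1 H2]; split; [move=> j q; exact: H1|rewrite H2 sum_ord_all].
rewrite /code_weights exec_seq.
have f0 := exec_frame (RPut 8 [::] (rlit 0)) tape s.
have r0 : rarr (exec tape (RPut 8 [::] (rlit 0)) s) 8 [::] = 0 by rewrite rarr_RPut_same.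
move: (exec _ _ s) f0 r0 => s0 f0 r0; rewrite /framed /= in f0.
have st0 : static s0 by exact: (static_frame f0).
apply: For_rule.
- exact: (static_d st0).
- by split => //; rewrite big_pred0.
move=> m s1 md f1 [I1 I1']; pose j := Ordinal md.
have n2 := nvar_set 9 m s1 1; have f2 := frame_set 9 m 1 (frame_cat f0 f1).
have i2 : I m (tick 1 (set_nvar 9 m s1)) by [].
move: (tick _ _) n2 f2 i2 => s2 n2 f2 [I2 I2']; rewrite /framed /= in f2.
(* Rows before [m] are complete, and row [m] is filled up to column [c]. *)
pose J (c : nat) s' := (forall (j' : 'I_d) (q : 'I_Q), (j' < m)%N || ((j' == m :> nat) && (q < c)%N) ->
    rarr s' 7 [:: j' : nat; q : nat] = W j' q)
  /\ rarr s' 8 [::] = \sum_(j' < d | (j' < m)%N) \sum_q W j' q + \sum_(q < Q | (q < c)%N) W j q.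
set qin := For 12 _ _.
suff : J Q (exec tape qin s2).
  move=> [J1 J2]; split; last by rewrite (sum_ord_lt _ md) J2 sum_ord_all.
  by move=> j' q; rewrite ltnS leq_eqVlt => h; apply: J1; rewrite ltn_ord andbT orbC.
rewrite /qin; apply: For_rule => //.
  split; last by rewrite [X in _ + X]big_pred0// addr0.
  by move=> j' q; rewrite ltn0 andbF orbF; exact: I2.
move=> c s3 cQ f3 [J3 J3']; pose q := Ordinal cQ.
have n4 := nvar_set 12 c s3 1; have f4 := frame_set 12 c 1 (frame_cat f2 f3).
have g4 := frame_set 12 c 1 f3.
have j4 : J c (tick 1 (set_nvar 12 c s3)) by [].
move: (tick _ _) n4 f4 g4 j4 => s4 n4 f4 g4 j4; rewrite /framed /= in f4 g4.
rewrite 3!exec_seq.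
have f5 := frame_exec (RPut 12 [::] (rlit 0)) tape f4.
have g5 := frame_exec (RPut 12 [::] (rlit 0)) tape g4.
have n5 : nvar (exec tape (RPut 12 [::] (rlit 0)) s4) 12 = c by [].
have r5 : rarr (exec tape (RPut 12 [::] (rlit 0)) s4) 12 [::] = 0 by rewrite rarr_RPut_same.
have j5 : J c (exec tape (RPut 12 [::] (rlit 0)) s4) by [].
move: (exec tape (RPut _ _ _) s4) f5 g5 n5 r5 j5 => s5 f5 g5 n5 r5 j5; rewrite /framed /= in f5 g5.
have f6 := frame_exec (code_utility k) tape f5.
have g6 := frame_exec (code_utility k) tape g5.
have h6 := exec_frame (code_utility k) tape s5.
have n95 : nvar s5 9 = j by rewrite (frame_nvar g5).
have r6 : rarr (exec tape (code_utility k) s5) 12 [::] =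
    \sum_(t < n) g t * sgn R (enum_val q (feature i (tnth X t) j)).
  apply: exec_utility => //.
  - exact: (static_frame f5).
  - by rewrite (frame_nvar f5).
  by move=> t; rewrite (frame_rarr f5).
move: (exec tape (code_utility k) s5) f6 g6 h6 r6 => s6 f6 g6 h6 r6; rewrite /framed /= in f6 g6 h6.
have j6 : J c s6.
  by have [A1 A2] := j5; split; rewrite (frame_rarr h6).
have n69 : nvar s6 9 = m by rewrite (frame_nvar g6).
have n612 : nvar s6 12 = c by rewrite (frame_nvar h6).
have f7 := frame_exec (RPut 7 [:: 9; 12] (RExp (RMul (rvar 14) (rvar 12)))) tape f6.
have r7 ix : rarr (exec tape (RPut 7 [:: 9; 12] (RExp (RMul (rvar 14) (rvar 12)))) s6) 7 ix =
   if ix == [:: m; c] then W j q else rarr s6 7 ix.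
  rewrite rarr_RPut /subscript [map _ _]/= n69 n612; case: eqP => // _.
  have [_ _ _ _ [_ h14 _]] : static s6 by exact: (static_frame f6).
  by rewrite /= h14 r6.
have n79 : nvar (exec tape (RPut 7 [:: 9; 12] (RExp (RMul (rvar 14) (rvar 12)))) s6) 9 = m by [].
have n712 : nvar (exec tape (RPut 7 [:: 9; 12] (RExp (RMul (rvar 14) (rvar 12)))) s6) 12 = c by [].
have r78 : rarr (exec tape (RPut 7 [:: 9; 12] (RExp (RMul (rvar 14) (rvar 12)))) s6) 8 [::] = rarr s6 8 [::] by [].
move: (exec tape (RPut _ _ _) s6) f7 r7 n79 n712 r78 => s7 f7 r7 n79 n712 r78.
have [J6 J6'] := j6.
split.
  move=> j' q'; rewrite ltnS => h.
  rewrite /radd_to -[LHS]/(rarr s7 7 [:: j' : nat; q' : nat]) r7.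
  case: eqP => [[ej eq]|ne].
    have -> : j' = j by apply: val_inj.
    by have -> : q' = q by apply: val_inj.
  apply: J6; move: h; rewrite [(q' <= c)%N]leq_eqVlt andb_orr orbA => /orP[/orP[->//|/andP[/eqP e1 /eqP e2]]|->].
    by case: ne; rewrite e1 e2.
  by rewrite orbT.
rewrite /radd_to rarr_RPut_same// /= n79 n712 r78 r7 eqxx J6'.
by rewrite (sum_ord_lt _ cQ) addrA.
Qed.

Lemma scan_foldl (U : eqType) (w : U -> R) x acc cur l :
  scan w x acc cur l =
  (foldl (fun (a : R * U) v => (a.1 + w v, if a.1 <= x then v else a.2)) (acc, cur) l).2.
Proof. by elim: l acc cur => //= v l IH acc cur; rewrite IH. Qed.

Lemma scan_map (U U' : eqType) (f : U -> U') (w : U' -> R) x acc cur l :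
  scan w x acc (f cur) (map f l) = f (scan (w \o f) x acc cur l).
Proof. by elim: l acc cur => //= v l IH acc cur; rewrite -IH; case: ifP. Qed.

Lemma exec_if tape b p1 p2 s : exec tape (If b p1 p2) s =
  exec tape (if beval s b then p1 else p2) (tick (bexp_cost b).+1 s).
Proof. by []. Qed.

(** The two nested loops form one fold over the list of pairs, which is the scan. The default item
    has both ranks 0 because the program starts from these values. *)
Lemma exec_choice tape s (W : 'I_d -> 'I_Q -> R) (Z : R) (j0 : 'I_d) (q0 : 'I_Q)
  (c := scan (fun x => W x.1 x.2) (tape (draws s) * Z) 0 (j0, q0)
         [seq (j, q) | j <- enum 'I_d, q <- enum 'I_Q]) :
  static s -> j0 = 0%N :> nat -> q0 = 0%N :> nat ->
  (forall (j : 'I_d) (q : 'I_Q), rarr s 7 [:: j : nat; q : nat] = W j q) ->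
  rarr s 8 [::] = Z ->
  [/\ nvar (exec tape (code_choice k) s) 13 = c.1,
      nvar (exec tape (code_choice k) s) 14 = c.2 &
      draws (exec tape (code_choice k) s) = (draws s).+1].
Proof.
move=> st j00 q00 hW hZ.
rewrite /code_choice 5!exec_seq.
set s1 := exec tape (NSet 14 _) _.
have f1 : frame [:: 13; 14]%N [::] [:: 10; 10; 9]%N false s s1.
  have := frame_exec (NSet 14 (NLit 0)) tape (frame_exec (NSet 13 (NLit 0)) tape (frame_exec (RPut 9 [::] (rlit 0)) tape
    (frame_exec (RPut 10 [::] (RMul (rvar 10) (rvar 8))) tape (exec_frame (RDraw 10 [::]) tape s)))).
  by rewrite /framed.
have d1 : draws s1 = (draws s).+1 by [].
have r1 : rarr s1 9 [::] = 0 by [].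
have r10 : rarr s1 10 [::] = tape (draws s) * Z by rewrite -hZ.
have n13 : nvar s1 13 = 0%N by [].
have n14 : nvar s1 14 = 0%N by [].
move: s1 f1 d1 r1 r10 n13 n14 => s1 f1 d1 r1 r10 n13 n14.
set qo := For 9 _ _.
have df : draws (exec tape qo s1) = (draws s).+1.
  by rewrite (frame_draws (exec_frame qo tape s1 : frame _ _ _ true _ _)).
pose x := tape (draws s) * Z.
pose f (a : R * ('I_d * 'I_Q)) (v : 'I_d * 'I_Q) := (a.1 + W v.1 v.2, if a.1 <= x then v else a.2).
pose I (a : R * ('I_d * 'I_Q)) s' := [/\ rarr s' 9 [::] = a.1, nvar s' 13 = a.2.1 & nvar s' 14 = a.2.2].
suff : I (foldl (fun a j => foldl (fun a q => f a (j, q)) a (enum 'I_Q)) (0, (j0, q0)) (enum 'I_d))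
   (exec tape qo s1).
  by rewrite foldl_pairs /c scan_foldl => -[_ h13 h14]; split.
have st1 : static s1 by exact: (static_frame f1).
rewrite /qo; apply: For_fold.
- exact: (static_d st1).
- by split; rewrite /= ?j00 ?q00.
move=> j a s2 f2 I2.
have f3 := frame_set 9 j 1 (frame_cat f1 f2); have n3 := nvar_set 9 j s2 1.
have g3 := frame_set 9 j 1 f2.
have I3 : I a (tick 1 (set_nvar 9 j s2)) by [].
move: (tick _ _) f3 g3 n3 I3 => s3 f3 g3 n3 I3; rewrite /framed /= in f3 g3.
apply: For_fold => //.
move=> q b s4 f4 I4.
have f5 := frame_set 12 q 1 (frame_cat f3 f4); have n5 := nvar_set 12 q s4 1.
have g5 := frame_set 12 q 1 (frame_cat g3 f4).
have n59 : nvar (tick 1 (set_nvar 12 q s4)) 9 = j by rewrite /= updateE /= (frame_nvar f4).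
have I5 : I b (tick 1 (set_nvar 12 q s4)) by [].
move: (tick _ _) f5 g5 n5 n59 I5 => s5 f5 g5 n5 n59 [I51 I52 I53]; rewrite /framed /= in f5 g5.
rewrite exec_seq.
set qi := If _ _ _.
have f6 := frame_exec qi tape f5; rewrite {2 3 4}/qi /= in f6.
have r510 : rarr s5 10 [::] = x by rewrite (frame_rarr g5).
have cond : beval s5 (BRLe (rvar 9) (rvar 10)) = (b.1 <= x) by rewrite /= I51 r510.
have h6 : [/\ nvar (exec tape qi s5) 13 = (f b (j, q)).2.1, nvar (exec tape qi s5) 14 = (f b (j, q)).2.2,
     rarr (exec tape qi s5) 9 [::] = b.1, nvar (exec tape qi s5) 9 = j & nvar (exec tape qi s5) 12 = q].
  by rewrite /qi exec_if cond /f /=; case: ifP => _; split => //=; rewrite updateE /= ?n5.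
have r7 : rarr (exec tape qi s5) 7 [:: j : nat; q : nat] = W j q.
  by rewrite (frame_rarr f6).
move: (exec tape qi s5) h6 r7 => s6 [h13 h14 h9 n69 n612] r7.
by split; rewrite ?h13 ?h14// /radd_to rarr_RPut_same// /= h9 n69 n612 r7.
Qed.

(** Each new entry depends only on its own former value, so the update can be made in place; the
    second part keeps the other regressions intact. *)
Lemma exec_update tape s (i j0 : 'I_d) (u : 'I_k.+1) (q0 : 'I_Q) (t : nat)
    (new := fun (j : 'I_d) (b : 'I_k.+1) =>
       t%:R / (t + 2)%:R * rarr s 4 [:: i : nat; u : nat; j : nat; b : nat]
       + 2 / (t + 2)%:R * ((j == j0)%:R * sgn R (enum_val q0 b))) :
  static s -> nvar s 4 = i -> nvar s 6 = u -> nvar s 7 = t -> nvar s 13 = j0 -> nvar s 14 = q0 ->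
  (forall (j : 'I_d) (b : 'I_k.+1),
     rarr (exec tape (code_update k) s) 4 [:: i : nat; u : nat; j : nat; b : nat] = new j b) /\
  (forall ix, (forall (j : 'I_d) (b : 'I_k.+1), ix <> [:: i : nat; u : nat; j : nat; b : nat]) ->
     rarr (exec tape (code_update k) s) 4 ix = rarr s 4 ix).
Proof.
move=> st h4 h6 h7 h13 h14.
pose I (P : 'I_d -> 'I_k.+1 -> bool) s' :=
  (forall (j : 'I_d) (b : 'I_k.+1),
     rarr s' 4 [:: i : nat; u : nat; j : nat; b : nat] =
     if P j b then new j b else rarr s 4 [:: i : nat; u : nat; j : nat; b : nat]) /\
  (forall ix, (forall (j : 'I_d) (b : 'I_k.+1), ix <> [:: i : nat; u : nat; j : nat; b : nat]) ->
     rarr s' 4 ix = rarr s 4 ix).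
suff : I (fun j _ => (j < d)%N) (exec tape (code_update k) s).
  by move=> [H1 H2]; split => // j b; rewrite H1 ltn_ord.
apply: (@For_rule R tape 9 (NVar 1) _ s (fun m => I (fun j _ => (j < m)%N)) d).
- exact: (static_d st).
- by split.
move=> m s2 md f2 I2; pose j := Ordinal md.
have f3 := frame_set 9 m 1 f2; have n3 := nvar_set 9 m s2 1.
have I3 : I (fun j _ => (j < m)%N) (tick 1 (set_nvar 9 m s2)) by [].
move: (tick _ _) f3 n3 I3 => s3 f3 n3 I3; rewrite /framed /= in f3.
set qi := For 10 _ _.
suff : I (fun j b => (j < m)%N || ((j == m :> nat) && (b < k.+1)%N)) (exec tape qi s3).
  by move=> [H1 H2]; split => // j' b; rewrite H1 ltn_ord andbT ltnS (leq_eqVlt j' m) orbC.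
rewrite /qi.
apply: (@For_rule R tape 10 (NLit k.+1) _ s3 (fun c => I (fun j b => (j < m)%N || ((j == m :> nat) && (b < c)%N))) k.+1) => //.
  case: I3 => [A1 A2]; split => // j' b; rewrite ltn0 andbF orbF; exact: A1.
move=> c s4 ck f4 I4; pose b := Ordinal ck.
have f5 := frame_set 10 c 1 (frame_cat f3 f4); have n5 := nvar_set 10 c s4 1.
have n59 : nvar (tick 1 (set_nvar 10 c s4)) 9 = m by rewrite /= updateE /= (frame_nvar f4).
have I5 : I (fun j b => (j < m)%N || ((j == m :> nat) && (b < c)%N)) (tick 1 (set_nvar 10 c s4)) by [].
move: (tick _ _) f5 n5 n59 I5 => s5 f5 n5 n59 [I51 I52]; rewrite /framed /= in f5.
have n54 : nvar s5 4 = i by rewrite (frame_nvar f5).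
have n56 : nvar s5 6 = u by rewrite (frame_nvar f5).
have n57 : nvar s5 7 = t by rewrite (frame_nvar f5).
have n513 : nvar s5 13 = j0 by rewrite (frame_nvar f5).
have n514 : nvar s5 14 = q0 by rewrite (frame_nvar f5).
have E ix : rarr (exec tape (RPut 4 [:: 4; 6; 9; 10]
        (RAdd (RMul (RDiv (RNat (NVar 7)) (RNat (NAdd (NVar 7) (NLit 2))))
                    (RGet 4 [:: 4; 6; 9; 10]))
              (RMul (RDiv (rlit 2) (RNat (NAdd (NVar 7) (NLit 2))))
                    (RMul (RNat (neq (NVar 9) (NVar 13))) (RGet 5 [:: 14; 10]))))) s5) 4 ix =
   if ix == [:: i : nat; u : nat; m; c] then new j b else rarr s5 4 ix.
  rewrite rarr_RPut /subscript [map _ _]/= n54 n56 n59 n5; case: eqP => // _.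
  have [_ _ _ _ [_ _ h5]] : static s5 by exact: (static_frame f5).
  have en : neval s5 (neq (NVar 9) (NVar 13)) = (j == j0) by rewrite neval_neq /= n59 n513.
  rewrite -[LHS]/((nvar s5 7)%:R / (nvar s5 7 + 2)%:R * rarr s5 4 [:: nvar s5 4; nvar s5 6; nvar s5 9; nvar s5 10]
     + 2%:R / (nvar s5 7 + 2)%:R * ((neval s5 (neq (NVar 9) (NVar 13)))%:R * rarr s5 5 [:: nvar s5 14; nvar s5 10])).
  rewrite en n54 n56 n57 n59 n514 n5.
  rewrite -[[:: i : nat; u : nat; m; c]]/[:: i : nat; u : nat; j : nat; b : nat] (I51 j b).
  by rewrite ltnn eqxx ltnn /= -[c]/(b : nat) h5.
split; last first.
  move=> ix ne; rewrite E; case: eqP => [e|_]; last exact: I52.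
  by case: (ne j b).
move=> j' b'; rewrite E; case: eqP => [[ej eb]|ne].
  have -> : j' = j by apply: val_inj.
  have -> : b' = b by apply: val_inj.
  by rewrite /= eqxx ltnSn orbT.
rewrite I51; congr (if _ then _ else _).
case: (ltngtP j' m) => //= jm; rewrite ltnS (leq_eqVlt b' c); case: eqP => //= bc.
by case: ne; rewrite jm bc.
Qed.

End InnerLoop.

(** * All regressions as one adaptive sampler *)

Section Training.
Context (R : realType) (d k n : nat) (X : dataset n d k.+1) (lam : R).
Notation pattern := {ffun 'I_k.+1 -> bool}.
Notation V := ('I_d * pattern)%type.
Notation Q := #|pattern|.
Context (T : nat) (beta : R) (i0 : 'I_d) (q0 : 'I_Q).
Implicit Types (s : store R) (H : seq V).
Notation static := (static X lam T beta).

(** All regressions share one history. Regression [r = i * k + u] belongs to node [i] and letter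
    [u + 1] and owns the [T] choices from position [r * T] on. *)
Definition segment (r : nat) H : seq V := take T (drop (r * T) H).
Definition node (r : nat) : 'I_d := insubd i0 (r %/ k)%N.
Definition letter (r : nat) : 'I_k.+1 := inord (r %% k).+1.

(** The regression in progress is read off from the length of the history. One utility thus governs
    the whole run, and the privacy and tail bounds apply to it at once. *)
Definition utility H (a : V) : R :=
  let r := (size H %/ T)%N in
  beta * fw_utility lam (node r) (letter r) X (segment r H) a.

Definition vertices : seq V := [seq (j, enum_val q) | j <- enum 'I_d, q <- enum 'I_Q].

Definition choose H (x : R) : V :=
  choose_item (fun a => expR (utility H a)) vertices (i0, enum_val q0) x.

Lemma uniq_vertices : uniq vertices.
Proof.
apply: allpairs_uniq; rewrite ?enum_uniq// => -[j q] [j' q'] _ _ /= [-> e].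
by rewrite (enum_val_inj e).
Qed.

Lemma mem_vertices a : a \in vertices.
Proof.
apply/allpairsP; exists (a.1, enum_rank a.2); rewrite /= !mem_enum enum_rankK; split=> //.
by case: a.
Qed.

Lemma node_letter (i : 'I_d) (u : 'I_k) :
  node (i * k + u) = i /\ letter (i * k + u) = lift ord0 u.
Proof.
have k0 : (0 < k)%N by apply: leq_ltn_trans (ltn_ord u).
split; apply: val_inj.
  by rewrite /node divnMDl// divn_small// addn0 val_insubd ltn_ord.
by rewrite /letter modnMDl modn_small//= inordK// ltnS ltn_ord.
Qed.

Lemma size_div (r t : nat) : (t < T)%N -> ((r * T + t) %/ T)%N = r.
Proof. by move=> tT; rewrite divnMDl ?(leq_ltn_trans _ tT)// divn_small// addn0. Qed.

Lemma segment_rcons_same r t H a : size H = (r * T + t)%N -> (t < T)%N ->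
  segment r (rcons H a) = rcons (segment r H) a.
Proof.
move=> sH tT; have sd : size (drop (r * T) H) = t by rewrite size_drop sH addKn.
rewrite /segment drop_rcons ?sH ?leq_addr// take_oversize ?size_rcons ?sd//.
by rewrite take_oversize// sd ltnW.
Qed.

Lemma size_segment r t H : size H = (r * T + t)%N -> (t < T)%N -> size (segment r H) = t.
Proof.
move=> sH tT; have sd : size (drop (r * T) H) = t by rewrite size_drop sH addKn.
by rewrite /segment take_oversize sd// ltnW.
Qed.

Lemma segment_rcons_other r r' t H a : size H = (r * T + t)%N -> (t < T)%N -> r' != r ->
  segment r' (rcons H a) = segment r' H.
Proof.
move=> sH tT; rewrite neq_ltn => /orP[lt|lt].
  have h : (r' * T + T <= size H)%N.
    by rewrite sH -mulSnr (leq_trans (leq_mul lt (leqnn T)))// leq_addr.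
  rewrite /segment -cats1 drop_cat; case: ltnP => h1.
    by rewrite takel_cat// size_drop; lia.
  have T0 : T = 0%N by lia.
  by rewrite T0 !take0.
have h : ((size H).+1 <= r' * T)%N.
  rewrite sH -addnS; apply: leq_trans (leq_mul lt (leqnn T)).
  by rewrite mulSnr leq_add2l.
by rewrite /segment !drop_oversize// ?size_rcons//; lia.
Qed.

(** The reference letter 0 has no regression; its block stays zero, which is its exact value since
    parameters are differences with letter 0. *)
Definition models H s : Prop :=
  [/\ static s, draws s = size H,
      forall (i : 'I_d) (u : 'I_k) (j : 'I_d) (b : 'I_k.+1),
        rarr s 4 [:: i : nat; u.+1; j : nat; b : nat] = fw_point R (segment (i * k + u) H) j b &
      forall i j b : nat, rarr s 4 [:: i; 0%N; j; b] = 0].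

Lemma models_frame N A W s s' H : frame N A W true s s' ->
  ~~ has (mem N) [:: 0; 1; 3]%N -> 0%N \notin A -> ~~ has (mem W) [:: 0; 14; 5]%N ->
  4%N \notin W -> models H s -> models H s'.
Proof.
move=> f hN hA hW w4 [st dr m1 m2]; split.
- exact: static_frame f hN hA hW st.
- by rewrite (frame_draws f).
- by move=> i u j b; rewrite (frame_rarr f).
by move=> i j b; rewrite (frame_rarr f).
Qed.

Hypotheses (i00 : i0 = 0%N :> nat) (q00 : q0 = 0%N :> nat).

Lemma exec_step tape s H (i : 'I_d) (u : 'I_k) t :
  models H s -> nvar s 4 = i -> nvar s 6 = u.+1 -> nvar s 7 = t ->
  size H = ((i * k + u) * T + t)%N -> (t < T)%N ->
  models (rcons H (choose H (tape (size H)))) (exec tape (code_step k) s).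
Proof.
move=> [st dr m1 m2] h4 h6 h7 sH tT.
set r := (i * k + u)%N in sH; have [nE lE] := node_letter i u.
have h6' : nvar s 6 = (lift ord0 u : 'I_k.+1) by rewrite h6 lift0.
pose v := fw_point R (segment r H).
pose g (t : 'I_n) := residual i (lift ord0 u) (tnth X t) (2 * lam * margin v (feature i (tnth X t))).
pose W (j : 'I_d) (q : 'I_Q) := expR (beta * \sum_(t < n) g t * sgn R (enum_val q (feature i (tnth X t) j))).
have uE a : utility H a = beta * \sum_(t < n) g t * sgn R (a.2 (feature i (tnth X t) a.1)).
  by rewrite /utility sH size_div// nE lE.
rewrite /code_step 3!exec_seq.
have v4 : forall (j : 'I_d) (b : 'I_k.+1), rarr s 4 [:: i : nat; (lift ord0 u : 'I_k.+1) : nat; j : nat; b : nat] = v j b.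
  by move=> j b; rewrite lift0 m1.
have r6 := exec_residuals tape st h4 h6' v4.
have f1 := exec_frame (code_residuals k) tape s.
move: (exec tape (code_residuals k) s) r6 f1 => s1 r6 f1; rewrite /framed /= in f1.
have st1 : static s1 by exact: (static_frame f1).
have h41 : nvar s1 4 = i by rewrite (frame_nvar f1).
have [r7 r8] := exec_weights tape st1 h41 r6.
have f2 := frame_exec (code_weights k) tape f1.
move: (exec tape (code_weights k) s1) r7 r8 f2 => s2 r7 r8 f2; rewrite /framed /= in f2.
have st2 : static s2 by exact: (static_frame f2).
have d2 : draws s2 = size H by rewrite (frame_draws f2).
have [h13 h14 d3] := exec_choice tape st2 i00 q00 r7 r8.
have f3 := frame_exec (code_choice k) tape f2.
move: (exec tape (code_choice k) s2) h13 h14 d3 f3 => s3; rewrite d2.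
set c := scan _ _ _ _ _ => h13 h14 d3 f3; rewrite /framed /= in f3.
have cE : choose H (tape (size H)) = (c.1, enum_val c.2).
  (* The program selects ranks of patterns while [choose] selects patterns; this bijection carries
     one scan to the other. *)
  pose h (x : 'I_d * 'I_Q) : V := (x.1, enum_val x.2).
  rewrite /choose /choose_item -[RHS]/(h c) -[(i0, enum_val q0)]/(h (i0, q0)) /c.
  have -> : vertices = map h [seq (j, q) | j <- enum 'I_d, q <- enum 'I_Q].
    by rewrite /vertices map_allpairs.
  have -> : \sum_a expR (utility H a) = \sum_j \sum_q W j q.
    rewrite pair_bigA /= (reindex h)/=; last first.
      exists (fun a : V => (a.1, enum_rank a.2)).
        by move=> [j q] _; rewrite /h /= enum_valK.
      by move=> [j q] _; rewrite /h /= enum_rankK.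
    by apply: eq_bigr => x _; rewrite uE.
  rewrite (scan_map h); congr (h _).
  rewrite !scan_foldl; congr (foldl _ _ _).2.
  by apply/funext => a; apply/funext => x; rewrite /= uE.
have st3 : static s3 by exact: (static_frame f3).
have h43 : nvar s3 4 = i by rewrite (frame_nvar f3).
have h63 : nvar s3 6 = (lift ord0 u : 'I_k.+1) by rewrite (frame_nvar f3).
have h73 : nvar s3 7 = t by rewrite (frame_nvar f3).
have [new old] := exec_update tape st3 h43 h63 h73 h13 h14.
have f4 := exec_frame (code_update k) tape s3.
move: (exec tape (code_update k) s3) new old f4 => s4 new old f4; rewrite /framed /= in f4.
have r34 : rarr s3 4 = rarr s 4 by rewrite (frame_rarr f3).
rewrite r34 in new old.
split.
- exact: (static_frame f4).
- by rewrite (frame_draws f4) d3 size_rcons.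
- move=> i' u' j b; case: (eqVneq (i' * k + u')%N r) => [e|ne].
    have [ei eu] := node_letter i' u'; rewrite e nE lE in ei eu.
    have uu : u' = u by apply: (@lift_inj _ ord0).
    rewrite -ei uu -(lift0 u) new -/r (segment_rcons_same _ sH tT) fw_point_rcons.
    rewrite (size_segment sH tT) cE /fw_step v4 /vertex /=.
    by congr (_ + _ * _); case: eqP => _; rewrite ?mul1r ?mul0r.
  rewrite (segment_rcons_other _ sH tT ne) -m1 old// => j' b' [e1 e2 _ _].
  by move: ne; rewrite e1 e2 eqxx.
by move=> i' j b; rewrite old ?m2// => j' b' [_ + _ _]; rewrite /= /bump leq0n.
Qed.

Definition trace tape (m : nat) : seq V := transcript choose m [::] tape.

Lemma exec_train tape s : models [::] s ->
  models (trace tape (d * k * T)) (exec tape (code_train k) s).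
Proof.
move=> m0.
have traceS m : trace tape m.+1 = rcons (trace tape m) (choose (trace tape m) (tape (size (trace tape m)))).
  by rewrite /trace transcriptS size_transcript.
have size_trace m : size (trace tape m) = m by rewrite /trace size_transcript.
rewrite /code_train -mulnA.
have [st0 _ _ _] := m0.
apply: (@For_rule R tape 4 (NVar 1) _ s (fun m => models (trace tape (m * (k * T)))) d).
- exact: (static_d st0).
- exact: m0.
move=> m s1 md f1 h1; pose i := Ordinal md.
have h2 : models (trace tape (m * (k * T))) (tick 1 (set_nvar 4 m s1)).
  by apply: (models_frame (frame_set_nvar 4 m s1 1)).
have n2 := nvar_set 4 m s1 1.
move: (tick _ _) h2 n2 => s2 h2 n2.
set q2 := For 5 _ _.
suff : models (trace tape ((m * k + k) * T)) (exec tape q2 s2).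
  by rewrite -mulSnr -mulnA.
rewrite /q2; apply: (@For_rule R tape 5 (NLit k) _ s2 (fun c => models (trace tape ((m * k + c) * T))) k) => //.
  by rewrite addn0 -mulnA; case: h2.
move=> c s3 ck f3 h3; pose u := Ordinal ck.
have h4 : models (trace tape ((m * k + c) * T)) (tick 1 (set_nvar 5 c s3)).
  by apply: (models_frame (frame_set_nvar 5 c s3 1)).
have f4 := frame_set 5 c 1 f3.
have n4 := nvar_set 5 c s3 1.
move: (tick _ _) h4 f4 n4 => s4 h4 f4 n4; rewrite /framed /= in f4.
rewrite exec_seq.
have f5 := frame_exec (NSet 6 (NAdd (NVar 5) (NLit 1))) tape f4.
have n5 : nvar (exec tape (NSet 6 (NAdd (NVar 5) (NLit 1))) s4) 6 = c.+1.
  by rewrite nvar_NSet /= n4 addn1.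
have h5 : models (trace tape ((m * k + c) * T)) (exec tape (NSet 6 (NAdd (NVar 5) (NLit 1))) s4).
  by apply: (models_frame (exec_frame (NSet 6 (NAdd (NVar 5) (NLit 1))) tape s4)).
move: (exec tape (NSet _ _) s4) f5 n5 h5 => s5 f5 n5 h5; rewrite /framed /= in f5.
have n54 : nvar s5 4 = m by rewrite (frame_nvar f5).
have [[_ _ hT _ _] _ _ _] := h5.
set q6 := For 7 _ _.
suff : models (trace tape ((m * k + c) * T + T)) (exec tape q6 s5) by rewrite -mulSnr addnS.
rewrite /q6; apply: (@For_rule R tape 7 (NVar 3) _ s5 (fun t => models (trace tape ((m * k + c) * T + t))) T) => //.
  by rewrite addn0; case: h5.
move=> t s6 tT f6 h6.
have h7 : models (trace tape ((m * k + c) * T + t)) (tick 1 (set_nvar 7 t s6)).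
  by apply: (models_frame (frame_set_nvar 7 t s6 1)).
have n7 := nvar_set 7 t s6 1.
have n74 : nvar (tick 1 (set_nvar 7 t s6)) 4 = i.
  by rewrite /= updateE /= (frame_nvar f6).
have n76 : nvar (tick 1 (set_nvar 7 t s6)) 6 = (u : nat).+1.
  by rewrite /= updateE /= (frame_nvar f6).
move: (tick _ _) h7 n7 n74 n76 => s7 h7 n7 n74 n76.
by rewrite addnS traceS; apply: (exec_step tape h7 n74 n76 n7); rewrite ?size_trace.
Qed.

End Training.

(** * Output and initialization *)

Section Tables.
Context (R : realType).
Implicit Types (s : store R).

Definition table (a : nat) (out : seq nat -> R) (D : seq nat -> Prop) s : Prop :=
  forall ix, D ix -> rarr s a ix = out ix.

Lemma For_table tape x e q s0 (m : nat) (S : nat -> seq nat -> Prop) a out :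
  neval s0 e = m ->
  (forall c s D, (c < m)%N -> framed (For x e q) s0 s -> table a out D s ->
     table a out (fun ix => D ix \/ S c ix) (exec tape q (tick 1 (set_nvar x c s)))) ->
  forall D, table a out D s0 ->
  table a out (fun ix => D ix \/ exists2 c, (c < m)%N & S c ix) (exec tape (For x e q) s0).
Proof.
move=> em step D D0.
apply: (@For_rule R tape x e q s0
  (fun m => table a out (fun ix => D ix \/ exists2 c, (c < m)%N & S c ix)) m em).
  by move=> ix [Dix|[c]]//; exact: D0.
move=> c s cm fr Ic ix [Dix|[c' c'm Sc]].
  by apply: (step c s _ cm fr Ic); left; left.
move: c'm; rewrite ltnS leq_eqVlt => /orP[/eqP E|lt].
  by rewrite E in Sc; apply: (step c s _ cm fr Ic); right.
by apply: (step c s _ cm fr Ic); left; right; exists c'.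
Qed.

End Tables.

Section Output.
Context (R : realType) (d k n : nat) (X : dataset n d k.+1) (lam : R).
Notation pattern := {ffun 'I_k.+1 -> bool}.
Context (T : nat) (beta : R).
Implicit Types (s : store R).
Notation static := (static X lam T beta).

(** The centering matrix: the identity minus the matrix with all entries [1 / k.+1]. *)
Definition centering (u v : nat) : R := (u == v)%:R - 1 / k.+1%:R.

Definition centered_entry (w : seq nat -> R) (ix : seq nat) : R :=
  match ix with
  | [:: i; j; u; b] => 2 * lam *
     (\sum_(u' < k.+1) \sum_(b' < k.+1)
        centering u u' * centering b b' * w [:: i; u' : nat; j; b' : nat])
  | _ => 0
  end.

Lemma reval_center s e1 e2 : reval s (center_exp k e1 e2) = centering (neval s e1) (neval s e2).
Proof. by rewrite /center_exp -[LHS]/((neval s (neq e1 e2))%:R - 1 / k.+1%:R) neval_neq. Qed.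

Definition code_center : program :=
  For 12 (NLit k.+1)
    (For 11 (NLit k.+1)
      (radd_to 11 (RMul (RMul (center_exp k (NVar 6) (NVar 12))
                              (center_exp k (NVar 10) (NVar 11)))
                        (RGet 4 [:: 4; 12; 9; 11])))).

Lemma exec_center tape s i j u b : nvar s 4 = i -> nvar s 9 = j -> nvar s 6 = u -> nvar s 10 = b ->
  rarr s 11 [::] = 0 ->
  rarr (exec tape code_center s) 11 [::] =
  \sum_(u' < k.+1) \sum_(b' < k.+1)
        centering u u' * centering b b' * rarr s 4 [:: i; u' : nat; j; b' : nat].
Proof.
move=> h4 h9 h6 h10 h11.
pose F (u' b' : 'I_k.+1) := centering u u' * centering b b' * rarr s 4 [:: i; u' : nat; j; b' : nat].
rewrite -[RHS]add0r -(foldl_sum (fun u' => \sum_b' F u' b')).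
rewrite /code_center.
apply: (@For_fold R tape 12 (NLit k.+1) _ s k.+1 R (fun a u' => a + \sum_b' F u' b') 0
  (fun a s => rarr s 11 [::] = a)) => //.
move=> u' a s1 f1 r1.
have f2 := frame_set 12 u' 1 f1; have n2 := nvar_set 12 u' s1 1.
have r2 : rarr (tick 1 (set_nvar 12 u' s1)) 11 [::] = a by [].
move: (tick _ _) f2 n2 r2 => s2 f2 n2 r2; rewrite /framed /= in f2.
rewrite -(foldl_sum (fun b' => F u' b')).
apply: (@For_fold R tape 11 (NLit k.+1) _ s2 k.+1 R (fun a b' => a + F u' b') a
  (fun a s => rarr s 11 [::] = a)) => //.
move=> b' c s3 f3 r3.
have f4 := frame_set 11 b' 1 (frame_cat f2 f3); have n4 := nvar_set 11 b' s3 1.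
have n412 : nvar (tick 1 (set_nvar 11 b' s3)) 12 = u' by rewrite /= updateE /= (frame_nvar f3).
have r4 : rarr (tick 1 (set_nvar 11 b' s3)) 11 [::] = c by [].
move: (tick _ _) f4 n4 n412 r4 => s4 f4 n4 n412 r4; rewrite /framed /= in f4.
rewrite /radd_to rarr_RPut_same//.
rewrite -[LHS]/(rarr s4 11 [::] + (reval s4 (center_exp k (NVar 6) (NVar 12)) *
  reval s4 (center_exp k (NVar 10) (NVar 11)) * rarr s4 4 [:: nvar s4 4; nvar s4 12; nvar s4 9; nvar s4 11])).
rewrite !reval_center r4 /= (frame_rarr f4)// n4 n412.
by rewrite !(frame_nvar f4)// h4 h6 h9 h10.
Qed.

Lemma exec_output tape s (i j : 'I_d) (u b : 'I_k.+1) : static s ->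
  rarr (exec tape (code_output k) s) 3 [:: i : nat; j : nat; u : nat; b : nat] =
  centered_entry (rarr s 4) [:: i : nat; j : nat; u : nat; b : nat].
Proof.
move=> st; set out := centered_entry (rarr s 4).
pose D4 (i j u c : nat) ix := ix = [:: i; j; u; c].
pose D3 (i j c : nat) ix := exists2 b, (b < k.+1)%N & D4 i j c b ix.
pose D2 (i c : nat) ix := exists2 u, (u < k.+1)%N & D3 i c u ix.
pose D1 (c : nat) ix := exists2 j, (j < d)%N & D2 c j ix.
suff : table 3 out (fun ix => False \/ exists2 c, (c < d)%N & D1 c ix) (exec tape (code_output k) s).
  apply; right; exists (i : nat); first exact: ltn_ord.
  exists (j : nat); first exact: ltn_ord.
  exists (u : nat); first exact: ltn_ord.
  by exists (b : nat); first exact: ltn_ord.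
apply: For_table; [exact: (static_d st)| |by []].
move=> {}i s1 D id f1 t1.
have f2 := frame_set 4 i 1 f1; have n24 := nvar_set 4 i s1 1.
have t2 : table 3 out D (tick 1 (set_nvar 4 i s1)) by [].
move: (tick _ _) f2 n24 t2 => s2 f2 n24 t2 {f1 t1 s1}; rewrite /framed /= in f2.
have st2 : static s2 by exact: (static_frame f2).
apply: For_table t2; first exact: (static_d st2).
move=> {}j s3 {}D jd f3 t3.
have f4 := frame_set 9 j 1 (frame_cat f2 f3); have n49 := nvar_set 9 j s3 1.
have n44 : nvar (tick 1 (set_nvar 9 j s3)) 4 = i by rewrite /= updateE /= (frame_nvar f3).
have t4 : table 3 out D (tick 1 (set_nvar 9 j s3)) by [].
move: (tick _ _) f4 n49 n44 t4 => s4 f4 n49 n44 t4 {f3 t3 s3}; rewrite /framed /= in f4.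
apply: For_table t4 => //.
move=> {}u s5 {}D uk f5 t5.
have f6 := frame_set 6 u 1 (frame_cat f4 f5); have n66 := nvar_set 6 u s5 1.
have n64 : nvar (tick 1 (set_nvar 6 u s5)) 4 = i by rewrite /= updateE /= (frame_nvar f5).
have n69 : nvar (tick 1 (set_nvar 6 u s5)) 9 = j by rewrite /= updateE /= (frame_nvar f5).
have t6 : table 3 out D (tick 1 (set_nvar 6 u s5)) by [].
move: (tick _ _) f6 n66 n64 n69 t6 => s6 f6 n66 n64 n69 t6 {f5 t5 s5}; rewrite /framed /= in f6.
apply: For_table t6 => //.
move=> {}b s7 {}D bk f7 t7.
have f8 := frame_set 10 b 1 (frame_cat f6 f7); have n810 := nvar_set 10 b s7 1.
have n84 : nvar (tick 1 (set_nvar 10 b s7)) 4 = i by rewrite /= updateE /= (frame_nvar f7).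
have n89 : nvar (tick 1 (set_nvar 10 b s7)) 9 = j by rewrite /= updateE /= (frame_nvar f7).
have n86 : nvar (tick 1 (set_nvar 10 b s7)) 6 = u by rewrite /= updateE /= (frame_nvar f7).
have t8 : table 3 out D (tick 1 (set_nvar 10 b s7)) by [].
move: (tick _ _) f8 n810 n84 n89 n86 t8 => s8 f8 n810 n84 n89 n86 t8 {f7 t7 s7}; rewrite /framed /= in f8.
rewrite 2!exec_seq -/code_center.
have f9 := frame_exec (RPut 11 [::] (rlit 0)) tape f8.
have g9 := exec_frame (RPut 11 [::] (rlit 0)) tape s8.
have r9 : rarr (exec tape (RPut 11 [::] (rlit 0)) s8) 11 [::] = 0 by rewrite rarr_RPut_same.
move: (exec tape (RPut 11 _ _) s8) f9 g9 r9 => s9 f9 g9 r9; rewrite /framed /= in f9 g9.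
have n94 : nvar s9 4 = i by rewrite (frame_nvar g9).
have n99 : nvar s9 9 = j by rewrite (frame_nvar g9).
have n96 : nvar s9 6 = u by rewrite (frame_nvar g9).
have n910 : nvar s9 10 = b by rewrite (frame_nvar g9).
have r10 := exec_center tape n94 n99 n96 n910 r9.
rewrite (frame_rarr f9)// in r10.
have f10 := frame_exec code_center tape f9.
have g10 := frame_cat g9 (exec_frame code_center tape s9).
have h10 := exec_frame code_center tape s9.
move: (exec tape code_center s9) f10 g10 h10 r10 => s10 f10 g10 h10 r10; rewrite /framed /= in f10 g10 h10.
have [_ _ _ _ [hl _ _]] : static s10 by exact: (static_frame f10).
move=> ix; rewrite rarr_RPut /subscript [map _ _]/=.
rewrite !(frame_nvar h10)// n94 n99 n96 n910.
case: eqP => [-> _|ne [Dix|//]].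
  by rewrite -[LHS]/(2 * rarr s10 0 [::] * rarr s10 11 [::]) hl r10.
by rewrite (frame_rarr g10)//; exact: t8.
Qed.

End Output.

Section Init.
Context (R : realType) (k : nat).
Notation pattern := {ffun 'I_k.+1 -> bool}.
Implicit Types (s : store R).

(** For [K >= 0], the minimum of [n] and the integer part of [K], in the form in which the loop
    computes it. *)
Fixpoint iteration_count (K : R) (n : nat) : nat :=
  if n is n'.+1 then
    let t := iteration_count K n' in if t.+1%:R <= K then t.+1 else t
  else 0%N.

Lemma iteration_count_le K n : (iteration_count K n <= n)%N.
Proof. by elim: n => //= n IH; case: ifP => _; rewrite ?ltnS// leqW. Qed.

Lemma iteration_count_leK K n : 0 <= K -> (iteration_count K n)%:R <= K.
Proof. by move=> K0; elim: n => //= n IH; case: ifP. Qed.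

Lemma iteration_count_max K n : K <= n%:R -> K < (iteration_count K n).+1%:R.
Proof.
(* Either every test so far succeeded, or the count has reached the integer part and stays there. *)
have H m : iteration_count K m = m \/ K < (iteration_count K m).+1%:R.
  elim: m => [|m [IH|IH]] /=; first by left.
    by rewrite IH; case: (leP m.+1%:R K) => h; [left|right].
  by rewrite leNgt IH /=; right.
case: (H n) => // -> /le_lt_trans; apply; by rewrite ltr_nat.
Qed.

Definition iteration_bound (lam alpha : R) : R :=
  (16 * 16) * (16 * 16) * (lam * lam * (k.+1%:R * k.+1%:R * expR (16 * lam))) / (alpha * alpha).

Definition temperature (d T : nat) (rho : R) : R :=
  expR (ln (rho / (16 * d%:R * k.+1%:R * T%:R)) / 2).

Definition sign_value (q b : nat) : R := sgn R (pattern_bit k q b).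

Lemma exec_sign tape s q b ix :
  rarr (exec tape (code_sign k (q, b)) s) 5 ix =
  if ix == [:: q; b] then sign_value q b else rarr s 5 ix.
Proof.
rewrite /code_sign 2!exec_seq rarr_RPut /subscript /=; case: eqP => // _.
by rewrite /sign_value; case: (pattern_bit k q b); rewrite /sgn //= sub0r.
Qed.

Lemma exec_signs tape l s (code := foldr (fun x p => Seq (code_sign k x) p) Skip) :
  frame [:: 12; 11]%N [::] [:: 5]%N true s (exec tape (code l) s) /\
  forall q b, rarr (exec tape (code l) s) 5 [:: q; b] = if (q, b) \in l then sign_value q b else rarr s 5 [:: q; b].
Proof.
elim: l s => [|[q b] l IH] s; first by split.
rewrite [code _]/= exec_seq -/code.
have f1 := exec_frame (code_sign k (q, b)) tape s.
have r1 := exec_sign tape s q b.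
move: (exec tape (code_sign k (q, b)) s) f1 r1 => s1 f1 r1; rewrite /framed /= in f1.
have [f2 r2] := IH s1.
split.
  apply: frame_sub (frame_cat f1 f2) => //= x; rewrite !inE;
  by move=> h; repeat (case/orP: h => [->|h]); rewrite ?orbT// h ?orbT.
move=> q' b'; rewrite r2 in_cons r1 eqseq_cons eqseq_cons andbT -pair_eqE /pair_eq /=.
case: ((q', b') \in l); first by rewrite orbT.
by rewrite orbF; case: andP => // -[/eqP -> /eqP ->].
Qed.

Lemma exec_init (d n : nat) (lam rho alpha : R) (X : dataset n d k.+1) tape
  (T := iteration_count (iteration_bound lam alpha) n) (s0 := input_store lam rho alpha X)
  (s := exec tape (code_init k) s0) :
  static X lam T (temperature d T rho) s /\ draws s = 0%N /\
  rarr s 4 = fun _ => 0.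
Proof.
have e0 : s0 = input_store lam rho alpha X by [].
have a0 : [/\ nvar s0 0 = n, nvar s0 1 = d & nvar s0 3 = 0%N] by [].
have b0 : [/\ rarr s0 0 [::] = lam, rarr s0 1 [::] = rho & rarr s0 2 [::] = alpha] by [].
have c0 : draws s0 = 0%N by [].
have x0 : forall (t : 'I_n) (j : 'I_d), narr s0 0 [:: t : nat; j : nat] = tnth (tnth X t) j.
  by move=> t j; rewrite /= !valK.
have v0 : rarr s0 4 = fun _ => 0 by apply/funext => -[|? ?].
rewrite /s /code_init /code_iterations 3!exec_seq.
move: s0 a0 b0 c0 x0 v0 {s e0} => s0 [a00 a01 a03] [b00 b01 b02] c0 x0 v0.
set it := RPut 13 _ _.
have r13 : rarr (exec tape it s0) 13 [::] = iteration_bound lam alpha.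
  by rewrite rarr_RPut_same//= b00 b02.
have f1 := exec_frame it tape s0.
move: (exec tape it s0) r13 f1 => s1 r13 f1; rewrite /framed /= in f1.
set lp := For 8 _ _.
have n3 : nvar (exec tape lp s1) 3 = T.
  apply: (@For_rule R tape 8 (NVar 0) _ s1 (fun m s => nvar s 3 = iteration_count (iteration_bound lam alpha) m) n) => //.
  - by rewrite /= (frame_nvar f1).
  - by rewrite /= (frame_nvar f1).
  move=> m s2 mn f2 h2.
  rewrite exec_if.
  have -> : beval (tick 1 (set_nvar 8 m s2)) (BRLe (RNat (NAdd (NVar 3) (NLit 1))) (rvar 13)) =
     ((iteration_count (iteration_bound lam alpha) m).+1%:R <= iteration_bound lam alpha).
    by rewrite /= updateE /= h2 addn1 (frame_rarr f2)// r13.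
  by rewrite [RHS]/=; case: ifP => _; rewrite /= !updateE /= h2 ?addn1.
have f2 := frame_exec lp tape f1.
move: (exec tape lp s1) n3 f2 => s2 n3 f2; rewrite /framed /= in f2.
set tm := RPut 14 _ _.
have n21 : nvar s2 1 = d by rewrite (frame_nvar f2).
have r14 : rarr (exec tape tm s2) 14 [::] = temperature d T rho.
  by rewrite rarr_RPut_same//= n3 n21 (frame_rarr f2)// b01.
have f3 := frame_exec tm tape f2.
have n33 : nvar (exec tape tm s2) 3 = T by [].
move: (exec tape tm s2) r14 f3 n33 => s3 r14 f3 n33; rewrite /framed /= in f3.
have [g4 r5] := exec_signs tape [seq (q, b) | q <- iota 0 #|{: pattern}|, b <- iota 0 k.+1] s3.
have f4 := frame_cat f3 g4; rewrite -/(code_signs k) in r5 g4 f4.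
move: (exec tape (code_signs k) s3) r5 g4 f4 => s4 r5 g4 f4; rewrite /= in f4.
split; [split|split].
- by rewrite (frame_nvar f4).
- by rewrite (frame_nvar f4).
- by rewrite (frame_nvar g4).
- by case: f4 => _ fa _ _; move=> t j; rewrite fa.
- split.
  + by rewrite (frame_rarr f4).
  + by rewrite (frame_rarr g4).
  move=> q b; rewrite r5.
  have -> : ((q : nat, b : nat) \in [seq (q, b) | q <- iota 0 #|{: pattern}|, b <- iota 0 k.+1]).
    by apply/allpairsP; exists (q : nat, b : nat); rewrite !mem_iota /= !add0n !ltn_ord.
  rewrite /sign_value /pattern_bit inord_val; congr (sgn _ (_ b)).
  by rewrite (enum_val_nth [ffun => false]).
- by rewrite (frame_draws f4).
by rewrite (frame_rarr f4).
Qed.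

End Init.

(** * The mechanism and its privacy *)

Section Estimator.
Context (R : realType) (d k : nat) (lam : R) (T : nat).
Notation pattern := {ffun 'I_k.+1 -> bool}.
Notation V := ('I_d * pattern)%type.
Implicit Types H : seq V.

Definition fitted_point H (i : 'I_d) (u : 'I_k.+1) (j : 'I_d) (b : 'I_k.+1) : R :=
  if unlift ord0 u is Some u' then fw_point R (segment T (i * k + u') H) j b else 0.

(** Centering in [b] removes the mean that the regressions do not determine; centering in [u]
    removes the common row of the reference letter. *)
Definition estimate H (i j : 'I_d) (u b : 'I_k.+1) : R :=
  2 * lam * (\sum_(u' < k.+1) \sum_(b' < k.+1)
    centering R k u u' * centering R k b b' * fitted_point H i u' j b').

Definition decode H : weights_array R d k.+1 :=
  [tuple [tuple [tuple [tuple if i == j then 0 else estimate H i j u b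
   | b < k.+1] | u < k.+1] | j < d] | i < d].

Lemma output_entry_decode H i j u b : i != j ->
  output_entry (decode H) i j u b = estimate H i j u b.
Proof. by move=> ij; rewrite /output_entry !tnth_mktuple (negbTE ij). Qed.

End Estimator.

Section Correctness.
Context (R : realType) (d k n : nat) (lam rho alpha : R).
Notation pattern := {ffun 'I_k.+1 -> bool}.
Notation V := ('I_d * pattern)%type.
Notation T := (iteration_count (iteration_bound k lam alpha) n).
Notation beta := (temperature k d T rho).
Context (i0 : 'I_d) (q0 : 'I_#|pattern|).
Hypotheses (i00 : i0 = 0%N :> nat) (q00 : q0 = 0%N :> nat).
Notation run X tape := (exec tape (code k) (input_store lam rho alpha X)).
Notation choices X tape := (trace X lam T beta i0 q0 tape (d * k * T)).

Lemma exec_code (X : dataset n d k.+1) tape :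
  read_output d k.+1 (run X tape) = decode lam T (choices X tape)
  /\ draws (run X tape) = (d * k * T)%N.
Proof.
rewrite /code /code_main 2!exec_seq.
have [st [dr r4]] := @exec_init R k d n lam rho alpha X tape.
move: (exec tape (code_init k) _) st dr r4 => s st dr r4.
have m0 : models X lam T beta [::] s.
  split; [exact: st|exact: dr|move=> i u j b|by move=> i j b; rewrite r4].
  have -> : segment T (i * k + u) [::] = [::] :> seq V by rewrite /segment; case: (_ * T)%N; case: T.
  by rewrite r4.
have := exec_train i00 q00 tape m0.
move: (exec tape (code_train k) s) => s1 [st1 dr1 m1 m2].
split; last first.
  rewrite (frame_draws (exec_frame (code_output k) tape s1 : frame _ _ _ true _ _)) dr1.
  by rewrite size_transcript.
apply: eq_mktuple => i; apply: eq_mktuple => j; apply: eq_mktuple => u; apply: eq_mktuple => b.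
case: eqP => // _; rewrite (exec_output tape i j u b st1) /centered_entry /estimate.
congr (_ * _); apply: eq_bigr => u' _; apply: eq_bigr => b' _; congr (_ * _).
rewrite /fitted_point; case: unliftP => [w ->|->]; last by rewrite m2.
by rewrite lift0 m1.
Qed.

Lemma nwrites_signs l : nwrites (foldr (fun x p => Seq (code_sign k x) p) Skip l) =
  flatten (nseq (size l) [:: 12; 11]%N).
Proof. by elim: l => //= x l ->. Qed.

Lemma loops_bounded_signs B l :
  loops_bounded B (foldr (fun x p => Seq (code_sign k x) p) Skip l).
Proof. by elim: l. Qed.

(** The program is cut in two because the number of steps is written by the first half and bounds a
    loop in the second, where it is a constant at most [n]. *)
Lemma clock_code : exists A B : nat, forall (d n : nat) (lam rho alpha : R) (X : dataset n d k.+1) tape,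
  (0 < d)%N ->
  (clock (exec tape (code k) (input_store lam rho alpha X)) <= A * (n + d) ^ B)%N.
Proof.
have [A1 [B1 H1]] := cost_poly (code_init k).
have [A2 [B2 H2]] := cost_poly (code_main k).
exists (A1 + A2)%N, (B1 + B2)%N => d' n' lam' rho' alpha' X tape d0.
have L0 : (0 < n' + d')%N by rewrite addn_gt0 d0 orbT.
rewrite /code exec_seq.
set s0 := input_store _ _ _ _.
have c1 : (clock (exec tape (code_init k) s0) <= cost (n' + d') (code_init k) + clock s0)%N.
  apply: (@clock_le _ tape [:: 0; 1]%N).
  - by rewrite /= loops_bounded_signs.
  - move=> x xB; rewrite /= nwrites_signs !inE !negb_or /=.
    have h : x \notin flatten (nseq (size [seq (q, b) | q <- iota 0 #|{: pattern}|, b <- iota 0 k.+1]) [:: 12; 11]%N).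
      by elim: (size _) => //= m IH; rewrite !inE !negb_or IH; move: xB; rewrite !inE => /orP[]/eqP->.
    by rewrite h; move: xB; rewrite !inE => /orP[]/eqP->.
  by move=> x; rewrite !inE => /orP[]/eqP->; rewrite /= ?leq_addr ?leq_addl.
have [st [dr _]] := @exec_init R k d' n' lam' rho' alpha' X tape.
have [h0 h1 h3 _ _] := st.
have c2 : (clock (exec tape (code_main k) (exec tape (code_init k) s0)) <=
   cost (n' + d') (code_main k) + clock (exec tape (code_init k) s0))%N.
  apply: (@clock_le _ tape [:: 0; 1; 3]%N) => //.
    by move=> x; rewrite !inE => /or3P[]/eqP->.
  move=> x; rewrite !inE => /or3P[]/eqP->; rewrite ?h0 ?h1 ?h3 ?leq_addr ?leq_addl//.
  by apply: leq_trans (iteration_count_le _ _) (leq_addr _ _).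
apply: leq_trans c2 _; rewrite mulnDl addnC.
have p1 : (A1 * (n' + d') ^ B1 <= A1 * (n' + d') ^ (B1 + B2))%N by rewrite leq_mul2l leq_pexp2l ?leq_addr ?orbT.
have p2 : (A2 * (n' + d') ^ B2 <= A2 * (n' + d') ^ (B1 + B2))%N by rewrite leq_mul2l leq_pexp2l ?leq_addl ?orbT.
apply: leq_add; last exact: leq_trans (H2 _ L0) p2.
by apply: leq_trans c1 _; rewrite /= addn0; exact: leq_trans (H1 _ L0) p1.
Qed.

Context (t : nat).
Hypothesis mt : (d * k * T <= t)%N.

Definition output_fun (X : dataset n d k.+1) (r : t.-tuple R) : weights_array R d k.+1 :=
  read_output d k.+1 (run X (nth 0 r)).

Lemma choose_measurable (X : dataset n d k.+1) h v :
  measurable ([set x | choose X lam T beta i0 q0 h x = v] : set (measurableTypeR R)).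
Proof.
apply: measurable_scan; last by move=> ?; exact: expR_gt0.
exact: (i0, enum_val q0).
Qed.

Lemma choose_prob (X : dataset n d k.+1) h v :
  uniform_prob (@ltr01 R) [set x | choose X lam T beta i0 q0 h x = v]
  = (gibbs_choice (utility X lam T beta i0) h v)%:E.
Proof.
apply: (choose_item_law (w := fun a => expR (utility X lam T beta i0 h a))).
- by move=> ?; exact: expR_gt0.
- exact: uniq_vertices.
- exact: mem_vertices.
Qed.

Lemma output_funE (X : dataset n d k.+1) (A : set (weights_array R d k.+1)) :
  output_fun X @^-1` A = [set r : t.-tuple R | (decode lam T @^-1` A) (choices X (nth 0 r))].
Proof.
by apply/seteqP; split => r /=; rewrite /output_fun; have [-> _] := exec_code X (nth 0 r).
Qed.

Lemma measurable_output_fun (X : dataset n d k.+1) : measurable_fun [set: t.-tuple R] (output_fun X).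
Proof.
move=> _ A mA; rewrite setTI output_funE.
apply: measurable_transcript mt; exact: choose_measurable.
Qed.

HB.instance Definition _ (X : dataset n d k.+1) :=
  isMeasurableFun.Build _ _ _ _ (output_fun X) (measurable_output_fun X).

Definition mechanism (X : dataset n d k.+1) : probability (weights_array R d k.+1) R :=
  distribution (uniform_tape R t) [the {mfun _ >-> _} of output_fun X].

Lemma mechanism_law (X : dataset n d k.+1) A :
  mechanism X A = (\sum_(s : (d * k * T).-tuple V)
    likelihood (utility X lam T beta i0) [::] s * \1_A (decode lam T s))%:E.
Proof.
rewrite /mechanism /= /distribution /pushforward /= output_funE.
rewrite /trace (transcript_law (choose_measurable X) (choose_prob X))//.
Qed.

End Correctness.

Section Privacy.
Context (R : realType) (d k n : nat) (lam rho alpha : R).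
Notation pattern := {ffun 'I_k.+1 -> bool}.
Notation V := ('I_d * pattern)%type.
Notation T := (iteration_count (iteration_bound k lam alpha) n).
Notation beta := (temperature k d T rho).
Context (i0 : 'I_d) (q0 : 'I_#|pattern|).
Hypotheses (i00 : i0 = 0%N :> nat) (q00 : q0 = 0%N :> nat).
Hypothesis (k0 : (0 < k)%N).

Lemma letter_neq0 r : letter k r != ord0.
Proof. by rewrite -val_eqE /letter /= inordK// ltnS ltn_mod. Qed.

Lemma neighboring_eq (X X' : dataset n d k.+1) : neighboring X X' ->
  exists t0 : 'I_n, forall t, t != t0 -> tnth X t = tnth X' t.
Proof.
move=> /eqP/cards1P[t0 e]; exists t0 => t tt.
apply/eqP; apply: contraNT tt => ne.
have : t \in [set i : 'I_n | tnth X i != tnth X' i]%SET by rewrite inE.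
by rewrite e inE.
Qed.

Lemma fw_utility_sensitivity (X X' : dataset n d k.+1) i u h a : u != ord0 ->
  neighboring X X' -> `|fw_utility lam i u X h a - fw_utility lam i u X' h a| <= 2.
Proof.
move=> u0 /neighboring_eq[t0 e].
rewrite /fw_utility -sumrB (bigD1 t0)//= big1 ?addr0; last first.
  by move=> t /e et; rewrite /fw_margin et subrr.
apply: le_trans (ler_normB _ _) _; rewrite !normrM !norm_sgn !mulr1.
by have := residual_le i (tnth X t0) (fw_margin lam i X h t0) u0;
   have := residual_le i (tnth X' t0) (fw_margin lam i X' h t0) u0; lra.
Qed.

Lemma temperature_gt0 : 0 < beta. Proof. exact: expR_gt0. Qed.

Lemma temperature_sqr : (0 < T)%N -> (0 < d)%N -> 0 < rho ->
  beta ^+ 2 = rho / (16 * d%:R * k.+1%:R * T%:R).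
Proof.
move=> T0 d0 r0; rewrite /temperature -expRM_natl.
have h : 0 < rho / (16 * d%:R * k.+1%:R * T%:R).
  by rewrite divr_gt0// !mulr_gt0// ltr0n.
have -> : 2%:R * (ln (rho / (16 * d%:R * k.+1%:R * T%:R)) / 2) =
  ln (rho / (16 * d%:R * k.+1%:R * T%:R)) by field.
by rewrite lnK// posrE.
Qed.

(** Each of the [d * k * T] choices has scaled sensitivity [2 * beta] and costs [4 (2 beta)^2]; the
    temperature is calibrated to this sum. *)
Lemma budget : 0 < rho -> 4 * (2 * beta) ^+ 2 * (d * k * T)%:R <= rho.
Proof.
move=> r0; have d0 : (0 < d)%N by apply: leq_ltn_trans (ltn_ord i0).
have [->|T0] := posnP T; first by rewrite muln0 mulr0 ltW.
rewrite exprMn temperature_sqr// !natrM.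
have dp : 0 < d%:R :> R by rewrite ltr0n.
have kp : 0 < k.+1%:R :> R by rewrite ltr0n.
have tp : 0 < T%:R :> R by rewrite ltr0n.
have kk : k%:R <= k.+1%:R :> R by rewrite ler_nat.
have -> : 4 * (2 ^+ 2 * (rho / (16 * d%:R * k.+1%:R * T%:R))) * (d%:R * k%:R * T%:R) =
  rho * (k%:R / k.+1%:R) by field; rewrite !gt_eqF.
by rewrite ler_piMr ?(ltW r0)// ler_pdivrMr// mul1r.
Qed.

Lemma measurable_tuple_singleton (disp : measure_display) (S : measurableType disp)
    (m : nat) (y : m.-tuple S) :
  (forall x : S, measurable [set x]) -> measurable [set y].
Proof.
move=> ms.
have -> : [set y] = \bigcap_(i in [set: 'I_m]) ((fun x : m.-tuple S => tnth x i) @^-1` [set tnth y i]).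
  apply/seteqP; split => x /=; first by move=> -> i _.
  by move=> h; apply: eq_from_tnth => i; exact: h.
apply: fin_bigcap_measurable; first exact: finite_finset.
move=> i _; rewrite -[X in measurable X]setTI.
by apply: (measurable_tnth i) => //; exact: ms.
Qed.

Lemma measurable_weights_singleton (w : weights_array R d k.+1) : measurable [set w].
Proof. by do 4! apply: measurable_tuple_singleton => ?; exact: measurable_set1. Qed.

Context (t : nat).
Hypothesis mt : (d * k * T <= t)%N.
Notation mech := (mechanism rho i00 q00 mt).

Lemma mechanism_zCDP : 0 < rho -> zCDP rho mech.
Proof.
move=> r0 X X' nb a a1.
pose U (Y : dataset n d k.+1) := utility Y lam T beta i0.
pose v0 : V := (i0, enum_val q0).
have UB h v : `|U X h v - U X' h v| <= 2 * beta.
  rewrite /U /utility -mulrBr normrM ger0_norm ?(ltW temperature_gt0)// mulrC.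
  by apply: ler_wpM2r; [exact: ltW temperature_gt0|apply: fw_utility_sensitivity nb; exact: letter_neq0].
have h0 : (d * k * T).-tuple V := [tuple v0 | _ < _].
have law (Y : dataset n d k.+1) : mixture_law (fun s : (d * k * T).-tuple V => decode lam T s) (mech Y)
    (fun s => likelihood (U Y) [::] s).
  move=> A mA; rewrite mechanism_law -sumEFin; apply: eq_bigr => s _.
  by rewrite EFinM diracE indicE.
apply: (renyi_finite _ _ (law X) (law X') _ h0 a1).
- by move=> s; exact: likelihood_gt0.
- by move=> s; exact: likelihood_gt0.
- by move=> s; exact: measurable_weights_singleton.
rewrite (eq_bigr (fun s : (d * k * T).-tuple V => likelihood (U X') [::] s *
   expR (a * path_sum (fun h v => surprisal (U X') h v - surprisal (U X) h v) [::] s))); last first.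
  by move=> s _; rewrite likelihood_ratio expRK.
apply: le_trans (likelihood_renyi _ v0 _ a1 UB) _.
rewrite ler_expR.
have := budget r0; set c := 4 * _ * _ => hb.
have aa : 0 <= a * (a - 1) by nra.
by have := ler_wpM2r aa hb; lra.
Qed.

End Privacy.

(** * Surprisals of a single regression *)

Section LocalPaths.
Context (R : realType) (d k n : nat) (lam : R) (X : dataset n d k.+1) (T : nat) (beta : R) (i0 : 'I_d).
Notation pattern := {ffun 'I_k.+1 -> bool}.
Notation V := ('I_d * pattern)%type.

Lemma path_sum_ext (f g : seq V -> V -> R) h h' s :
  (forall s1 a s2, s = s1 ++ a :: s2 -> f (h ++ s1) a = g (h' ++ s1) a) ->
  path_sum f h s = path_sum g h' s.
Proof.
elim: s h h' => //= a s IH h h' fg.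
have := fg [::] a s erefl; rewrite !cats0 => ->; congr (_ + _).
by apply: IH => s1 b s2 e; rewrite !cat_rcons; apply: (fg (a :: s1) b s2); rewrite e.
Qed.

Lemma path_sum0 (f : seq V -> V -> R) h s :
  (forall s1 a s2, s = s1 ++ a :: s2 -> f (h ++ s1) a = 0) -> path_sum f h s = 0.
Proof.
move=> f0; rewrite (@path_sum_ext f (fun _ _ => 0) h h) //.
by elim: s h {f0} => //= a s IH h; rewrite IH addr0.
Qed.

(** The weights of the averaged Frank-Wolfe gap of regression [r], extended by zero to the positions
    owned by other regressions. *)
Definition step_weight (r m : nat) : R :=
  if (r * T <= m < r * T + T)%N then 2 * (m - r * T).+1%:R / (T%:R * T.+1%:R) else 0.

Lemma step_weight_bounds r m : 0 <= step_weight r m <= 1.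
Proof.
rewrite /step_weight; case: ifP => [/andP[h1 h2]|_]; last by rewrite lexx ler01.
have T0 : (0 < T)%N by lia.
have tp : 0 < T%:R :> R by rewrite ltr0n.
have tp1 : 0 < T.+1%:R :> R by rewrite ltr0n.
rewrite divr_ge0 ?mulr_ge0//= ler_pdivrMr ?mulr_gt0// mul1r.
have h3 : (m - r * T).+1%:R <= T%:R :> R by rewrite ler_nat; lia.
have h4 : 2 <= T.+1%:R :> R by rewrite ler_nat.
by rewrite mulrC; apply: ler_pM.
Qed.

(** The first [j] weights inside the segment sum to [j (j + 1) / (T (T + 1))], which is 1 at
    [j = T]. *)
Lemma sum_step_weight (r m : nat) : \sum_(t < m) step_weight r t <= 1.
Proof.
have [T0|T0] := posnP T.
  by rewrite big1 ?ler01// => t _; rewrite /step_weight; case: ifP => // /andP[]; lia.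
have tp : 0 < T%:R :> R by rewrite ltr0n.
have tp1 : 0 < T.+1%:R :> R by rewrite ltr0n.
have H j : (j <= T)%N -> \sum_(t < r * T + j) step_weight r t = j%:R * j.+1%:R / (T%:R * T.+1%:R).
  elim: j => [|j IH] jT.
    rewrite mul0r mul0r big1// => t _; rewrite /step_weight; case: ifP => // /andP[h _].
    by have := ltn_ord t; lia.
  rewrite addnS big_ord_recr /= IH ?(ltnW jT)// /step_weight leq_addr ltn_add2l jT addKn.
  by rewrite -[j.+2%:R]natr1 -[j.+1%:R]natr1 /=; field; rewrite !gt_eqF.
have E : \sum_(t < r * T + T) step_weight r t = 1.
  by rewrite H// divff// gt_eqF ?mulr_gt0.
rewrite -E -(big_mkord xpredT (step_weight r)) -(big_mkord xpredT (step_weight r)).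
have nn t : 0 <= step_weight r t by have /andP[] := step_weight_bounds r t.
have [mT|Tm] := leqP m (r * T + T).
  by rewrite [leRHS](big_cat_nat (n := m))//= lerDl sumr_ge0.
rewrite (big_cat_nat (n := r * T + T)) ?(ltnW Tm)//= gerDl.
rewrite big_nat_cond big1// => t /andP[/andP[h _] _].
by rewrite /step_weight; case: ifP => // /andP[]; lia.
Qed.

(** This makes the tail bound for the joint sampler available to each regression without
    conditioning on the earlier ones. *)
Lemma path_sum_segment (r M : nat) (H : seq V) : size H = (M * T)%N -> (r < M)%N ->
  path_sum (fun h b => step_weight r (size h) * surprisal (utility X lam T beta i0) h b) [::] H =
  path_sum (fun h a => 2 * (size h).+1%:R / (T%:R * T.+1%:R) *
      fw_surprisal lam beta (node k i0 r) (letter k r) X h a) [::] (segment T r H).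
Proof.
move=> sH rM; set f := fun h b => _.
have hM : (r * T + T <= M * T)%N by rewrite -mulSnr leq_mul2r rM orbT.
pose A := take (r * T) H; pose B := drop (r * T) H.
have sA : size A = (r * T)%N by rewrite size_take_min sH; lia.
have HE : H = A ++ (segment T r H ++ drop T B).
  by rewrite /segment /A /B cat_take_drop cat_take_drop.
have sS : size (segment T r H) = T.
  by rewrite /segment size_take_min size_drop sH; lia.
rewrite {1}HE path_sum_cat path_sum_cat !cat0s.
rewrite (@path_sum0 f [::] A) ?add0r; last first.
  move=> s1 a s2 e; rewrite /f cat0s /step_weight.
  have : (size s1 < r * T)%N by rewrite -sA e size_cat /= -addSnnS leq_addr.
  by move=> h; rewrite leqNgt h /= mul0r.
rewrite (@path_sum0 f (A ++ segment T r H) (drop T B)) ?addr0; last first.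
  move=> s1 a s2 e; rewrite /f /step_weight !size_cat sA sS.
  by case: ifP => [/andP[]|_]; [lia|rewrite mul0r].
apply: path_sum_ext => s1 a s2 e.
have s1T : (size s1 < T)%N by move: sS; rewrite e size_cat /=; lia.
rewrite cat0s /f /step_weight size_cat sA leq_addr ltn_add2l s1T addKn.
congr (_ * _).
have seg : segment T r (A ++ s1) = s1.
  by rewrite /segment drop_cat sA ltnn subnn drop0 take_oversize// ltnW.
have uE b : utility X lam T beta i0 (A ++ s1) b = beta * fw_utility lam (node k i0 r) (letter k r) X s1 b.
  by rewrite /utility size_cat sA size_div// seg.
rewrite /surprisal /fw_surprisal uE; congr (ln _ - _).
by apply: eq_bigr => b _; rewrite uE.
Qed.

End LocalPaths.

(** * Accuracy *)

Section Numerics.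
Context (R : realType) (d k n : nat) (lam rho alpha : R).
Hypotheses (d2 : (2 <= d)%N) (k1 : (1 <= k)%N).
Hypotheses (lam0 : 0 < lam) (rho0 : 0 < rho) (alpha0 : 0 < alpha).
Variables (q dd : R).
Hypotheses (qE : q = k.+1%:R) (dE : dd = d%:R).
Notation x := (expR lam).
Notation L := (ln (d * k.+1)%:R : R).

Definition sample_size : Prop :=
  2 ^+ 30 * (lam ^+ 2 * q ^+ 5 * L * expR (34 * lam) / alpha ^+ 4
   + Num.sqrt dd * lam ^+ 2 * q `^ (11 / 2) * L ^+ 2 * expR (34 * lam)
     / (Num.sqrt rho * alpha ^+ 3)) <= n%:R.
Hypothesis enough : sample_size.
Hypothesis alpha_lt : alpha < 16 * lam.

Let q2 : 2 <= q. Proof. by rewrite qE ler_nat ltnS. Qed.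
Let qp : 0 < q. Proof. by rewrite qE ltr0n. Qed.
Let dd2 : 2 <= dd. Proof. by rewrite dE ler_nat. Qed.
Let dp : 0 < dd. Proof. by rewrite dE ltr0n ltnW. Qed.
Let x1 : 1 <= x. Proof. by have := expR_ge1Dx lam; have := lam0; lra. Qed.
Let xl : lam <= x. Proof. by have := expR_ge1Dx lam; have := lam0; lra. Qed.
Let ex (m : nat) : expR (m%:R * lam) = x ^+ m. Proof. exact: expRM_natl. Qed.

Let eL : expR L = dd * q.
Proof. by rewrite lnK ?natrM -?qE -?dE// posrE mulr_gt0. Qed.

Let dq4 : 4 <= dd * q. Proof. by have := q2; have := dd2; nra. Qed.

Let L1 : 1 <= L.
Proof.
rewrite -ler_expR eL; apply: le_trans dq4.
by have := @expR_le1Dx2 R 1 (lexx _); lra.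
Qed.

Let sqrtd0 : 0 < Num.sqrt dd :> R. Proof. by rewrite sqrtr_gt0. Qed.
Let sqrtq0 : 0 < Num.sqrt q. Proof. by rewrite sqrtr_gt0. Qed.
Let sqrtr0 : 0 < Num.sqrt rho. Proof. by rewrite sqrtr_gt0. Qed.

Let power_q : q `^ (11 / 2) = q ^+ 5 * Num.sqrt q.
Proof.
have -> : 11 / 2 = 5%:R + 2^-1 :> R by field.
by rewrite powRD ?powR_mulrn ?powR12_sqrt// ?(gt_eqF qp) ?implybT ?(ltW qp).
Qed.

Lemma sample_size_statistical : 2 ^+ 30 * (lam ^+ 2 * q ^+ 5 * L * x ^+ 34 / alpha ^+ 4) <= n%:R.
Proof.
apply: le_trans enough; rewrite -ex ler_pM2l ?exprn_gt0// lerDl.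
have l0 : 0 <= L by apply: le_trans L1.
by rewrite !(divr_ge0, mulr_ge0, exprn_ge0, sqrtr_ge0, powR_ge0, expR_ge0, ltW alpha0)// ?ltW.
Qed.

Lemma sample_size_private :
  2 ^+ 30 * (Num.sqrt dd * lam ^+ 2 * (q ^+ 5 * Num.sqrt q) * L ^+ 2 * x ^+ 34
     / (Num.sqrt rho * alpha ^+ 3)) <= n%:R.
Proof.
apply: le_trans enough; rewrite -ex -power_q ler_pM2l ?exprn_gt0// lerDr.
have l0 : 0 <= L by apply: le_trans L1.
by rewrite !(divr_ge0, mulr_ge0, exprn_ge0, expR_ge0, ltW alpha0)// ?ltW.
Qed.

Lemma iteration_boundE :
  iteration_bound k lam alpha = 2 ^+ 16 * lam ^+ 2 * q ^+ 2 * x ^+ 16 / alpha ^+ 2.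
Proof. by rewrite /iteration_bound -qE -ex; field; rewrite gt_eqF. Qed.

(** Needed for at least one Frank-Wolfe step. It rests on [alpha < 16 lambda], which gives
    [alpha^2 <= 2^8 lambda^2]. *)
Lemma iteration_bound_ge2 : 2 <= iteration_bound k lam alpha.
Proof.
rewrite iteration_boundE ler_pdivlMr ?exprn_gt0//.
have a2 : alpha ^+ 2 <= 2 ^+ 8 * lam ^+ 2 by have := lam0; have := alpha0; have := alpha_lt; nra.
have q4 : 1 <= q ^+ 2 by rewrite exprn_ege1//; have := q2; lra.
have x16 : 1 <= x ^+ 16 by exact: exprn_ege1.
have l2 : 0 <= lam ^+ 2 by exact: sqr_ge0.
have h : 1 <= q ^+ 2 * x ^+ 16 by rewrite -[leLHS]mulr1; apply: ler_pM.
have := ler_wpM2l l2 h; rewrite !mulrA mulr1; nra.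
Qed.

(** This ensures that the cap [n] does not cut the counting short of the integer part of the
    bound. *)
Lemma iteration_bound_le : iteration_bound k lam alpha <= n%:R.
Proof.
apply: le_trans sample_size_statistical; rewrite iteration_boundE.
have a4 : 0 < alpha ^+ 4 by rewrite exprn_gt0.
have -> : 2 ^+ 16 * lam ^+ 2 * q ^+ 2 * x ^+ 16 / alpha ^+ 2 =
  2 ^+ 16 * lam ^+ 2 * q ^+ 2 * x ^+ 16 * alpha ^+ 2 / alpha ^+ 4 by field; rewrite gt_eqF.
rewrite mulrA ler_pM2r ?invr_gt0//.
(* The extra [lambda^2] is absorbed into [e^(2 lambda)]. *)
have a2 : alpha ^+ 2 <= 2 ^+ 8 * x ^+ 2.
  apply: (@le_trans _ _ (2 ^+ 8 * lam ^+ 2)); first by have := lam0; have := alpha0; have := alpha_lt; nra.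
  by rewrite ler_pM2l//; apply: lerXn2r; rewrite ?nnegrE ?expR_ge0 ?(ltW lam0).
have c0 : 0 <= 2 ^+ 16 * lam ^+ 2 * q ^+ 2 * x ^+ 16.
  by rewrite !mulr_ge0// ?exprn_ge0 ?expR_ge0// ltW.
apply: le_trans (ler_wpM2l c0 a2) _.
have q0 : 0 <= q by exact: ltW.
have q1 : 1 <= q by have := q2; lra.
have h1 : q ^+ 2 <= q ^+ 5 * L.
  by rewrite -[leLHS]mulr1; apply: ler_pM; rewrite ?exprn_ge0// ler_weXn2l.
have h2 : x ^+ 18 <= x ^+ 34.
  by rewrite ler_weXn2l.
have h3 : q ^+ 2 * x ^+ 18 <= q ^+ 5 * L * x ^+ 34.
  by apply: ler_pM; rewrite ?exprn_ge0 ?expR_ge0.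
have c1 : 0 <= 2 ^+ 24 * lam ^+ 2 :> R by rewrite mulr_ge0 ?exprn_ge0// ltW.
have h4 := ler_wpM2l c1 h3.
have -> : 2 ^+ 16 * lam ^+ 2 * q ^+ 2 * x ^+ 16 * (2 ^+ 8 * x ^+ 2) =
   2 ^+ 24 * lam ^+ 2 * (q ^+ 2 * x ^+ 18) by ring.
apply: le_trans h4 _.
have -> : 2 ^+ 30 * (lam ^+ 2 * q ^+ 5 * L * x ^+ 34) =
  64 * (2 ^+ 24 * lam ^+ 2 * (q ^+ 5 * L * x ^+ 34)) by ring.
rewrite ler_peMl ?ler1n// !mulr_ge0// ?exprn_ge0 ?expR_ge0// ?ltW//.
by have := L1; lra.
Qed.

(** The recovery bound multiplies this by at most [68 q^2 e^(16 lambda)], and [68 / 2^9] is below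
    the [1 / 4] of [(alpha / 2)^2]. The deviation target equates [4 lambda e] with this gap. *)
Definition gap_target : R := alpha ^+ 2 / (2 ^+ 9 * q ^+ 2 * x ^+ 16).
Definition deviation_target : R := gap_target / (4 * lam).

Let two_pow : (2 ^ k.+1)%:R <= expR (q * L).
Proof.
rewrite natrX -[q * L]mulrC qE expRM_natr.
apply: lerXn2r; rewrite ?nnegrE ?expR_ge0//.
by have := expR_ge1Dx L; have := L1; lra.
Qed.

Let d_le : d%:R <= expR L.
Proof. by rewrite -dE eL ler_peMr ?ltW//; have := q2; lra. Qed.

Let sixteen : 16 <= expR (2 * L).
Proof. by rewrite expRM_natl eL; have := dq4; nra. Qed.

(** The sample size makes the exponent at least [16 q L], while the number of events is at most
    [2 e^(L + 2 (L + q L))], with [2 L <= q L]. *)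
Lemma deviation_target_prob :
  (2 * (d * k.+1 * (d * 2 ^ k.+1) ^ 2))%:R * expR (- (n%:R * deviation_target ^+ 2 / 16)) <= 1 / 6.
Proof.
have D : 16 * (q * L) <= n%:R * deviation_target ^+ 2 / 16.
  have e2 : deviation_target ^+ 2 = alpha ^+ 4 / (2 ^+ 22 * lam ^+ 2 * q ^+ 4 * x ^+ 32).
    by rewrite /deviation_target /gap_target; field; rewrite !gt_eqF ?expR_gt0.
  have p0 : 0 <= deviation_target ^+ 2 / 16 by rewrite divr_ge0 ?sqr_ge0.
  have H := ler_wpM2r p0 sample_size_statistical.
  have E : 2 ^+ 30 * (lam ^+ 2 * q ^+ 5 * L * x ^+ 34 / alpha ^+ 4) * (deviation_target ^+ 2 / 16) =
    16 * (q * L) * x ^+ 2.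
    by rewrite e2; field; rewrite !gt_eqF ?expR_gt0.
  rewrite E in H; rewrite -[leRHS]mulrA; apply: le_trans H.
  rewrite ler_peMr ?exprn_ege1// !mulr_ge0//; first exact: ltW.
  by apply: le_trans L1.
apply: (@le_trans _ _ ((2 * (d * k.+1 * (d * 2 ^ k.+1) ^ 2))%:R * expR (- (16 * (q * L))))).
  by rewrite ler_wpM2l// ler_expR lerN2.
rewrite expRN ler_pdivrMr ?expR_gt0// div1r ler_pdivlMl//.
have -> : (2 * (d * k.+1 * (d * 2 ^ k.+1) ^ 2))%:R = 2 * (expR L * (d%:R * (2 ^ k.+1)%:R) ^+ 2).
  by rewrite eL dE qE -[d%:R * (2 ^ _)%:R]natrM -natrX -!natrM.
have h1 : (d%:R * (2 ^ k.+1)%:R) ^+ 2 <= expR (2 * (L + q * L)).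
  rewrite expRM_natl; apply: lerXn2r; rewrite ?nnegrE ?expR_ge0 ?mulr_ge0//.
  by rewrite expRD; apply: ler_pM.
have h2 : 16 * (expR L * (d%:R * (2 ^ k.+1)%:R) ^+ 2) <= expR (2 * L + (L + 2 * (L + q * L))).
  rewrite 2!expRD; apply: ler_pM; [by []| |exact: sixteen|by rewrite ler_pM2l ?expR_gt0].
  by apply: mulr_ge0; [exact: expR_ge0|exact: sqr_ge0].
have h3 : 2 * L + (L + 2 * (L + q * L)) <= 16 * (q * L).
  have h : 2 * L <= q * L by rewrite ler_wpM2r//; have := L1; lra.
  by have := L1; lra.
rewrite -ler_expR in h3.
have h4 : 0 <= expR L * (d%:R * (2 ^ k.+1)%:R) ^+ 2 by rewrite mulr_ge0 ?expR_ge0 ?sqr_ge0.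
apply: le_trans (le_trans h2 h3); rewrite !mulrA; lra.
Qed.

Lemma log_vertices_le :
  ln (d * 2 ^ k.+1)%:R + ln (6 * (d * k.+1)%:R) <= 3 * (q * L).
Proof.
have h1 : ln (d * 2 ^ k.+1)%:R <= L + q * L.
  rewrite -ler_expR lnK ?posrE ?ltr0n ?muln_gt0 ?expn_gt0 ?(ltnW d2)//.
  by rewrite natrM expRD; apply: ler_pM.
have h2 : ln (6 * (d * k.+1)%:R) <= 2 * L + L.
  rewrite -ler_expR lnK ?posrE ?mulr_gt0 ?ltr0n ?muln_gt0 ?(ltnW d2)//.
  rewrite expRD eL [in leLHS]natrM -dE -qE; apply: ler_pM; [by []| | |by []].
    by apply: mulr_ge0; exact: ltW.
  by apply: le_trans sixteen; rewrite ler_nat.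
have h : 2 * L <= q * L by rewrite ler_wpM2r//; have := L1; lra.
by have := L1; lra.
Qed.

Lemma optimization_error (T : nat) : (0 < T)%N -> T%:R <= iteration_bound k lam alpha ->
  iteration_bound k lam alpha < T.+1%:R ->
  2 * lam / temperature k d T rho * (ln (d * 2 ^ k.+1)%:R + ln (6 * (d * k.+1)%:R))
    + 64 * lam ^+ 2 * n%:R / T.+1%:R <= n%:R * gap_target.
Proof.
move=> T0 TK KT; set b := temperature k d T rho.
have tp : 0 < T%:R :> R by rewrite ltr0n.
have tp1 : 0 < T.+1%:R :> R by rewrite ltr0n.
have b0 : 0 < b by exact: expR_gt0.
have xp : 0 < x by exact: expR_gt0.
have kp := qp.
have Lp : 0 < L := lt_le_trans ltr01 L1.
have np : 0 <= n%:R :> R by [].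
pose g2 := alpha ^+ 2 / (2 ^+ 10 * q ^+ 2 * x ^+ 16).
have g20 : 0 < g2 by rewrite divr_gt0 ?mulr_gt0 ?exprn_gt0.
have gE : n%:R * gap_target = n%:R * g2 + n%:R * g2.
  by rewrite /gap_target /g2; field; rewrite !gt_eqF.
rewrite gE; apply: lerD; last first.
  rewrite ler_pdivrMr// [leLHS]mulrC -[leRHS]mulrA; apply: ler_wpM2l => //.
  have -> : 64 * lam ^+ 2 = g2 * iteration_bound k lam alpha.
    by rewrite iteration_boundE /g2; field; rewrite !gt_eqF.
  by apply: ler_wpM2l; exact: ltW.
(* The inverse of [beta] with [T] replaced by its real bound, so that [b * y >= 1] follows from [T]
   being at most that bound. *)
pose y := 4 * Num.sqrt dd * Num.sqrt q * (2 ^+ 8 * lam * q * x ^+ 8 / alpha) / Num.sqrt rho.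
have y0 : 0 < y by rewrite !(divr_gt0, mulr_gt0, exprn_gt0).
have by1 : 1 <= b * y.
  rewrite -(@expr_ge1 _ 2)//; last by apply/ltW/mulr_gt0.
  rewrite exprMn.
  have d1 : (0 < d)%N by exact: ltnW.
  have bE : b ^+ 2 = rho / (16 * dd * q * T%:R).
    rewrite /b /temperature -expRM_natl -dE -qE.
    have h : 0 < rho / (16 * dd * q * T%:R) by rewrite divr_gt0// !mulr_gt0.
    have -> : 2%:R * (ln (rho / (16 * dd * q * T%:R)) / 2) = ln (rho / (16 * dd * q * T%:R)) by field.
    by rewrite lnK// posrE.
  have yE : y ^+ 2 = 16 * dd * q * iteration_bound k lam alpha / rho.
    rewrite /y !exprMn !exprVn !sqr_sqrtr ?(ltW rho0) ?(ltW dp) ?(ltW kp)// iteration_boundE.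
    by field; rewrite !gt_eqF.
  rewrite bE yE.
  have -> : rho / (16 * dd * q * T%:R) * (16 * dd * q * iteration_bound k lam alpha / rho)
     = iteration_bound k lam alpha / T%:R by field; rewrite !gt_eqF.
  by rewrite ler_pdivlMr ?mul1r.
have by2 : b^-1 <= y by rewrite -(ler_pM2l b0) divff ?gt_eqF.
have S := log_vertices_le.
have qL0 : 0 <= 3 * (q * L) by rewrite !mulr_ge0// ltW.
have l2 : 0 <= 2 * lam by rewrite mulr_ge0// ltW.
apply: (@le_trans _ _ (2 * lam * y * (3 * (q * L)))).
  apply: (@le_trans _ _ (2 * lam / b * (3 * (q * L)))).
    by rewrite ler_wpM2l// divr_ge0// ltW.
  by rewrite ler_wpM2r// ler_wpM2l.
apply: le_trans (ler_wpM2r (ltW g20) sample_size_private).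
pose c := Num.sqrt dd * lam ^+ 2 * Num.sqrt q * q ^+ 3 * L * x ^+ 8 / (Num.sqrt rho * alpha).
have c0 : 0 < c by rewrite !(divr_gt0, mulr_gt0, exprn_gt0).
have -> : 2 * lam * y * (3 * (q * L)) = 6 * 2 ^+ 10 * c / q.
  by rewrite /y /c; field; rewrite !gt_eqF.
have -> : 2 ^+ 30 * (Num.sqrt dd * lam ^+ 2 * (q ^+ 5 * Num.sqrt q) * L ^+ 2 * x ^+ 34 /
    (Num.sqrt rho * alpha ^+ 3)) * g2 = 2 ^+ 20 * c * (L * x ^+ 10).
  by rewrite /g2 /c; field; rewrite !gt_eqF.
apply: (@le_trans _ _ (6 * 2 ^+ 10 * c)).
  rewrite ler_pdivrMr//; apply: ler_peMr; last by apply: le_trans q2; rewrite ler1n.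
  by apply: mulr_ge0; [rewrite mulr_ge0 ?exprn_ge0|exact: ltW].
apply: (@le_trans _ _ (2 ^+ 20 * c)).
  rewrite ler_pM2r//; have -> : 2 ^+ 20 = 2 ^+ 10 * 2 ^+ 10 :> R by rewrite -exprD.
  by rewrite ler_pM2r ?exprn_gt0// -natrX ler_nat.
apply: ler_peMr; first by apply: mulr_ge0; [rewrite exprn_ge0|exact: ltW].
by rewrite -[leLHS]mulr1; apply: ler_pM => //; exact: exprn_ege1.
Qed.

Lemma recovery_target :
  k.+1%:R ^+ 2 * expR (4 * lam) * (32 * expR (12 * lam) *
     (gap_target + 4 * lam * deviation_target) + 16 * lam ^+ 2 * deviation_target)
  <= (alpha / 2) ^+ 2.
Proof.
have xp : 0 < x by exact: expR_gt0.
have kp := qp.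
have g0 : 0 <= gap_target by rewrite divr_ge0// ?mulr_ge0 ?exprn_ge0 ?expR_ge0// ltW.
rewrite -qE !ex.
have -> : 4 * lam * deviation_target = gap_target.
  by rewrite /deviation_target; field; rewrite gt_eqF.
have -> : 16 * lam ^+ 2 * deviation_target = 4 * lam * gap_target.
  by rewrite /deviation_target; field; rewrite gt_eqF.
have lx : lam <= x ^+ 12.
  by apply: le_trans xl _; rewrite -[leLHS]expr1 ler_weXn2l.
have h : 32 * x ^+ 12 * (gap_target + gap_target) + 4 * lam * gap_target <= 68 * x ^+ 12 * gap_target.
  have := ler_wpM2r g0 lx; lra.
have c0 : 0 <= q ^+ 2 * x ^+ 4 by apply: mulr_ge0; [exact: sqr_ge0|rewrite exprn_ge0 ?expR_ge0].
apply: le_trans (ler_wpM2l c0 h) _.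
have -> : q ^+ 2 * x ^+ 4 * (68 * x ^+ 12 * gap_target) = 68 / 2 ^+ 9 * alpha ^+ 2.
  by rewrite /gap_target; field; rewrite !gt_eqF.
have -> : (alpha / 2) ^+ 2 = 128 / 2 ^+ 9 * alpha ^+ 2 by field.
by rewrite ler_wpM2r ?sqr_ge0// ler_wpM2r ?invr_ge0 ?exprn_ge0// ler_nat.
Qed.

End Numerics.

Section Accuracy.
Context (R : realType) (d k n : nat) (lam rho alpha : R) (D : graphical_model R d k.+1).
Notation pattern := {ffun 'I_k.+1 -> bool}.
Notation V := ('I_d * pattern)%type.
Hypotheses (centeredD : centered D) (widthD : width D <= lam).

Lemma centering_sum (f : 'I_k.+1 -> R) (b : 'I_k.+1) :
  \sum_(b' < k.+1) centering R k b b' * f b' = f b - (\sum_b' f b') / k.+1%:R.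
Proof.
rewrite (eq_bigr (fun b' : 'I_k.+1 => (b' == b)%:R * f b' - f b' / k.+1%:R)); last first.
  by move=> b' _; rewrite /centering val_eqE eq_sym; ring.
rewrite sumrB -mulr_suml; congr (_ - _).
by rewrite (bigD1 b)//= eqxx mul1r big1 ?addr0// => b' /negbTE ->; rewrite mul0r.
Qed.

(** Zero row sums make the centering in [b] harmless; zero column sums make the centering in [u]
    remove exactly the row of letter 0. *)
Lemma centered_difference (i j : 'I_d) (u b : 'I_k.+1) : i != j ->
  \sum_(u' < k.+1) centering R k u u' * (\sum_(b' < k.+1) centering R k b b' *
     (weight D i j u' b' - weight D i j ord0 b')) = weight D i j u b.
Proof.
move=> ij; have [rows cols] := centeredD ij.
rewrite (eq_bigr (fun u' : 'I_k.+1 => centering R k u u' * (weight D i j u' b - weight D i j ord0 b))); last first.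
  move=> u' _; congr (_ * _).
  by rewrite (centering_sum (fun b' => weight D i j u' b' - weight D i j ord0 b')) sumrB !rows subrr mul0r subr0.
rewrite (centering_sum (fun u' => weight D i j u' b - weight D i j ord0 b)).
rewrite sumrB cols sub0r sumr_const card_ord -[_ *+ _]mulr_natr.
have k0 : k.+1%:R != 0 :> R by rewrite pnatr_eq0.
by field.
Qed.

Definition fitting_error (T : nat) (H : seq V) (i : 'I_d) (u : 'I_k.+1) (j : 'I_d) (b : 'I_k.+1) : R :=
  2 * lam * fitted_point R T H i u j b - (weight D i j u b - weight D i j ord0 b).

(** The regressions control the error after centering in [b]; the centering in [u] at most doubles
    its supremum. *)
Lemma estimate_error T H (i j : 'I_d) (u b : 'I_k.+1) (a : R) : i != j ->
  (forall u' b', `|fitting_error T H i u' j b' - (\sum_b'' fitting_error T H i u' j b'') / k.+1%:R| <= a / 2) ->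
  `|weight D i j u b - estimate lam T H i j u b| <= a.
Proof.
move=> ij err.
pose er u' := fitting_error T H i u' j b - (\sum_b'' fitting_error T H i u' j b'') / k.+1%:R.
have -> : weight D i j u b - estimate lam T H i j u b =
   - (er u - (\sum_u' er u') / k.+1%:R).
  rewrite -(centering_sum er) -(centered_difference u b ij) /estimate mulr_sumr -sumrB -sumrN.
  apply: eq_bigr => u' _; rewrite /er -(centering_sum (fitting_error T H i u' j)).
  rewrite mulr_sumr mulr_sumr mulr_sumr -sumrB -sumrN; apply: eq_bigr => b' _.
  by rewrite /fitting_error; ring.
rewrite normrN; apply: le_trans (ler_normB _ _) _.
have kp : 0 < k.+1%:R :> R by rewrite ltr0n.
have h1 : `|er u| <= a / 2 by exact: err.
have h2 : `|(\sum_u' er u') / k.+1%:R| <= a / 2.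
  rewrite normrM normfV (ger0_norm (ltW kp)) ler_pdivrMr//.
  apply: le_trans (ler_norm_sum _ _ _) _.
  apply: le_trans (ler_sum _ (fun u' _ => err u' b)) _.
  by rewrite sumr_const card_ord mulr_natr.
lra.
Qed.

Lemma fitting_error_le T H i u j b : 0 < lam -> i != j -> `|fitting_error T H i u j b| <= 4 * lam.
Proof.
move=> lam0 ij.
have h1 : `|fitted_point R T H i u j b| <= 1.
  rewrite /fitted_point; case: unliftP => [u' _|_]; last by rewrite normr0.
  exact: inball_le (inball_fw_point R _).
have h2 := inball_le j b (inball_true_point widthD i u).
rewrite /true_point eq_sym (negbTE ij) in h2.
apply: le_trans (ler_normB _ _) _.
rewrite normrM ger0_norm; last by rewrite mulr_ge0// ltW.
have l2 : 0 <= 2 * lam by rewrite mulr_ge0// ltW.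
by have := ler_wpM2l l2 h1; lra.
Qed.

(** Fitted and true parameters lie in the same ball, so a fitting error is at most [4 lambda] and,
    once centered, at most [8 lambda <= alpha / 2], whatever was chosen. *)
Lemma accurate_trivial T H : 0 < lam -> 16 * lam <= alpha ->
  accurate D alpha (decode lam T H).
Proof.
move=> lam0 la i j u v ij; rewrite output_entry_decode//; apply: estimate_error => // u' b'.
apply: le_trans (ler_normB _ _) _.
have h b : `|fitting_error T H i u' j b| <= 4 * lam by exact: fitting_error_le.
have kp : 0 < k.+1%:R :> R by rewrite ltr0n.
have h2 : `|(\sum_b'' fitting_error T H i u' j b'') / k.+1%:R| <= 4 * lam.
  rewrite normrM normfV (ger0_norm (ltW kp)) ler_pdivrMr//.
  apply: le_trans (ler_norm_sum _ _ _) _.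
  apply: le_trans (ler_sum _ (fun b _ => h b)) _.
  by rewrite sumr_const card_ord mulr_natr.
by have := h b'; lra.
Qed.

Notation T := (iteration_count (iteration_bound k lam alpha) n).
Notation beta := (temperature k d T rho).
Context (i0 : 'I_d) (q0 : 'I_#|pattern|).
Hypotheses (i00 : i0 = 0%N :> nat) (q00 : q0 = 0%N :> nat).
Hypotheses (k1 : (1 <= k)%N) (d2 : (2 <= d)%N).
Hypotheses (lam0 : 0 < lam) (rho0 : 0 < rho) (alpha0 : 0 < alpha).
Hypothesis enough : sample_size d k n lam rho alpha k.+1%:R d%:R.
Hypothesis alpha_lt : alpha < 16 * lam.

Let K2 : 2 <= iteration_bound k lam alpha.
Proof. exact: (iteration_bound_ge2 k1 lam0 alpha0 erefl alpha_lt). Qed.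

Let KT : iteration_bound k lam alpha < T.+1%:R.
Proof.
apply: iteration_count_max.
exact: (iteration_bound_le d2 k1 lam0 alpha0 erefl erefl enough alpha_lt).
Qed.

Let TK : T%:R <= iteration_bound k lam alpha.
Proof. by apply: iteration_count_leK; apply: le_trans K2. Qed.

Let T0 : (0 < T)%N.
Proof. by have := le_lt_trans K2 KT; rewrite ltr_nat ltnS; apply: leq_trans. Qed.

Let n0 : (0 < n)%N.
Proof. by apply: leq_trans T0 (iteration_count_le _ _). Qed.

Notation eps := (deviation_target lam alpha k.+1%:R).
Notation gam := (gap_target lam alpha k.+1%:R).

Let gam0 : 0 < gam.
Proof. by rewrite divr_gt0 ?mulr_gt0 ?exprn_gt0 ?expR_gt0. Qed.

Let eps0 : 0 <= eps.
Proof. by rewrite divr_ge0 ?(ltW gam0)// mulr_ge0// ltW. Qed.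

Definition surprise_bound : R := ln (d * 2 ^ k.+1)%:R + ln (6 * (d * k.+1)%:R).

Definition regression_surprise (X : dataset n d k.+1) (r : nat) (H : seq V) : R :=
  path_sum (fun h b => step_weight R T r (size h) * surprisal (utility X lam T beta i0) h b) [::] H.

Lemma accurate_good (X : dataset n d k.+1) (H : seq V) : size H = (d * k * T)%N ->
  deviations_le D eps X ->
  (forall r, (r < d * k)%N -> regression_surprise X r H <= surprise_bound) ->
  accurate D alpha (decode lam T H).
Proof.
move=> sH dev sur i j u v ij; rewrite output_entry_decode//; apply: estimate_error => // u' b'.
(* At the reference letter both the fitted and the true difference vanish. *)
rewrite /fitting_error /fitted_point; case: unliftP => [w uE|->]; last first.
  rewrite mulr0 subrr subr0 big1 ?mul0r ?subrr ?normr0 ?divr_ge0 ?(ltW alpha0)// => b'' _.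
  by rewrite subrr subr0.
set r := (i * k + w)%N; set S := segment T r H.
have rM : (r < d * k)%N.
  apply: (@leq_trans (i.+1 * k)); first by rewrite mulSnr ltn_add2l.
  by rewrite leq_mul2r ltn_ord orbT.
have [nE lE] := node_letter i0 i w; rewrite /= -/r in nE lE.
have u0 : lift ord0 w != ord0 :> 'I_k.+1 by rewrite eq_sym neq_lift.
have b0 : 0 < beta by exact: expR_gt0.
have sS : size S = T.
  rewrite /S /segment size_take_min size_drop sH; apply/minn_idPl.
  by rewrite leq_subRL -?mulSnr leq_mul2r ?rM ?orbT// ltnW ?orbT.
have gap := @fw_gap_avg R d k n lam beta i (lift ord0 w) b0 u0 X _ S T (inball_true_point widthD i (lift ord0 w)) T0 sS.
have sr := sur r rM; rewrite /regression_surprise (path_sum_segment lam X beta i0 sH rM) nE lE -/S in sr.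
have gap' : fw_loss lam i (lift ord0 w) X S - empirical_loss i (lift ord0 w) X (true_point D i (lift ord0 w)) <= n%:R * gam.
  apply: le_trans gap _.
  apply: le_trans (optimization_error d2 k1 lam0 rho0 alpha0 erefl erefl enough T0 TK KT).
  rewrite lerD2r; apply: ler_wpM2l => //.
  by rewrite divr_ge0 ?(ltW b0)// mulr_ge0// ltW.
have ji : j != i by rewrite eq_sym.
have rec := recovery widthD b' eps0 lam0 n0 u0 ji dev (inball_fw_point R S) gap'.
have {}rec := le_trans rec (recovery_target lam0 alpha0 erefl).
rewrite /true_point (negbTE ji) -uE in rec.
rewrite -(ler_pXn2r (n := 2))// ?nnegrE ?divr_ge0 ?(ltW alpha0)//.
by rewrite real_normK ?num_real.
Qed.

(** Each regression fails with probability at most [1 / (6 d (k + 1))], and there are [d k] of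
    them. *)
Lemma surprise_prob (X : dataset n d k.+1) :
  5 / 6 <= \sum_(s : (d * k * T).-tuple V | [forall r : 'I_(d * k), regression_surprise X r s <= surprise_bound])
     likelihood (utility X lam T beta i0) [::] s.
Proof.
set U := utility X lam T beta i0.
pose v0 : V := (i0, enum_val q0).
have tot := likelihood_sum1 U (d * k * T) [::] v0.
rewrite (bigID (fun s : (d * k * T).-tuple V => [forall r : 'I_(d * k), regression_surprise X r s <= surprise_bound])) /= in tot.
set good := \sum_(s | _) _ in tot *; set bad := \sum_(s | _) _ in tot.
suff : bad <= 1 / 6 by move: tot; lra.
have cardV : #|{: V}| = (d * 2 ^ k.+1)%N by rewrite card_prod card_ffun !card_ord card_bool.
pose x : R := ln (6 * (d * k.+1)%:R).
have tail r : \sum_(s : (d * k * T).-tuple V | ~~ (regression_surprise X r s <= surprise_bound))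
    likelihood U [::] s <= expR (- x).
  have := @surprisal_tail R V U (step_weight R T r) v0 (d * k * T) x (step_weight_bounds R T r) (sum_step_weight R T r _).
  apply: le_trans; rewrite le_eqVlt; apply/orP; left; apply/eqP; apply: eq_bigl => s.
  by rewrite -ltNge /surprise_bound /x cardV.
have ub := @union_bound R _ _ (fun s : (d * k * T).-tuple V => likelihood U [::] s)
  (fun (r : 'I_(d * k)) s => regression_surprise X r s <= surprise_bound) (fun s => ltW (likelihood_gt0 _ _ _)).
apply: le_trans ub _; apply: le_trans (ler_sum _ (fun (r : 'I_(d * k)) _ => tail r)) _.
have dk0 : 0 < (d * k.+1)%:R :> R by rewrite ltr0n muln_gt0 (ltnW d2).
rewrite sumr_const card_ord -[_ *+ _]mulr_natl /x expRN lnK ?posrE ?mulr_gt0//.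
rewrite invfM mulrCA -[leRHS]mulr1 div1r; apply: ler_wpM2l; first by rewrite invr_ge0.
by rewrite ler_pdivrMr// mul1r ler_nat leq_mul2l leqnSn orbT.
Qed.

Lemma deviations_good : 5 / 6 <= \sum_(X : dataset n d k.+1 | deviations_le D eps X) iid_pmf D X.
Proof.
have tot : \sum_(X : dataset n d k.+1) iid_pmf D X = 1.
  by rewrite sum_tuple_prod gibbs_pmf_sum1 expr1n.
rewrite (bigID (deviations_le D eps)) /= in tot.
have h := deviations_prob n D eps0.
have h' := deviation_target_prob d2 k1 lam0 alpha0 erefl erefl enough.
have := le_trans h h'; move: tot.
set a := \sum_(X | _) _; set b := \sum_(X | _) _; lra.
Qed.

Context (t : nat).
Hypothesis mt : (d * k * T <= t)%N.
Notation mech := (mechanism rho i00 q00 mt).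

Lemma mechanism_accurate (X : dataset n d k.+1) : deviations_le D eps X ->
  ((5 / 6)%:E <= mech X (accurate D alpha))%E.
Proof.
move=> dev; rewrite mechanism_law lee_fin; apply: le_trans (surprise_prob X) _.
rewrite [leLHS]big_mkcond /=; apply: ler_sum => s _.
have l0 := ltW (likelihood_gt0 (utility X lam T beta i0) [::] s).
case: ifP => [/forallP good|_]; last by rewrite mulr_ge0// indicE.
rewrite indicE mem_set ?mulr1//=.
apply: (@accurate_good X) => //; first by rewrite size_tuple.
by move=> r rM; exact: (good (Ordinal rM)).
Qed.

Lemma success_good : ((2 / 3)%:E < success_prob D mech (accurate D alpha))%E.
Proof.
have p0 X : 0 <= iid_pmf D X by apply: prodr_ge0 => ? _; exact: gibbs_pmf_ge0.
(* Good samples and good choices each have probability at least [5 / 6], and [25 / 36 > 2 / 3]. *)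
apply: (@lt_le_trans _ _ ((\sum_(X : dataset n d k.+1 | deviations_le D eps X) iid_pmf D X * (5 / 6))%:E)).
  by rewrite lte_fin -mulr_suml; have := deviations_good; lra.
rewrite /success_prob -sumEFin big_mkcond /=; apply: lee_sum => X _.
case: ifP => dev; last by rewrite mule_ge0 ?lee_fin.
by rewrite EFinM lee_wpmul2l ?lee_fin//; exact: mechanism_accurate.
Qed.

End Accuracy.

Section TrivialAccuracy.
Context (R : realType) (d k n : nat) (lam rho alpha : R) (D : graphical_model R d k.+1).
Hypotheses (centeredD : centered D) (widthD : width D <= lam).

Lemma success_trivial (M : dataset n d k.+1 -> probability (weights_array R d k.+1) R) :
  (forall X, M X (accurate D alpha) = 1%E) ->
  ((2 / 3)%:E < success_prob D M (accurate D alpha))%E.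
Proof.
move=> M1; rewrite /success_prob (eq_bigr (fun X => (iid_pmf D X)%:E)); last first.
  by move=> X _; rewrite M1 mule1.
by rewrite sumEFin sum_tuple_prod gibbs_pmf_sum1 expr1n lte_fin; lra.
Qed.

End TrivialAccuracy.

Theorem mainTheorem1 (R : realType) :
  exists C c : R, 0 < C /\ 0 < c /\
  forall k : nat, (2 <= k)%N ->
  exists (prog : program) (A B : nat),
  forall (d : nat) (lambda rho alpha : R),
    (2 <= d)%N -> 0 < lambda -> 0 < rho -> 0 < alpha ->
  forall n : nat,
  exists M : dataset n d k -> probability (weights_array R d k) R,
    implements prog (A * (n + d) ^ B)%N lambda rho alpha M /\
    zCDP rho M /\
    forall D : graphical_model R d k,
      centered D -> width D <= lambda ->
      C * (lambda ^+ 2 * k%:R ^+ 5 * ln (d * k)%:R * expR (c * lambda)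
             / alpha ^+ 4
           + Num.sqrt d%:R * lambda ^+ 2 * k%:R `^ (11 / 2)
               * ln (d * k)%:R ^+ 2 * expR (c * lambda)
             / (Num.sqrt rho * alpha ^+ 3)) <= n%:R ->
      ((2 / 3)%:E < success_prob D M (accurate D alpha))%E.
Proof.
(* The constant [2^30] is what the exponent [16 q L] of the deviation bound requires. That bound
   consumes [e^(32 lambda)], and 34 leaves a margin. *)
exists (2 ^+ 30), 34; split; first by rewrite exprn_gt0.
split=> // -[|[|k]] // _.
have [A [B clk]] := clock_code R k.+1.
exists (code k.+1), A, B => d lam rho alpha d2 lam0 rho0 alpha0 n.
have d0 : (0 < d)%N by exact: ltnW.
have Q0 : (0 < #|{ffun 'I_k.+2 -> bool}|)%N by rewrite card_ffun card_bool expn_gt0.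
pose i0 := Ordinal d0; pose q0 := Ordinal Q0.
have i00 : i0 = 0%N :> nat by [].
have q00 : q0 = 0%N :> nat by [].
pose T := iteration_count (iteration_bound k.+1 lam alpha) n.
pose X0 : dataset n d k.+2 := [tuple [tuple ord0 | _ < d] | _ < n].
(* Every draw takes time, so the clock bounds the number of draws. That number does not depend on
   the dataset or the tape, so one arbitrary run suffices. *)
have mt : (d * k.+1 * T <= A * (n + d) ^ B)%N.
  have [_ dr] := exec_code lam rho alpha i00 q00 X0 (fun=> 0).
  have := clk d n lam rho alpha X0 (fun=> 0) d0.
  have := draws_le_clock (fun=> 0) (code k.+1) (input_store lam rho alpha X0).
  move: dr; move: (exec _ _ _) => s -> /=; rewrite !addn0; exact: leq_trans.
exists (mechanism rho i00 q00 mt); split; [|split].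
- move=> X run output; split; first by move=> tape _; exact: clk.
  by split; [exact: (measurable_output_fun rho i00 q00 mt X)|].
- exact: mechanism_zCDP.
- move=> D cD wD enough.
  (* For large [alpha] the iteration bound may fall below 1, but then every output is accurate. *)
  have [small|large] := ltP alpha (16 * lam); first exact: success_good.
  apply: success_trivial => X.
  rewrite /mechanism /= /distribution /pushforward /= (output_funE lam rho alpha i00 q00) -[RHS](probability_setT (uniform_tape R (A * (n + d) ^ B))).
  congr (uniform_tape _ _ _); apply/seteqP; split => // r _.
  exact: accurate_trivial.
Qed.
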